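(* Let $\{K_k:k=1,\dots,d\}$ be an augmented Agler decomposition for the Schur-class function $S\in\mathcal S(\mathcal E,\mathcal E_* )$ which is strictly closely connected. Then there is an essentially unique (up to unitary equivalence) closely connected GR-unitary colligation $U$ realizing $S$ and compatible with $\{K_k\}$, and an essentially unique (not necessarily minimal) associated scattering system $\mathfrak S(\Sigma(U))$, which can be constructed in functional-model form as follows. The subspaces $\mathcal D$ and $\mathcal R$ (see context) are equal to all of $\widehat\bigoplus_{k=1}^d\mathcal H(K_k)\widehat\oplus\mathcal E$ and $\widehat\bigoplus_{k=1}^d\mathcal H(K_k)\widehat\oplus\mathcal E_*$ respectively, and the operator $V$ (see context) is unitary between them. Define $$U=\begin{bmatrix}A&B\\ C&D\end{bmatrix}:\begin{bmatrix}\widehat\bigoplus_{k=1}^d\mathcal H(K_k)\\ \mathcal E\end{bmatrix}\to\begin{bmatrix}\widehat\bigoplus_{k=1}^d\mathcal H(K_k)\\ \mathcal E_*\end{bmatrix}$$ by $U=V$. Construct the system $\mathfrak S_{\Omega^B}(\Sigma(U))$ (see context), with scattering space $$\mathcal V^{\Omega^B}=\widehat\bigoplus_{k=1}^d\widehat\bigoplus_{n\in\Xi}z^n\mathcal H(K_k).$$ Then $\mathfrak S_{\Omega^B}(\Sigma(U))$ is a multievolution scattering system with embedded GR-unitary colligation $U$ compatible with the given augmented Agler decomposition $\{K_k:k=1,\dots,d\}$.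
   Context: **Formal series and kernels.** $\mathcal G[[z^{\pm1}]]$ is the space of formal Laurent series $\sum_{n\in\mathbb Z^d}f_nz^n$ with coefficients in the Hilbert space $\mathcal G$ and arbitrary support. Convention: $(z^n)^*=z^{-n}$, $H(z)^*=\sum H_n^*z^{-n}$. A kernel $K(z,w)=\sum K_{n,m}z^nw^{-m}$ with coefficients in $\mathcal L(\mathcal G)$ is positive if $\sum\langle K_{n,m}u_m,u_n\rangle\ge0$ for finitely supported $(u_n)$; equivalently $K=H(z)H(w)^*$. $\mathcal H(K)$ is the unique Hilbert space of formal series containing all $[K]_m(z)u:=\sum_nK_{n,m}u\,z^n$ with $\langle f,[K]_mu\rangle=\langle f_m,u\rangle$. **Augmented Agler decomposition.** $\mathcal S(\mathcal E,\mathcal E_* )$: holomorphic contractive-operator-valued functions on $\mathbb D^d$, identified with Taylor series $S(z)=\sum_{n\in\mathbb Z_+^d}S_nz^n$ ($S_n=0$ otherwise). An augmented Agler decomposition of $S$ is a collection of positive kernels $K_k=H_k(z)H_k(w)^*$ with coefficients in $\mathcal L(\mathcal E_*\oplus\mathcal E)$, $H_k=\begin{bmatrix}H_k^1\\ H_k^2\end{bmatrix}$, $H_k^1$ supported in $\mathbb Z_+^d$, $H_k^2$ supported in $-\mathbf e_k-\mathbb Z_+^d$, with $$\begin{bmatrix}I-S(z)S(w)^*&S(w)-S(z)\\ S(z)^*-S(w)^*&S(z)^*S(w)-I\end{bmatrix}=\sum_{k=1}^d(1-z_kw_k^{-1})K_k(z,w).$$ It is strictly closely connected if the sum maps $\widehat\bigoplus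 f_k\mapsto\sum f_k$ on the external direct sums $\widehat\bigoplus\mathcal H(K_k)$ and $\widehat\bigoplus z_k\mathcal H(K_k)$ are both injective. **$\mathcal D$, $\mathcal R$, $V$.** $\mathcal D$ is the closed span of the vectors $\big([K_1]_m(z)\binom{e_*}{e},\dots,[K_d]_m(z)\binom{e_*}{e},\,S_m^*e_*+\delta_{m,0}e\big)$ and $\mathcal R$ the closed span of $\big([K_1]_{m-\mathbf e_1}(z)\binom{e_*}{e},\dots,[K_d]_{m-\mathbf e_d}(z)\binom{e_*}{e},\,\delta_{m,0}e_*+S_{-m}e\big)$, over $e_*\in\mathcal E_*,e\in\mathcal E,m\in\mathbb Z^d$; $V:\mathcal D\to\mathcal R$ is the unitary operator sending each generator of $\mathcal D$ to the generator of $\mathcal R$ with the same $m,e_*,e$. **Colligations.** A GR-unitary colligation is a unitary $U=\begin{bmatrix}A&B\\ C&D\end{bmatrix}:\mathcal H\oplus\mathcal E\to\mathcal H\oplus\mathcal E_*$ with $\mathcal H=\bigoplus_{k=1}^d\mathcal H_k$, $P_k$ the projection onto $\mathcal H_k$, $Z(z)=\sum z_kP_k$. It realizes $S$ if $S(z)=D+C(I-Z(z)A)^{-1}Z(z)B$; compatible with $\{K_k\}$ if $K_k(z,w)=\Gamma_k(z)\Gamma_k(w)^*$, $\Gamma_k(z)=\begin{bmatrix}C(I-Z(z)A)^{-1}\\ z_k^{-1}B^*(I-Z(z)^{-1}A^* )^{-1}\end{bmatrix}P_k$. It is closely connected if $\mathcal H$ is the smallest closed subspace containing $\operatorname{im}B,\operatorname{im}C^*$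 and invariant under $A,A^*,P_1,\dots,P_d$. **Scattering systems.** A multievolution scattering system is $(\mathcal K;\mathcal U=(\mathcal U_1,\dots,\mathcal U_d);\mathcal F,\mathcal F_* )$ with $\mathcal U_k$ commuting unitaries on $\mathcal K$ and $\mathcal F,\mathcal F_*$ wandering ($\mathcal U^n\mathcal F\perp\mathcal F$, $\mathcal U^n\mathcal F_*\perp\mathcal F_*$ for $n\ne0$). Let $\Omega^B=\{n\in\mathbb Z^d:n_1+\cdots+n_d\ge0\}$, $\Xi=\{n:n_1+\cdots+n_d=0\}$. Trajectories of $U$ are functions $(u,x,y):\mathbb Z^d\to\mathcal E\times\mathcal H\times\mathcal E_*$ with $P_kx(n+\mathbf e_k)=P_k(Ax(n)+Bu(n))$, $y(n)=Cx(n)+Du(n)$; admissible ones, with $\|(u,x,y)\|^2=\sum_{\Omega^B}\|u(n)\|^2+\sum_{\Xi}\|x(n)\|^2+\sum_{\mathbb Z^d\setminus\Omega^B}\|y(n)\|^2<\infty$, form the Hilbert space $\mathcal T$. $\mathfrak S(\Sigma(U))=(\mathcal T;\mathcal U;\mathcal F,\mathcal F_* )$ with $(\mathcal U_k\xi)(n)=\xi(n-\mathbf e_k)$; $\mathcal F$ is the set of $(u,x,y)\in\mathcal T$ with $u|_{\Omega^B\setminus\{0\}}=0$, $x|_\Xi=0$, $y|_{\mathbb Z^d\setminus\Omega^B}=0$; $\mathcal F_*=\mathcal U_1\mathcal F_{*}^{0}$ with $\mathcal F_*^0$ the set of $(u,x,y)\in\mathcal T$ with $u|_{\Omega^B}=0$,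 $x|_\Xi=0$, $y(n)=0$ for $n\in(\mathbb Z^d\setminus\Omega^B)\setminus\{-\mathbf e_1\}$. $\mathfrak S_{\Omega^B}(\Sigma(U))$ is the system obtained by transporting $\mathfrak S(\Sigma(U))$ through the unitary map $(u,x,y)\mapsto(y|_{\mathbb Z^d\setminus\Omega^B},x|_\Xi,u|_{\Omega^B})$ onto $\mathcal T_{\Omega^B}=\ell^2(\mathbb Z^d\setminus\Omega^B,\mathcal E_* )\oplus\bigoplus_k\ell^2(\Xi,\mathcal H_k)\oplus\ell^2(\Omega^B,\mathcal E)$; thus $\mathcal U_k^*(\vec e_*,\vec x,\vec e)=(\vec e_*',\vec x',\vec e')$ with $\vec e'(n)=\vec e(n+\mathbf e_k)$; $\vec x'(n,j)=\sum_{j'}A_{jj'}\vec x(n+\mathbf e_k-\mathbf e_j,j')+B_j\vec e(n+\mathbf e_k-\mathbf e_j)$; $\vec e_*'(n)=\vec e_*(n+\mathbf e_k)$ if $n+\mathbf e_k\notin\Omega^B$ and $\vec e_*'(n)=\sum_jC_j\vec x(n+\mathbf e_k,j)+D\vec e(n+\mathbf e_k)$ if $n+\mathbf e_k\in\Xi$. Its scattering space is $\bigoplus_k\ell^2(\Xi,\mathcal H_k)$; with $\mathcal H_k=\mathcal H(K_k)$ it is identified with $\widehat\bigoplus_k\widehat\bigoplus_{n\in\Xi}z^n\mathcal H(K_k)$. ''With embedded GR-unitary colligation $U$'' means unitarily equivalent to $\mathfrak S(\Sigma(U))$. *)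

(* Defs.v *)
From HB Require Import structures.
From mathcomp Require Import all_boot all_order all_algebra complex.
From mathcomp Require Import mathcomp_extra boolp classical_sets functions.
From mathcomp Require Import cardinality fsbigop reals ereal topology.
From mathcomp Require Import normedtype sequences esum.

Set Implicit Arguments.
Unset Strict Implicit.
Unset Printing Implicit Defensive.

Import Order.TTheory GRing.Theory Num.Theory.
Import numFieldNormedType.Exports.
Local Open Scope classical_set_scope.
Local Open Scope ring_scope.
Local Open Scope complex_scope.

(* A Hilbert space is presented as a set of vectors of an ambient complex
   vector space (of formal series, of sequences, of trajectories, ...) with
   its own inner product, linear in the first argument.  The values of the
   inner product, and of operators, outside the underlying set are irrelevant.
   The record carries only the data; the axioms are in [is_hilbert]. *)
Record hspace (R : realType) (V : lmodType R[i]) := HSpace {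
  hset : set V;
  hip : V -> V -> R[i] }.

HB.instance Definition _ (R : realType) (V : lmodType R[i]) :=
  gen_eqMixin (hspace V).
HB.instance Definition _ (R : realType) (V : lmodType R[i]) :=
  gen_choiceMixin (hspace V).

Section Hilbert.
Variable R : realType.
Local Notation C := R[i].
Local Notation modulus := (@Normc.normc R).
Implicit Types V W : lmodType C.

Definition hnorm V (H : hspace V) (x : V) : R :=
  Num.sqrt (complex.Re (hip H x x)).

Definition hcvg V (H : hspace V) (u : nat -> V) (l : V) : Prop :=
  (fun n => hnorm H (u n - l)) @ \oo --> (0 : R).

Definition hcauchy V (H : hspace V) (u : nat -> V) : Prop :=
  forall eps : R, 0 < eps -> exists N : nat, forall m n : nat,
    (N <= m)%N -> (N <= n)%N -> hnorm H (u m - u n) < eps.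

Definition linear_set V (M : set V) : Prop :=
  M 0 /\ forall (a : C) x y, M x -> M y -> M (a *: x + y).

Record is_hilbert V (H : hspace V) : Prop := IsHilbert {
  hilbert_linear : linear_set (hset H);
  hip_linear : forall (a : C) x y z, hset H x -> hset H y -> hset H z ->
    hip H (a *: x + y) z = a * hip H x z + hip H y z;
  hip_conj : forall x y, hset H x -> hset H y -> hip H y x = (hip H x y)^*%C;
  hip_ge0 : forall x, hset H x -> 0 <= hip H x x;
  hip_eq0 : forall x, hset H x -> hip H x x = 0 -> x = 0;
  hilbert_complete : forall u : nat -> V, (forall n, hset H (u n)) ->
    hcauchy H u -> exists2 l, hset H l & hcvg H u l }.

Definition closed_subspace V (H : hspace V) (M : set V) : Prop :=
  [/\ M `<=` hset H, linear_set M
    & forall (u : nat -> V) l, (forall n, M (u n)) -> hset H l ->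
        hcvg H u l -> M l].

Definition closed_span V (H : hspace V) (G : set V) : set V :=
  [set x | forall M, closed_subspace H M -> G `<=` M -> M x].

Definition hsub V (H : hspace V) (M : set V) : hspace V := HSpace M (hip H).

Definition linear_on V W (H : hspace V) (T : V -> W) : Prop :=
  forall (a : C) x y, hset H x -> hset H y -> T (a *: x + y) = a *: T x + T y.

Definition bounded_op V W (H1 : hspace V) (H2 : hspace W) (T : V -> W) : Prop :=
  [/\ forall x, hset H1 x -> hset H2 (T x),
      linear_on H1 T
    & exists M : R, forall x, hset H1 x -> hnorm H2 (T x) <= M * hnorm H1 x].

Definition unitary V W (H1 : hspace V) (H2 : hspace W) (T : V -> W) : Prop :=
  [/\ forall x, hset H1 x -> hset H2 (T x),
      linear_on H1 T,
      forall y, hset H2 y -> exists2 x, hset H1 x & T x = y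
    & forall x y, hset H1 x -> hset H1 y -> hip H2 (T x) (T y) = hip H1 x y].

Definition adj V W (H1 : hspace V) (H2 : hspace W) (T : V -> W) (y : W) : V :=
  xget 0 [set z | hset H1 z /\
                  forall x, hset H1 x -> hip H2 (T x) y = hip H1 x z].

Definition has_usum (I : choiceType) (A : set I) (f : I -> C) (s : C) : Prop :=
  forall eps : R, 0 < eps -> exists2 F0, fsets A F0 & forall F, fsets A F ->
    F0 `<=` F -> modulus (\sum_(i \in F) f i - s) < eps.

Definition usum (I : choiceType) (A : set I) (f : I -> C) : C :=
  xget 0 [set s | has_usum A f s].

Definition square_summable (I : choiceType) V (A : set I)
    (H : I -> hspace V) (f : I -> V) : Prop :=
  (\esum_(i in A) (hnorm (H i) (f i) ^+ 2)%:E < +oo)%E.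

Definition hprod V W (H1 : hspace V) (H2 : hspace W) : hspace (V * W)%type :=
  HSpace [set x : V * W | hset H1 x.1 /\ hset H2 x.2]
         (fun x y => hip H1 x.1 y.1 + hip H2 x.2 y.2).

(* The Hilbert direct sum of the H i over i in A; families are extended by 0
   outside A.  For a constant family this is l^2(A, H). *)
Definition hdsum (I : choiceType) V (A : set I) (H : I -> hspace V) :
    hspace (I -> V) :=
  HSpace [set f : I -> V | [/\ forall i, A i -> hset (H i) (f i),
                               forall i, ~ A i -> f i = 0
                             & square_summable A H f]]
         (fun f g => usum A (fun i => hip (H i) (f i) (g i))).

Definition ell2 (I : choiceType) V (A : set I) (H : hspace V) :
    hspace (I -> V) :=
  hdsum A (fun=> H).

End Hilbert.

Notation Zd d := 'rV[int]_d.+1.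

Section FormalSeries.
Variables (R : realType) (d : nat).
Local Notation C := R[i].
Implicit Types V : lmodType C.

Definition evec (k : 'I_d.+1) : Zd d := delta_mx 0 k.

Definition nonneg_idx : set (Zd d) := [set n | forall i, 0 <= n 0 i].

(* A formal series is its family of coefficients n |-> f_n, and a kernel sends
   (n, m) to the coefficient of z^n w^(-m). *)
Definition kernel (T : Type) : Type := Zd d -> Zd d -> T -> T.

Definition zmul (T : Type) (n : Zd d) (f : Zd d -> T) : Zd d -> T :=
  fun m => f (m - n).

Definition zmulH V (n : Zd d) (H : hspace (Zd d -> V)) : hspace (Zd d -> V) :=
  HSpace [set zmul n f | f in hset H]
         (fun f g => hip H (zmul (- n) f) (zmul (- n) g)).

Definition positive_kernel V (G : hspace V) (K : kernel V) : Prop :=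
  (forall n m, bounded_op G G (K n m)) /\
  forall (F : set (Zd d)) (u : Zd d -> V), finite_set F ->
    (forall n, hset G (u n)) ->
    0 <= \sum_(n \in F) \sum_(m \in F) hip G (K n m (u m)) (u n).

(* [K]_m(z) u *)
Definition ksec (T : Type) (K : kernel T) (m : Zd d) (u : T) : Zd d -> T :=
  fun n => K n m u.

Definition is_rkhs V (G : hspace V) (K : kernel V) (H : hspace (Zd d -> V)) :
    Prop :=
  [/\ is_hilbert H,
      forall f n, hset H f -> hset G (f n),
      forall m u, hset G u -> hset H (ksec K m u)
    & forall f m u, hset H f -> hset G u ->
        hip H f (ksec K m u) = hip G (f m) u].

Definition rkhs V (G : hspace V) (K : kernel V) : hspace (Zd d -> V) :=
  xget (HSpace [set 0] (fun _ _ => 0)) [set H | is_rkhs G K H].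

End FormalSeries.

Section Schur.
Variables (R : realType) (d : nat).
Local Notation C := R[i].
Local Notation modulus := (@Normc.normc R).
Variables (VE VEs : lmodType C) (E : hspace VE) (Es : hspace VEs).

Definition polydisk : set 'rV[C]_d.+1 := [set z | forall k, modulus (z 0 k) < 1].

(* Complex (Frechet) differentiability for the operator norm. *)
Definition holomorphic_ops (S : 'rV[C]_d.+1 -> VE -> VEs) : Prop :=
  forall z, polydisk z -> exists2 L : 'I_d.+1 -> VE -> VEs,
    forall k, bounded_op E Es (L k) &
    forall eps : R, 0 < eps -> exists2 delta : R, 0 < delta &
      forall h, polydisk (z + h) -> \sum_k modulus (h 0 k) < delta ->
        forall e, hset E e ->
          hnorm Es (S (z + h) e - S z e - \sum_k h 0 k *: L k e)
            <= eps * (\sum_k modulus (h 0 k)) * hnorm E e.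

Definition schur_class (S : 'rV[C]_d.+1 -> VE -> VEs) : Prop :=
  [/\ forall z, polydisk z -> bounded_op E Es (S z),
      forall z e, polydisk z -> hset E e -> hnorm Es (S z e) <= hnorm E e
    & holomorphic_ops S].

Definition zmon (z : 'rV[C]_d.+1) (n : Zd d) : C := \prod_k z 0 k ^ n 0 k.

(* The series converges unconditionally in operator norm at each point. *)
Definition taylor_series (S : 'rV[C]_d.+1 -> VE -> VEs)
    (Sn : Zd d -> VE -> VEs) : Prop :=
  [/\ forall n, bounded_op E Es (Sn n),
      forall n e, ~ nonneg_idx n -> hset E e -> Sn n e = 0
    & forall z, polydisk z -> forall eps : R, 0 < eps ->
        exists2 F0 : set (Zd d), finite_set F0 &
          forall F, finite_set F -> F0 `<=` F -> forall e, hset E e ->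
            hnorm Es (\sum_(n \in F) zmon z n *: Sn n e - S z e)
              <= eps * hnorm E e].

End Schur.

Section Agler.
Variables (R : realType) (d : nat).
Local Notation C := R[i].
Variables (VE VEs : lmodType C) (E : hspace VE) (Es : hspace VEs).
Variables (Sn : Zd d -> VE -> VEs).
Variable K : 'I_d.+1 -> kernel d (VEs * VE)%type.
Local Notation G := (hprod Es E).

Definition delta0 (V : lmodType C) (n : Zd d) (x : V) : V :=
  if n == 0 then x else 0.

(* Coefficient of z^n w^(-m) in
     [ I - S(z)S(w)^*    S(w) - S(z)    ]
     [ S(z)^* - S(w)^*   S(z)^*S(w) - I ]
   where S(z)^* = sum_n S_n^* z^(-n), so that S(w) and S(z)^* contribute
   S_(-m) and S_(-n)^*. *)
Definition agler_lhs (n m : Zd d) (g : VEs * VE) : VEs * VE :=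
  let St k := adj E Es (Sn k) in
  (delta0 n (delta0 m g.1) - Sn n (St m g.1)
     + (delta0 n (Sn (- m) g.2) - delta0 m (Sn n g.2)),
   delta0 m (St (- n) g.1) - delta0 n (St m g.1)
     + (St (- n) (Sn (- m) g.2) - delta0 n (delta0 m g.2))).

(* K = H(z)H(w)^*, the components of H being supported in Z_+^d and in
   - e_k - Z_+^d respectively. *)
Definition agler_factor (k : 'I_d.+1) : Prop :=
  exists (W : lmodType C) (X : hspace W) (H : Zd d -> W -> VEs * VE),
  [/\ is_hilbert X,
      forall n, bounded_op X G (H n),
      forall n x, hset X x -> ~ nonneg_idx n -> (H n x).1 = 0,
      forall n x, hset X x -> ~ nonneg_idx (- evec k - n) -> (H n x).2 = 0
    & forall n m g, hset G g -> K k n m g = H n (adj X G (H m) g)].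

Definition augmented_agler_decomposition : Prop :=
  [/\ forall k, positive_kernel G (K k),
      forall k, agler_factor k
    & forall n m g, hset G g ->
        agler_lhs n m g =
        \sum_k (K k n m g - K k (n - evec k) (m - evec k) g)].

Definition HK (k : 'I_d.+1) : hspace (Zd d -> (VEs * VE)%type) :=
  rkhs G (K k).

Definition sum_map (f : 'I_d.+1 -> Zd d -> (VEs * VE)%type) :
    Zd d -> (VEs * VE)%type :=
  \sum_k f k.

Definition strictly_closely_connected : Prop :=
  let inj X := forall f g, hset X f -> hset X g ->
    sum_map f = sum_map g -> f = g in
  inj (hdsum setT HK) /\ inj (hdsum setT (fun k => zmulH (evec k) (HK k))).

Definition genD (m : Zd d) (es : VEs) (e : VE) :
    ('I_d.+1 -> Zd d -> (VEs * VE)%type) * VE :=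
  (fun k => ksec (K k) m (es, e), adj E Es (Sn m) es + delta0 m e).

Definition genR (m : Zd d) (es : VEs) (e : VE) :
    ('I_d.+1 -> Zd d -> (VEs * VE)%type) * VEs :=
  (fun k => ksec (K k) (m - evec k) (es, e), delta0 m es + Sn (- m) e).

Definition spaceD :=
  closed_span (hprod (hdsum setT HK) E)
    [set x | exists m es e, [/\ hset Es es, hset E e & x = genD m es e]].

Definition spaceR :=
  closed_span (hprod (hdsum setT HK) Es)
    [set x | exists m es e, [/\ hset Es es, hset E e & x = genR m es e]].

Definition is_V
    (V : ('I_d.+1 -> Zd d -> (VEs * VE)%type) * VE ->
         ('I_d.+1 -> Zd d -> (VEs * VE)%type) * VEs) : Prop :=
  unitary (hsub (hprod (hdsum setT HK) E) spaceD)
          (hsub (hprod (hdsum setT HK) Es) spaceR) V /\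
  forall m es e, hset Es es -> hset E e -> V (genD m es e) = genR m es e.

End Agler.

(* The state space is the direct sum of the spaces cspace k, which are taken
   inside one common ambient vector space; cmap is U itself, as a map
   (x, e) |-> (A x + B e, C x + D e). *)
Record colligation (R : realType) (d : nat) (V VE VEs : lmodType R[i]) :=
  Colligation {
    cspace : 'I_d.+1 -> hspace V;
    cmap : ('I_d.+1 -> V) * VE -> ('I_d.+1 -> V) * VEs }.

Section Colligation.
Variables (R : realType) (d : nat).
Local Notation C := R[i].
Variables (VE VEs : lmodType C) (E : hspace VE) (Es : hspace VEs).
Local Notation coll V := (colligation d V VE VEs).

Section Blocks.
Variables (V : lmodType C) (U : coll V).
Local Notation VX := ('I_d.+1 -> V).

Definition state : hspace VX := hdsum setT (cspace U).
Definition blockA (x : VX) : VX := (cmap U (x, 0)).1.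
Definition blockB (e : VE) : VX := (cmap U (0, e)).1.
Definition blockC (x : VX) : VEs := (cmap U (x, 0)).2.
Definition blockD (e : VE) : VEs := (cmap U (0, e)).2.

Definition GR_unitary : Prop :=
  (forall k, is_hilbert (cspace U k)) /\
  unitary (hprod state E) (hprod state Es) (cmap U).

Definition proj (k : 'I_d.+1) (x : VX) : VX :=
  fun j => if j == k then x j else 0.

Definition Zop (z : 'rV[C]_d.+1) (x : VX) : VX := \sum_k z 0 k *: proj k x.

Definition realizes (S : 'rV[C]_d.+1 -> VE -> VEs) : Prop :=
  forall z, polydisk z -> exists2 T : VX -> VX,
    [/\ bounded_op state state T,
        forall x, hset state x -> T (x - Zop z (blockA x)) = x
      & forall x, hset state x -> T x - Zop z (blockA (T x)) = x] &
    forall e, hset E e -> S z e = blockD e + blockC (T (Zop z (blockB e))).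

(* Coefficient of z^n in the formal power (Z(z) T)^j. *)
Fixpoint Zpow (T : VX -> VX) (j : nat) (n : Zd d) (x : VX) : VX :=
  if j is i.+1 then \sum_k proj k (T (Zpow T i (n - evec k) x))
  else if n == 0 then x else 0.

(* Coefficient of z^n in (I - Z(z) T)^(-1) = sum_j (Z(z) T)^j; only the power
   j = |n| contributes to it.  It vanishes unless n is in Z_+^d. *)
Definition resolvent (T : VX -> VX) (n : Zd d) (x : VX) : VX :=
  Zpow T (\sum_i absz (n 0%R i))%N n x.

(* Coefficient of z^n in Gamma_k(z).  In the second component, z^(-p) in
   (I - Z(z)^(-1) A^* )^(-1) contributes to n = - e_k - p. *)
Definition Gamma (k : 'I_d.+1) (n : Zd d) (x : VX) : VEs * VE :=
  (blockC (resolvent blockA n (proj k x)),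
   adj E state blockB
     (resolvent (adj state state blockA) (- evec k - n) (proj k x))).

Definition compatible (K : 'I_d.+1 -> kernel d (VEs * VE)%type) : Prop :=
  forall k n m g, hset (hprod Es E) g ->
    K k n m g = Gamma k n (adj state (hprod Es E) (Gamma k m) g).

Definition closely_connected : Prop :=
  forall M : set VX, closed_subspace state M ->
    (forall e, hset E e -> M (blockB e)) ->
    (forall es, hset Es es -> M (adj state Es blockC es)) ->
    (forall x, M x -> M (blockA x)) ->
    (forall x, M x -> M (adj state state blockA x)) ->
    (forall k x, M x -> M (proj k x)) ->
    M = hset state.

End Blocks.

Definition colligation_equiv (V V' : lmodType C) (U : coll V) (U' : coll V') :
    Prop :=
  exists tau : 'I_d.+1 -> V -> V',
    let Tau (x : 'I_d.+1 -> V) := fun k => tau k (x k) in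
    (forall k, unitary (cspace U k) (cspace U' k) (tau k)) /\
    forall x e, hset (state U) x -> hset E e ->
      cmap U' (Tau x, e) = (Tau (cmap U (x, e)).1, (cmap U (x, e)).2).

End Colligation.

Record scattering_data (R : realType) (d : nat) (W : lmodType R[i]) :=
  ScatteringData {
    sK : hspace W;
    sU : 'I_d.+1 -> W -> W;
    sF : set W;
    sFs : set W }.

Section Scattering.
Variables (R : realType) (d : nat).
Local Notation C := R[i].

Section Systems.
Variables (W : lmodType C) (s : scattering_data d W).

(* U^n = U_1^(n_1) ... U_d^(n_d), with U_k^(-1) = U_k^* *)
Definition zpower (T : W -> W) (p : int) : W -> W :=
  match p with
  | Posz j => iter j T
  | Negz j => iter j.+1 (adj (sK s) (sK s) T)
  end.

Definition Upow (n : Zd d) : W -> W :=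
  \big[(fun f g => f \o g)/idfun]_(k < d.+1) zpower (sU s k) (n 0 k).

Definition wandering (F : set W) : Prop :=
  forall n f g, n != 0 -> F f -> F g -> hip (sK s) (Upow n f) g = 0.

Definition scattering_system : Prop :=
  [/\ is_hilbert (sK s),
      forall k, unitary (sK s) (sK s) (sU s k),
      forall j k x, hset (sK s) x -> sU s j (sU s k x) = sU s k (sU s j x),
      closed_subspace (sK s) (sF s) /\ wandering (sF s)
    & closed_subspace (sK s) (sFs s) /\ wandering (sFs s)].

(* The orthogonal complement of the outgoing space spanned by the U^n F, n in
   Om, and the incoming space spanned by the U^n F_*, n not in Om. *)
Definition scattering_space (Om : set (Zd d)) : set W :=
  [set x | [/\ hset (sK s) x,
      forall n f, Om n -> sF s f -> hip (sK s) x (Upow n f) = 0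
    & forall n f, ~ Om n -> sFs s f -> hip (sK s) x (Upow n f) = 0]].

Definition transport (W' : lmodType C) (K' : hspace W') (Phi : W -> W') :
    scattering_data d W' :=
  let Psi y := xget 0 [set x | hset (sK s) x /\ Phi x = y] in
  ScatteringData K' (fun k y => Phi (sU s k (Psi y)))
    [set Phi x | x in sF s] [set Phi x | x in sFs s].

End Systems.

Definition scattering_equiv (W W' : lmodType C)
    (s : scattering_data d W) (s' : scattering_data d W') : Prop :=
  exists tau : W -> W',
    [/\ unitary (sK s) (sK s') tau,
        forall k x, hset (sK s) x -> tau (sU s k x) = sU s' k (tau x),
        [set tau x | x in sF s] = sF s'
      & [set tau x | x in sFs s] = sFs s'].

Definition OmegaB : set (Zd d) := [set n | 0 <= \sum_i n 0 i].
Definition Xi : set (Zd d) := [set n | \sum_i n 0 i = 0].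

Variables (VE VEs V : lmodType C) (E : hspace VE) (Es : hspace VEs).
Variable U : colligation d V VE VEs.
Local Notation VX := ('I_d.+1 -> V).
Local Notation VT := (Zd d -> (VE * VX * VEs)%type).
Local Notation VOm := ((Zd d -> VEs) * ('I_d.+1 -> Zd d -> V) * (Zd d -> VE))%type.

Definition tu (xi : VT) (n : Zd d) : VE := (xi n).1.1.
Definition tx (xi : VT) (n : Zd d) : VX := (xi n).1.2.
Definition ty (xi : VT) (n : Zd d) : VEs := (xi n).2.

Definition trajectory : set VT :=
  [set xi | [/\ forall n, hset (hprod (hprod E (state U)) Es) (xi n),
      forall n k, tx xi (n + evec k) k =
                  (blockA U (tx xi n) + blockB U (tu xi n)) k
    & forall n, ty xi n = blockC U (tx xi n) + blockD U (tu xi n)]].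

Definition admissible : set VT :=
  [set xi | [/\ square_summable OmegaB (fun=> E) (tu xi),
      square_summable Xi (fun=> state U) (tx xi)
    & square_summable (~` OmegaB) (fun=> Es) (ty xi)]].

Definition spaceT : hspace VT :=
  HSpace (trajectory `&` admissible)
    (fun xi xi' => usum OmegaB (fun n => hip E (tu xi n) (tu xi' n))
       + usum Xi (fun n => hip (state U) (tx xi n) (tx xi' n))
       + usum (~` OmegaB) (fun n => hip Es (ty xi n) (ty xi' n))).

Definition Tshift (k : 'I_d.+1) (xi : VT) : VT := fun n => xi (n - evec k).

Definition TF : set VT :=
  [set xi | [/\ hset spaceT xi,
      forall n, OmegaB n -> n <> 0 -> tu xi n = 0,
      forall n, Xi n -> tx xi n = 0
    & forall n, ~ OmegaB n -> ty xi n = 0]].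

Definition TFs0 : set VT :=
  [set xi | [/\ hset spaceT xi,
      forall n, OmegaB n -> tu xi n = 0,
      forall n, Xi n -> tx xi n = 0
    & forall n, ~ OmegaB n -> n <> - evec ord0 -> ty xi n = 0]].

Definition system_T : scattering_data d VT :=
  ScatteringData spaceT Tshift TF [set Tshift ord0 xi | xi in TFs0].

Definition spaceTOm : hspace VOm :=
  hprod (hprod (ell2 (~` OmegaB) Es)
               (hdsum setT (fun k => ell2 Xi (cspace U k))))
        (ell2 OmegaB E).

Definition restrict_to (I : Type) (V' : lmodType C) (A : set I) (f : I -> V') :
    I -> V' :=
  fun n => if `[< A n >] then f n else 0.

Definition PhiOm (xi : VT) : VOm :=
  (restrict_to (~` OmegaB) (ty xi),
   fun k => restrict_to Xi (fun n => tx xi n k),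
   restrict_to OmegaB (tu xi)).

Definition system_Om : scattering_data d VOm :=
  transport system_T spaceTOm PhiOm.

(* The explicit form of U_k^* on (e_*, x, e). *)
Definition model_shift_adj (k : 'I_d.+1) (t : VOm) : VOm :=
  let: (es, x, e) := t in
  (restrict_to (~` OmegaB) (fun n =>
     if `[< OmegaB (n + evec k) >]
     then blockC U (fun j => x j (n + evec k)) + blockD U (e (n + evec k))
     else es (n + evec k)),
   fun j => restrict_to Xi (fun n =>
     blockA U (fun i => x i (n + evec k - evec j)) j
       + blockB U (e (n + evec k - evec j)) j),
   restrict_to OmegaB (fun n => e (n + evec k))).

End Scattering.

(* A family (f_(k,n)), f_(k,n) in z^n H_k, is identified with the element
   (0, x, 0) where x(n, k) = z^(-n) f_(k,n) is in H_k. *)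
Definition scattering_embedding (R : realType) (d : nat)
    (VG VE VEs : lmodType R[i]) (f : 'I_d.+1 -> Zd d -> Zd d -> VG) :
    (Zd d -> VEs) * ('I_d.+1 -> Zd d -> Zd d -> VG) * (Zd d -> VE) :=
  (0, fun k n => zmul (- n) (f k n), 0).

(* Main.v *)
Require Import Defs.
From HB Require Import structures.
From mathcomp Require Import all_boot all_order all_algebra complex.
From mathcomp Require Import mathcomp_extra boolp classical_sets functions.
From mathcomp Require Import cardinality fsbigop reals ereal topology.
From mathcomp Require Import normedtype sequences esum.
From mathcomp Require Import ring lra zify.

(** Write H for the direct sum of the spaces H(K_k). Pairing a vector (f, e) of
    H + E with the generators of D, and a vector of H + E_* with those of R, reads
    off the coefficients of
      sum_k f_k(z) + (S(z) e, e)   and   sum_k z_k f_k(z) + (e', S(z)^* e'),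
    the observations [obsD] and [obsR]. The Agler decomposition says that the two
    families of generators have the same Gram matrix ([agler_obs]), so there is a
    unitary V between their closed spans ([gram_unitary], [V_exists]). A vector
    orthogonal to all generators of D has zero observation; by the supports of the
    two components of the elements of H(K_k), the coefficient of z^0 forces e = 0,
    and injectivity of the sum map forces f = 0. Hence D, and likewise R with the
    shifted sum map, is everything ([spaceD_full], [spaceR_full]).

    The equation obsR (V p) = obsD p then determines V, and it is a recursion for
    the coefficients of C (I - Z A)^(-1) x and of its dual counterpart. Since
    x itself solves this recursion, Gamma_k(z) x = x_k(z) ([model_Gamma]).
    Compatibility, close connectedness and the formal transfer function of V all
    follow from this. Every GR-unitary colligation U satisfies an analogous
    relation between input and output observations ([colligation_identity]). If U
    is compatible with the K_k and realizes S, then strict close connectedness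
    makes the states invisible to all Gamma_k a reducing subspace, which vanishes
    when U is closely connected. The maps x |-> Gamma_k(z) x are then unitary onto
    the H(K_k) ([model_map_unitary]) and carry U to an operator with the property
    that determines V ([model_equiv]).

    Realization of the function S and the formal transfer function are linked by
    the Neumann series: the degree j part of (I - Z A)^(-1) is (Z A)^j, and the
    error of a partial sum is C (Z A)^J applied to a fixed vector, which tends to
    0 since A is a contraction and |z_k| < 1 ([transfer_sum_cvg]). Conversely a
    several-variable power series is determined by its sums ([slices_unique]).

    On the scattering side, U is invertible, so the trajectory recursion runs
    forwards and backwards and a trajectory is determined by free data on Omega^B
    ([ext_traj], [PhiOm_unitary]). Unitarity of U at the points of one level makes
    the shifts isometric ([tnorm2_shift]). On the data, a vector
    of F is a single input at 0 and a vector of U_1^* F_* a single output at - e_1;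
    this gives the wandering property and identifies the scattering space as the
    vectors whose two outer components vanish ([scattering_spaceE]). *)

Set Implicit Arguments.
Unset Strict Implicit.
Unset Printing Implicit Defensive.

Import Order.TTheory GRing.Theory Num.Theory.
Import numFieldNormedType.Exports.
Local Open Scope classical_set_scope.
Local Open Scope ring_scope.

Local Notation cproj := Defs.proj.

(** * Hilbert space calculus *)

Section ComplexFacts.
Variable R : realType.
Local Open Scope complex_scope.
Implicit Types a b x : R[i].

Lemma modulus_ge0 x : 0 <= Normc.normc x.
Proof. by case: x => u v; rewrite /Normc.normc sqrtr_ge0. Qed.

Lemma modulusD x y : Normc.normc (x + y : R[i]) <= Normc.normc x + Normc.normc y.
Proof. exact: le_normcD. Qed.

Lemma modulusN x : Normc.normc (- x) = Normc.normc x.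
Proof. exact: normcN. Qed.

Lemma modulus_real (r : R) : Normc.normc r%:C = `|r|.
Proof. by rewrite /Normc.normc /= expr0n /= addr0 sqrtr_sqr. Qed.

Lemma modulus_conj x : Normc.normc x^*%C = Normc.normc x.
Proof. by case: x => u v; rewrite /Normc.normc /= sqrrN. Qed.

Lemma mulr_conj x : x * x^*%C = (Normc.normc x ^+ 2)%:C.
Proof. by rewrite -sqr_normc -rmorphXn. Qed.

Lemma realC_inj (r s : R) : r%:C = s%:C -> r = s.
Proof. by case. Qed.

Lemma ReD x y : complex.Re (x + y : R[i]) = complex.Re x + complex.Re y.
Proof. by case: x y => [? ?] [? ?]. Qed.

Lemma ReN x : complex.Re (- x) = - complex.Re x.
Proof. by case: x. Qed.

Lemma Re_sum (I : Type) (r : seq I) (P : pred I) (F : I -> R[i]) :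
  complex.Re (\sum_(i <- r | P i) F i) = \sum_(i <- r | P i) complex.Re (F i).
Proof. by apply: (big_morph (@complex.Re R) ReD). Qed.

Lemma Re_conj x : complex.Re x^*%C = complex.Re x.
Proof. by case: x. Qed.

Lemma Re_ReC (r : R) : complex.Re r%:C = r.
Proof. by []. Qed.

Lemma Re_realM (r : R) x : complex.Re (r%:C * x) = r * complex.Re x.
Proof. by case: x => u v /=; rewrite mul0r subr0. Qed.

Lemma ge0_realC x : 0 <= x -> x = (complex.Re x)%:C.
Proof. by move=> /ger0_Im; case: x => u v /= ->. Qed.

Lemma conjcM x y : (x * y)^*%C = x^*%C * y^*%C.
Proof. exact: rmorphM. Qed.

Lemma conjcD x y : (x + y)^*%C = x^*%C + y^*%C.
Proof. exact: rmorphD. Qed.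

Lemma conjcN x : (- x)^*%C = - x^*%C.
Proof. exact: rmorphN. Qed.

Lemma realCM (r s : R) : (r * s)%:C = r%:C * s%:C.
Proof. exact: rmorphM. Qed.

(** Bounds on real parts become bounds on moduli after such a rotation. *)
Lemma modulus_rot x : exists2 w : R[i], w * w^*%C = 1 & w * x = (Normc.normc x)%:C.
Proof.
have [->|x0] := eqVneq x 0.
  by exists 1; rewrite ?mulr0 ?Normc.normc0 // conjc1 mulr1.
set m := Normc.normc x; have m0 : m != 0.
  by apply: contra_neq x0 => /Normc.eq0_normc.
have xx : x^*%C * x = (m ^+ 2)%:C by rewrite mulrC mulr_conj.
exists (x^*%C * m^-1%:C).
  rewrite conjcM conjcK conjc_real mulrACA xx -!realCM.
  by congr (_%:C); field.
by rewrite mulrAC xx -realCM; congr (_%:C); field.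
Qed.

End ComplexFacts.

Create HintDb hil.
Ltac hs := solve [auto 14 with hil].

Section HilbertBasics.
Variable R : realType.
Local Open Scope complex_scope.
Implicit Types V W : lmodType R[i].

Lemma hset0 V (H : hspace V) : is_hilbert H -> hset H 0.
Proof. by case=> -[]. Qed.

Lemma hsetZD V (H : hspace V) a x y :
  is_hilbert H -> hset H x -> hset H y -> hset H (a *: x + y).
Proof. by case=> -[_ h] *; apply: h. Qed.

Lemma hsetZ V (H : hspace V) a x : is_hilbert H -> hset H x -> hset H (a *: x).
Proof. by move=> hH hx; rewrite -[_ *: _]addr0; apply: hsetZD => //; apply: hset0. Qed.

Lemma hsetD V (H : hspace V) x y :
  is_hilbert H -> hset H x -> hset H y -> hset H (x + y).
Proof. by move=> *; rewrite -[x]scale1r; apply: hsetZD. Qed.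

Lemma hsetN V (H : hspace V) x : is_hilbert H -> hset H x -> hset H (- x).
Proof. by move=> *; rewrite -scaleN1r; apply: hsetZ. Qed.

Lemma hsetB V (H : hspace V) x y :
  is_hilbert H -> hset H x -> hset H y -> hset H (x - y).
Proof. by move=> *; apply: hsetD => //; apply: hsetN. Qed.

Lemma hset_sum V (H : hspace V) (I : Type) (r : seq I) (P : pred I) (F : I -> V) :
  is_hilbert H -> (forall i, hset H (F i)) -> hset H (\sum_(i <- r | P i) F i).
Proof. by move=> hH h; elim/big_rec: _ => [|i x _ hx]; [exact: hset0|exact: hsetD]. Qed.

Lemma hset_delta0 d V (H : hspace V) (n : Zd d) x :
  is_hilbert H -> hset H x -> hset H (delta0 n x).
Proof. by move=> hH hx; rewrite /delta0; case: ifP => // _; apply: hset0. Qed.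

End HilbertBasics.

#[global] Hint Resolve hset0 hsetZD hsetZ hsetD hsetN hsetB hset_sum hset_delta0 : hil.

Section Hip.
Variables (R : realType) (V : lmodType R[i]) (H : hspace V).
Hypothesis hH : is_hilbert H.
Local Open Scope complex_scope.

Lemma hipDl x y z : hset H x -> hset H y -> hset H z ->
  hip H (x + y) z = hip H x z + hip H y z.
Proof. by move=> *; rewrite -[x in LHS]scale1r (hip_linear hH) ?mul1r. Qed.

Lemma hip0l z : hset H z -> hip H 0 z = 0.
Proof.
move=> hz; have h0 := hset0 hH; apply: (addrI (hip H 0 z)).
by rewrite -hipDl // addr0 addr0.
Qed.

Lemma hipZl a x z : hset H x -> hset H z -> hip H (a *: x) z = a * hip H x z.
Proof.
move=> hx hz; rewrite -[a *: x]addr0 (hip_linear hH) ?hip0l ?addr0 //.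
exact: hset0.
Qed.

Lemma hipNl x z : hset H x -> hset H z -> hip H (- x) z = - hip H x z.
Proof. by move=> *; rewrite -scaleN1r hipZl ?mulN1r. Qed.

Lemma hipBl x y z : hset H x -> hset H y -> hset H z ->
  hip H (x - y) z = hip H x z - hip H y z.
Proof. by move=> *; rewrite hipDl ?hipNl //; hs. Qed.

Lemma hipDr x y z : hset H x -> hset H y -> hset H z ->
  hip H x (y + z) = hip H x y + hip H x z.
Proof.
move=> *; rewrite (hip_conj hH (x := y + z)) ?hipDl ?conjcD //; last by hs.
by rewrite -!(hip_conj hH).
Qed.

Lemma hip0r z : hset H z -> hip H z 0 = 0.
Proof. by move=> hz; rewrite (hip_conj hH (x := 0)) ?hip0l ?conjc0 //; hs. Qed.

Lemma hipZr a x z : hset H x -> hset H z -> hip H x (a *: z) = a^*%C * hip H x z.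
Proof.
move=> *; rewrite (hip_conj hH (x := a *: z)) ?hipZl ?conjcM //; last by hs.
by rewrite -(hip_conj hH).
Qed.

Lemma hipNr x z : hset H x -> hset H z -> hip H x (- z) = - hip H x z.
Proof. by move=> *; rewrite -scaleN1r hipZr // conjcN conjc1 mulN1r. Qed.

Lemma hipBr x y z : hset H x -> hset H y -> hset H z ->
  hip H x (y - z) = hip H x y - hip H x z.
Proof. by move=> *; rewrite hipDr ?hipNr //; hs. Qed.

Lemma hip_suml (I : Type) (r : seq I) (F : I -> V) z :
  (forall i, hset H (F i)) -> hset H z ->
  hip H (\sum_(i <- r) F i) z = \sum_(i <- r) hip H (F i) z.
Proof.
move=> hF hz; elim: r => [|i r IH]; first by rewrite !big_nil hip0l.
by rewrite !big_cons hipDl ?IH //; hs.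
Qed.

Lemma hip_sumr (I : Type) (r : seq I) (F : I -> V) z :
  (forall i, hset H (F i)) -> hset H z ->
  hip H z (\sum_(i <- r) F i) = \sum_(i <- r) hip H z (F i).
Proof.
move=> hF hz; elim: r => [|i r IH]; first by rewrite !big_nil hip0r.
by rewrite !big_cons hipDr ?IH //; hs.
Qed.

Lemma hnorm_ge0 x : 0 <= hnorm H x.
Proof. exact: sqrtr_ge0. Qed.

Lemma sqr_hnorm x : hset H x -> hnorm H x ^+ 2 = complex.Re (hip H x x).
Proof.
move=> hx; rewrite /hnorm sqr_sqrtr //.
by have := hip_ge0 hH hx; rewrite lecE => /andP[].
Qed.

Lemma hipxx x : hset H x -> hip H x x = (hnorm H x ^+ 2)%:C.
Proof. by move=> hx; rewrite sqr_hnorm //; apply: ge0_realC; apply: hip_ge0. Qed.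

Lemma hnorm0 : hnorm H 0 = 0.
Proof. by rewrite /hnorm hip0l ?sqrtr0 //; hs. Qed.

Lemma hnorm_eq0 x : hset H x -> hnorm H x = 0 -> x = 0.
Proof. by move=> hx h; apply: (hip_eq0 hH) => //; rewrite hipxx // h expr0n. Qed.

Lemma hnormZ a x : hset H x -> hnorm H (a *: x) = Normc.normc a * hnorm H x.
Proof.
move=> hx; rewrite /hnorm hipZl ?hipZr //; last by hs.
rewrite mulrA mulr_conj Re_realM sqrtrM ?sqr_ge0 // sqrtr_sqr ger0_norm //.
exact: modulus_ge0.
Qed.

Lemma hnormN x : hset H x -> hnorm H (- x) = hnorm H x.
Proof.
by move=> hx; rewrite -scaleN1r hnormZ // modulusN Normc.normc1 mul1r.
Qed.

Lemma sqr_hnormD x y : hset H x -> hset H y ->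
  hnorm H (x + y) ^+ 2 =
  hnorm H x ^+ 2 + hnorm H y ^+ 2 + 2 * complex.Re (hip H x y).
Proof.
move=> hx hy; rewrite !sqr_hnorm //; try hs.
rewrite hipDl ?hipDr //; try hs.
rewrite (hip_conj hH hx hy) !ReD Re_conj; ring.
Qed.

Lemma Re_cauchy_schwarz x y : hset H x -> hset H y ->
  complex.Re (hip H x y) <= hnorm H x * hnorm H y.
Proof.
move=> hx hy; set a := hnorm H x; set b := hnorm H y.
have [a0|a0] := eqVneq a 0.
  by rewrite (hnorm_eq0 hx a0) hip0l // a0 mul0r.
have [b0|b0] := eqVneq b 0.
  by rewrite (hnorm_eq0 hy b0) hip0r // b0 mulr0.
have ap : 0 < a by rewrite lt_neqAle eq_sym a0 hnorm_ge0.
have bp : 0 < b by rewrite lt_neqAle eq_sym b0 hnorm_ge0.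
have := sqr_ge0 (hnorm H (b%:C *: x + (- a)%:C *: y)).
rewrite sqr_hnormD //; try hs.
rewrite !hnormZ // hipZl ?hipZr //; try hs.
rewrite conjc_real !Re_realM !modulus_real normrN !gtr0_norm // -/a -/b.
set p := complex.Re _ => h.
have {}h : 0 <= (2 * a * b) * (a * b - p) by move: h; congr (_ <= _); ring.
by move: h; rewrite pmulr_rge0 ?subr_ge0 // !mulr_gt0.
Qed.

Lemma cauchy_schwarz x y : hset H x -> hset H y ->
  Normc.normc (hip H x y) <= hnorm H x * hnorm H y.
Proof.
move=> hx hy; have [w w1 wx] := modulus_rot (hip H x y).
have mw : Normc.normc w = 1.
  apply/eqP; rewrite -(@eqrXn2 _ 2) ?modulus_ge0 // expr1n; apply/eqP/realC_inj.
  by rewrite -mulr_conj w1.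
by rewrite -[Normc.normc _]Re_ReC -wx -hipZl // -[hnorm H x]mul1r -mw -hnormZ //
  Re_cauchy_schwarz //; hs.
Qed.

Lemma hnormD x y : hset H x -> hset H y ->
  hnorm H (x + y) <= hnorm H x + hnorm H y.
Proof.
move=> hx hy; rewrite -(@ler_pXn2r _ 2) ?nnegrE ?addr_ge0 ?hnorm_ge0 //.
by rewrite sqr_hnormD // sqrrD; have := Re_cauchy_schwarz hx hy; lra.
Qed.

Lemma hnormB x y : hset H x -> hset H y ->
  hnorm H (x - y) <= hnorm H x + hnorm H y.
Proof. by move=> hx hy; rewrite -(hnormN hy) hnormD //; hs. Qed.

Lemma hnorm_le_dist x y : hset H x -> hset H y ->
  hnorm H x <= hnorm H y + hnorm H (x - y).
Proof.
by move=> hx hy; rewrite -{1}[x](subrK y) addrC hnormD //; hs.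
Qed.

Lemma hnorm_sum (I : Type) (r : seq I) (P : pred I) (F : I -> V) :
  (forall i, hset H (F i)) ->
  hnorm H (\sum_(i <- r | P i) F i) <= \sum_(i <- r | P i) hnorm H (F i).
Proof.
move=> hF; elim: r => [|i r IH]; first by rewrite !big_nil hnorm0.
rewrite !big_cons; case: ifP => // _.
by apply: le_trans (hnormD _ _) _; rewrite ?lerD2l //; hs.
Qed.

Lemma polarization x y : hset H x -> hset H y ->
  hip H x y = 4%:R^-1 * (hip H (x + y) (x + y) - hip H (x - y) (x - y)
    + 'i%C * hip H (x + 'i%C *: y) (x + 'i%C *: y)
    - 'i%C * hip H (x - 'i%C *: y) (x - 'i%C *: y)).
Proof.
move=> hx hy.
have ci : ('i%C : R[i])^*%C = - 'i%C by rewrite /=; apply/eqP; rewrite eq_complex /= oppr0 !eqxx.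
rewrite !(hipDl, hipDr, hipBl, hipBr, hipNl, hipNr, hipZl, hipZr) //; try hs.
rewrite ci; set p := hip H x x; set q := hip H y y; set s := hip H x y; set t := hip H y x.
have i2 : ('i%C : R[i]) * 'i%C = -1 by rewrite -expr2 sqr_i.
have c4 : (4%:R : R[i]) != 0 by rewrite pnatr_eq0.
apply: (mulfI c4); rewrite mulrA mulfV // mul1r.
transitivity (2 * s + 2 * t - 2 * ('i%C * 'i%C) * s + 2 * ('i%C * 'i%C) * t); last by ring.
by rewrite i2; ring.
Qed.

(** A vector is determined by its inner products; this is how identities in a
    Hilbert space are checked on generators. *)
Lemma hip_inj x y : hset H x -> hset H y ->
  (forall z, hset H z -> hip H x z = hip H y z) -> x = y.
Proof.
move=> hx hy h; apply/eqP; rewrite -subr_eq0; apply/eqP.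
by apply: (hip_eq0 hH); try hs; rewrite hipBl ?h ?subrr //; hs.
Qed.

End Hip.

Section Maps.
Variable R : realType.
Local Open Scope complex_scope.
Variables (V W : lmodType R[i]) (H1 : hspace V) (H2 : hspace W) (T : V -> W).
Hypothesis hH1 : is_hilbert H1.
Hypothesis linT : linear_on H1 T.

Lemma lin0 : T 0 = 0.
Proof.
have h0 := hset0 hH1; have := linT 1 h0 h0.
rewrite !scale1r addr0 => e; apply: (addrI (T 0)).
by rewrite -e addr0.
Qed.

Lemma linD x y : hset H1 x -> hset H1 y -> T (x + y) = T x + T y.
Proof. by move=> hx hy; rewrite -[x in LHS]scale1r linT // scale1r. Qed.

Lemma linZ a x : hset H1 x -> T (a *: x) = a *: T x.
Proof.
by move=> hx; rewrite -[a *: x]addr0 linT ?lin0 ?addr0 //; apply: hset0.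
Qed.

Lemma linN x : hset H1 x -> T (- x) = - T x.
Proof. by move=> hx; rewrite -scaleN1r linZ // scaleN1r. Qed.

Lemma linB x y : hset H1 x -> hset H1 y -> T (x - y) = T x - T y.
Proof. by move=> hx hy; rewrite linD ?linN //; hs. Qed.

Lemma lin_sum (I : Type) (r : seq I) (F : I -> V) :
  (forall i, hset H1 (F i)) -> T (\sum_(i <- r) F i) = \sum_(i <- r) T (F i).
Proof.
move=> hF; elim: r => [|i r IH]; first by rewrite !big_nil lin0.
by rewrite !big_cons linD ?IH //; hs.
Qed.

Lemma lin_delta0 d (n : Zd d) x : hset H1 x -> T (delta0 n x) = delta0 n (T x).
Proof. by rewrite /delta0; case: ifP => // _; rewrite lin0. Qed.

End Maps.

Section Unitary.
Variable R : realType.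
Variables (V W : lmodType R[i]) (H1 : hspace V) (H2 : hspace W) (T : V -> W).
Hypothesis unT : unitary H1 H2 T.

Lemma unitary_hset x : hset H1 x -> hset H2 (T x).
Proof. by case: unT => h _ _ _; apply: h. Qed.

Lemma unitary_lin : linear_on H1 T.
Proof. by case: unT. Qed.

Lemma unitary_hip x y : hset H1 x -> hset H1 y -> hip H2 (T x) (T y) = hip H1 x y.
Proof. by case: unT => _ _ _ h; apply: h. Qed.

Lemma unitary_hnorm x : hset H1 x -> hnorm H2 (T x) = hnorm H1 x.
Proof. by move=> hx; rewrite /hnorm unitary_hip. Qed.

Lemma unitary_inj x y : is_hilbert H1 -> hset H1 x -> hset H1 y -> T x = T y -> x = y.
Proof.
move=> hH1 hx hy e; apply: (hip_inj hH1) => // z hz.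
by rewrite -!unitary_hip // e.
Qed.

(** Completeness of the space of trajectories is obtained in this way from
    that of the space of data. *)
Lemma unitary_hilbert : is_hilbert H1 -> is_hilbert H2.
Proof.
move=> hH1; case: unT => hT lT sT iT; have l0 := lin0 hH1 lT; split.
- split; first by rewrite -l0; apply: hT; hs.
  by move=> a _ _ /sT[x hx <-] /sT[y hy <-]; rewrite -lT //; apply: hT; hs.
- move=> a _ _ _ /sT[x hx <-] /sT[y hy <-] /sT[z hz <-].
  by rewrite -lT // !iT ?(hip_linear hH1) //; hs.
- by move=> _ _ /sT[x hx <-] /sT[y hy <-]; rewrite !iT // (hip_conj hH1).
- by move=> _ /sT[x hx <-]; rewrite iT // (hip_ge0 hH1).
- by move=> _ /sT[x hx <-]; rewrite iT // => /(hip_eq0 hH1) -> //.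
move=> u hu cu.
have /choice[v hv] : forall n, exists x, hset H1 x /\ T x = u n.
  by move=> n; have [x hx e] := sT _ (hu n); exists x.
have nT x y : hset H1 x -> hset H1 y -> hnorm H2 (T x - T y) = hnorm H1 (x - y).
  by move=> hx hy; rewrite -(linB hH1 lT) // unitary_hnorm //; hs.
have hv1 n : hset H1 (v n) by case: (hv n).
have [||l hl cl] := hilbert_complete hH1 (u := v) => //.
  move=> e e0; have [N hN] := cu e e0; exists N => m n hm hn.
  by have := hN m n hm hn; rewrite -!(hv _).2 nT.
exists (T l); first exact: hT.
rewrite /hcvg; apply: cvg_trans cl; apply: near_eq_cvg; near=> n.
by rewrite -(hv n).2 nT.
Unshelve. all: by end_near.
Qed.

(** This is the inverse map that the transport of a scattering system uses. *)
Definition uinv (y : W) : V := xget 0 [set x | hset H1 x /\ T x = y].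

Lemma uinvP y : hset H2 y -> hset H1 (uinv y) /\ T (uinv y) = y.
Proof.
case: unT => _ _ sT _ hy; have [x hx e] := sT _ hy.
exact: (@xgetI _ 0 [set x | hset H1 x /\ T x = y] x (conj hx e)).
Qed.

Lemma uinvK x : is_hilbert H1 -> hset H1 x -> uinv (T x) = x.
Proof.
move=> hH1 hx; have [hy e] := uinvP (unitary_hset hx).
exact: unitary_inj e.
Qed.

Lemma unitary_uinv : is_hilbert H1 -> unitary H2 H1 uinv.
Proof.
move=> hH1; have hH2 := unitary_hilbert hH1; split.
- by move=> y /uinvP[].
- move=> a x y hx hy; have [ux ex] := uinvP hx; have [uy ey] := uinvP hy.
  by rewrite -{1}ex -{1}ey -unitary_lin // uinvK //; hs.
- by move=> x hx; exists (T x); [exact: unitary_hset | exact: uinvK].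
- move=> x y hx hy; have [ux ex] := uinvP hx; have [uy ey] := uinvP hy.
  by rewrite -unitary_hip // ex ey.
Qed.

Lemma unitary_adj y : is_hilbert H1 -> hset H2 y -> adj H1 H2 T y = uinv y.
Proof.
move=> hH1 hy; have [ux ex] := uinvP hy; rewrite /adj.
have : [set z | hset H1 z /\ forall x, hset H1 x -> hip H2 (T x) y = hip H1 x z]
    (uinv y) by split => // x hx; rewrite -{1}ex unitary_hip.
move=> hu; have [hz hh] := xgetI 0 hu; apply: (hip_inj hH1) => // z hz'.
rewrite (hip_conj hH1 (x := z)) // -hh //.
by rewrite (hip_conj hH1 (x := z)) // -[in RHS]unitary_hip // ex.
Qed.

End Unitary.

(** * Closed subspaces, orthogonal projection and adjoints *)

Section Convergence.
Variables (R : realType) (V : lmodType R[i]) (H : hspace V).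
Hypothesis hH : is_hilbert H.
Local Open Scope complex_scope.

Lemma hcvgP (u : nat -> V) l :
  hcvg H u l <-> forall e : R, 0 < e -> exists N : nat, forall n, (N <= n)%N ->
    hnorm H (u n - l) < e.
Proof.
split=> [/cvgrPdist_lt h e e0|h].
  have [N _ hN] := h e e0; exists N => n hn.
  by have := hN n hn; rewrite /= sub0r normrN ger0_norm ?hnorm_ge0.
apply/cvgrPdist_lt => e e0; have [N hN] := h e e0; exists N => // n hn /=.
by rewrite sub0r normrN ger0_norm ?hnorm_ge0 ?hN.
Qed.

Lemma hcvg_cauchy u l : (forall n, hset H (u n)) -> hset H l ->
  hcvg H u l -> hcauchy H u.
Proof.
move=> hu hl /hcvgP h e e0; have [|N hN] := h (e / 2); first by rewrite divr_gt0.
exists N => m n hm hn; rewrite [e]splitr.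
have -> : u m - u n = (u m - l) - (u n - l) by rewrite opprB addrA subrK.
by apply: le_lt_trans (hnormB hH _ _) _; [hs|hs|rewrite ltrD ?hN].
Qed.

Lemma modulus_small (x : R[i]) M :
  (forall e : R, 0 < e -> Normc.normc x <= e * M) -> x = 0.
Proof.
move=> h; apply: Normc.eq0_normc; apply/eqP; rewrite eq_le modulus_ge0 andbT.
rewrite leNgt; apply/negP => p0.
have M0 : 0 < `|M| + 1 by rewrite ltr_wpDl.
have := h (Normc.normc x / (2 * (`|M| + 1))).
rewrite divr_gt0 ?mulr_gt0 // => /(_ isT) hx.
have : Normc.normc x / (2 * (`|M| + 1)) * M <= Normc.normc x / 2.
  rewrite invfM mulrA -mulrA ler_piMr ?divr_ge0 ?modulus_ge0 //.
  by rewrite mulrC ler_pdivrMr // mul1r; have := ler_norm M; lra.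
lra.
Qed.

(** Orthogonality passes to limits, so orthogonal complements are closed. *)
Lemma hip_lim u l y : (forall n, hset H (u n)) -> hset H l -> hset H y ->
  hcvg H u l -> (forall n, hip H (u n) y = 0) -> hip H l y = 0.
Proof.
move=> hu hl hy /hcvgP h u0; apply: (@modulus_small _ (hnorm H y)) => e e0.
have [N hN] := h e e0.
have -> : hip H l y = - hip H (u N - l) y by rewrite hipBl // u0 sub0r opprK.
rewrite modulusN; apply: le_trans (cauchy_schwarz hH _ _) _; try hs.
by rewrite ler_wpM2r ?hnorm_ge0 // ltW // hN.
Qed.

Definition perp (G : set V) : set V :=
  [set x | hset H x /\ forall g, G g -> hip H x g = 0].

Lemma perp_closed G : G `<=` hset H -> closed_subspace H (perp G).
Proof.
move=> hG; split; first by move=> x [].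
- split; first by split=> [|g /hG hg]; [hs | rewrite hip0l].
  move=> a x y [hx px] [hy py]; split; first by hs.
  by move=> g gg; have hg := hG _ gg; rewrite (hip_linear hH) ?px ?py ?mulr0 ?addr0.
move=> u l hu hl cl; split=> // g gg.
apply: (hip_lim (u := u)) => //; [by move=> n; case: (hu n)|exact: hG|].
by move=> n; case: (hu n) => _ ->.
Qed.

Lemma closed_span_closed G : G `<=` hset H -> closed_subspace H (closed_span H G).
Proof.
move=> hG.
have hT : closed_subspace H (hset H).
  by split=> //; split=> [|a x y hx hy]; hs.
split.
- by move=> x hx; apply: hx.
- split; first by move=> M [_ [M0 _] _] _.
  by move=> a x y hx hy M cM GM; case: (cM) => _ [_ hl] _; apply: hl; [apply: hx|apply: hy].
- move=> u l hu hl cl M cM GM; case: (cM) => _ _ hc; apply: (hc u) => // n.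
  exact: hu.
Qed.

Lemma closed_span_gen G : G `<=` closed_span H G.
Proof. by move=> x gx M _; apply. Qed.

Lemma closed_span_min G M : closed_subspace H M -> G `<=` M -> closed_span H G `<=` M.
Proof. by move=> cM GM x hx; apply: hx. Qed.

Section Projection.
Variable M : set V.
Hypothesis cM : closed_subspace H M.

Lemma csub_sub : M `<=` hset H. Proof. by case: cM. Qed.
Lemma csub0 : M 0. Proof. by case: cM => _ []. Qed.
Lemma csubZD a x y : M x -> M y -> M (a *: x + y).
Proof. by case: cM => _ [_ h] _; apply: h. Qed.
Lemma csubZ a x : M x -> M (a *: x).
Proof. by move=> hx; rewrite -[_ *: _]addr0; apply: csubZD => //; apply: csub0. Qed.
Lemma csubD x y : M x -> M y -> M (x + y).
Proof. by move=> *; rewrite -[x]scale1r; apply: csubZD. Qed.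
Lemma csubB x y : M x -> M y -> M (x - y).
Proof. by move=> *; rewrite addrC -scaleN1r; apply: csubZD. Qed.

Lemma hsub_hilbert : is_hilbert (hsub H M).
Proof.
have sM := csub_sub; split.
- by case: cM.
- by move=> a x y z /sM ? /sM ? /sM ?; apply: (hip_linear hH).
- by move=> x y /sM ? /sM ?; apply: (hip_conj hH).
- by move=> x /sM ?; apply: (hip_ge0 hH).
- by move=> x /sM ?; apply: (hip_eq0 hH).
move=> u hu cu; have [||l hl cl] := hilbert_complete hH (u := u) => //.
  by move=> n; exact: sM (hu n).
by exists l => //; case: cM => _ _ h; apply: (h u).
Qed.

(** First variation: moving l by t z, with t real, changes the squared
    distance by t^2 |z|^2 - 2 t Re <x - l, z>, which is negative for small t >
    0 unless the real part is at most 0. *)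
Lemma nearest_point_perp x l : hset H x -> M l ->
  (forall m, M m -> hnorm H (x - l) <= hnorm H (x - m)) ->
  forall y, M y -> hip H (x - l) y = 0.
Proof.
move=> hx Ml hmin y My; have hl := csub_sub Ml.
have Re0 z : M z -> complex.Re (hip H (x - l) z) <= 0.
  move=> Mz; have hz := csub_sub Mz; rewrite leNgt; apply/negP => p0.
  set p := complex.Re _ in p0; set q := hnorm H z ^+ 2.
  have q0 : 0 <= q by rewrite sqr_ge0.
  set t := p / (q + 1).
  have := hmin (l + t%:C *: z) (csubD Ml (csubZ _ Mz)).
  rewrite -(@ler_pXn2r _ 2) ?nnegrE ?hnorm_ge0 //.
  have -> : x - (l + t%:C *: z) = (x - l) + (- t)%:C *: z.
    by rewrite opprD addrA rmorphN scaleNr.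
  rewrite (sqr_hnormD hH (x := x - l)) ?(hnormZ hH) ?(hipZr hH) //; try hs.
  rewrite conjc_real Re_realM modulus_real normrN exprMn real_normK ?num_real //.
  rewrite -/p -/q => h.
  have e : p = t * (q + 1) by rewrite /t; field; lra.
  have t0 : 0 < t by rewrite divr_gt0 //; lra.
  have : 0 <= t ^+ 2 * q - 2 * t * p by lra.
  rewrite e; have -> : t ^+ 2 * q - 2 * t * (t * (q + 1)) = - (t ^+ 2 * (q + 2)) by ring.
  by rewrite oppr_ge0 leNgt mulr_gt0 ?exprn_gt0 //; lra.
have hy := csub_sub My; have [w w1 wx] := modulus_rot (hip H (x - l) y).
have := Re0 _ (csubZ w^*%C My); rewrite hipZr ?conjcK ?wx ?Re_ReC //; last by hs.
by move=> h; apply: Normc.eq0_normc; apply/eqP; rewrite eq_le h modulus_ge0.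
Qed.

(** A minimizing sequence for the distance to M is Cauchy by the parallelogram
    law. *)
Lemma projection_exists x : hset H x ->
  exists2 m, M m & forall y, M y -> hip H (x - m) y = 0.
Proof.
move=> hx; have sM := csub_sub.
pose D := [set hnorm H (x - m) ^+ 2 | m in M].
have D0 : has_inf D.
  split; first by exists (hnorm H (x - 0) ^+ 2); exists 0 => //; exact: csub0.
  by exists 0 => _ [m _ <-]; rewrite sqr_ge0.
set dd := inf D.
have ddle m : M m -> dd <= hnorm H (x - m) ^+ 2.
  by move=> Mm; apply: ge_inf; [case: D0|exists m].
have /choice[u hu] : forall n : nat, exists m, M m /\ hnorm H (x - m) ^+ 2 < dd + n.+1%:R^-1.
  move=> n; have [|_ [m Mm <-] h] := inf_adherent (_ : 0 < n.+1%:R^-1 :> R) D0.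
    by rewrite invr_gt0.
  by exists m.
have Mu n : M (u n) by case: (hu n).
have pl m n : hnorm H (u m - u n) ^+ 2 <= 2 * m.+1%:R^-1 + 2 * n.+1%:R^-1.
  have hm := sM _ (Mu m); have hn := sM _ (Mu n).
  (* The midpoint of u m and u n lies in M, so its squared distance from x is at least dd. *)
  pose h : R[i] := (2^-1)%:C.
  have := ddle _ (csubZ h (csubD (Mu m) (Mu n))).
  have e1 : x - h *: (u m + u n) = h *: ((x - u m) + (x - u n)).
    have hh : h + h = 1 by rewrite /h -rmorphD; congr (_%:C); field.
    have ex : x = h *: x + h *: x by rewrite -scalerDl hh scale1r.
    by rewrite {1}ex !scalerDr !scalerN opprD addrACA.
  have hh2 : Normc.normc h ^+ 2 = 4%:R^-1.
    by rewrite /h modulus_real ger0_norm ?invr_ge0 // exprVn; congr (_^-1); ring.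
  rewrite e1 (hnormZ hH) ?exprMn ?hh2; last by hs.
  have e2 : u m - u n = (x - u n) - (x - u m) by rewrite opprB [RHS]addrC addrA subrK.
  rewrite e2.
  have := (hu m).2; have := (hu n).2.
  rewrite (sqr_hnormD hH (x := x - u m)) ?(sqr_hnormD hH (x := x - u n)); try hs.
  rewrite (hnormN hH) ?(hipNr hH) ?ReN; try hs.
  rewrite (hip_conj hH (x := x - u m)) ?Re_conj; try hs.
  move: (n.+1%:R^-1) (m.+1%:R^-1) => a b; lra.
have cu : hcauchy H u.
  move=> e e0; have e4 : 0 < e ^+ 2 / 4 by rewrite divr_gt0 ?exprn_gt0.
  exists (Num.truncn (e ^+ 2 / 4)^-1) => m n hm hn.
  rewrite -(@ltr_pXn2r _ 2) ?nnegrE ?hnorm_ge0 ?(ltW e0) //.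
  apply: le_lt_trans (pl m n) _.
  have small k : (Num.truncn (e ^+ 2 / 4)^-1 <= k)%N -> k.+1%:R^-1 < e ^+ 2 / 4.
    move=> hk; rewrite -[ltRHS]invrK ltf_pV2 ?posrE ?invr_gt0 //.
    by apply: lt_le_trans (truncnS_gt _) _; rewrite ler_nat.
  have := small _ hm; have := small _ hn.
  move: (n.+1%:R^-1) (m.+1%:R^-1) => a b; lra.
have [|//|l hl cl] := hilbert_complete hH (u := u); first by move=> n; exact: sM (Mu n).
have Ml : M l by case: cM => _ _ h; apply: (h u).
exists l => //; apply: nearest_point_perp => // m Mm.
apply/ler_addgt0Pr => /= e e0; rewrite -[e]/(e : R).
have /hcvgP/(_ (e / 2)) := cl; rewrite divr_gt0 // => /(_ isT)[N hN].
pose n := maxn N (Num.truncn ((e / 2) ^+ 2)^-1).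
have hm := sM _ Mm; have hn := sM _ (Mu n).
have -> : x - l = (x - u n) + (u n - l) by rewrite addrA subrK.
apply: le_trans (hnormD hH _ _) _; try hs.
have h1 : hnorm H (u n - l) < e / 2 by rewrite hN // leq_maxl.
have h2 : hnorm H (x - u n) <= hnorm H (x - m) + e / 2.
  rewrite -(@ler_pXn2r _ 2) ?nnegrE ?addr_ge0 ?hnorm_ge0 ?divr_ge0 ?(ltW e0) //.
  apply: le_trans (ltW (hu n).2) _.
  have h3 : n.+1%:R^-1 < (e / 2) ^+ 2.
    rewrite -[ltRHS]invrK ltf_pV2 ?posrE ?invr_gt0 ?exprn_gt0 ?divr_gt0 //.
    by apply: lt_le_trans (truncnS_gt _) _; rewrite ler_nat ltnS leq_maxr.
  rewrite sqrrD; have := ddle _ Mm.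
  have : 0 <= hnorm H (x - m) * (e / 2) by rewrite mulr_ge0 ?hnorm_ge0 // divr_ge0 ?(ltW e0).
  by move: h3; move: (n.+1%:R^-1) => a; lra.
lra.
Qed.

(** Subtracting from a vector its projection to M leaves a vector orthogonal
    to M. *)
Lemma csub_total : (forall x, hset H x -> (forall y, M y -> hip H x y = 0) -> x = 0) ->
  M = hset H.
Proof.
move=> h; apply/seteqP; split; first exact: csub_sub.
move=> x hx; have [m Mm pm] := projection_exists hx; have hm := csub_sub Mm.
have := h (x - m) (hsetB hH hx hm) pm.
by move=> /eqP; rewrite subr_eq0 => /eqP ->.
Qed.

End Projection.

Lemma closed_span_total G : G `<=` hset H ->
  (forall x, hset H x -> (forall g, G g -> hip H x g = 0) -> x = 0) ->
  closed_span H G = hset H.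
Proof.
move=> hG h; apply: csub_total; first exact: closed_span_closed.
move=> x hx px; apply: h => // g gg; apply: px; exact: closed_span_gen.
Qed.

End Convergence.

#[global] Hint Extern 4 (is_hilbert (hsub _ _)) => apply: hsub_hilbert : hil.

Section Adjoint.
Variable R : realType.
Local Open Scope complex_scope.
Variables (V W : lmodType R[i]) (H1 : hspace V) (H2 : hspace W) (T : V -> W).
Hypothesis (hH1 : is_hilbert H1) (hH2 : is_hilbert H2).

Lemma adj_unique y z : hset H1 z ->
  (forall x, hset H1 x -> hip H2 (T x) y = hip H1 x z) -> adj H1 H2 T y = z.
Proof.
move=> hz hh.
have /(xgetI 0)[hz' hh'] : [set z | hset H1 z /\
    forall x, hset H1 x -> hip H2 (T x) y = hip H1 x z] z by [].
apply: (hip_inj hH1) => // x hx.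
rewrite (hip_conj hH1 (x := x)) // -hh' // [in RHS](hip_conj hH1 (x := x)) //.
by rewrite -hh.
Qed.

Hypothesis bT : bounded_op H1 H2 T.

Lemma bounded_hset x : hset H1 x -> hset H2 (T x).
Proof. by case: bT => h _ _; apply: h. Qed.

Lemma bounded_lin : linear_on H1 T. Proof. by case: bT. Qed.

Lemma bounded_pos : exists2 M : R, 0 < M & forall x, hset H1 x ->
  hnorm H2 (T x) <= M * hnorm H1 x.
Proof.
case: bT => _ _ [M hM]; exists (`|M| + 1); first by rewrite ltr_wpDl.
move=> x hx; apply: le_trans (hM _ hx) _; rewrite ler_wpM2r ?hnorm_ge0 //.
by have := ler_norm M; lra.
Qed.

(** The functional x |-> <T x, y> vanishes on a closed subspace of codimension
    at most one, and the representing vector is a multiple of a vector w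
    orthogonal to it. *)
Lemma riesz y : hset H2 y ->
  exists2 z, hset H1 z & forall x, hset H1 x -> hip H2 (T x) y = hip H1 x z.
Proof.
move=> hy; have hT := bounded_hset; have lT := bounded_lin.
pose phi x := hip H2 (T x) y.
have phiZD a u v : hset H1 u -> hset H1 v -> phi (a *: u + v) = a * phi u + phi v.
  by move=> hu hv; rewrite /phi lT // (hip_linear hH2) //; apply: hT.
pose N := [set x | hset H1 x /\ phi x = 0].
have cN : closed_subspace H1 N.
  split; first by move=> x [].
    split; first by split; [hs|rewrite /phi (lin0 hH1 lT) hip0l].
    by move=> a u v [hu pu] [hv pv]; split; [hs|rewrite phiZD // pu pv mulr0 addr0].
  move=> u l hu hl /hcvgP cl; split=> //.
  have [M M0 hM] := bounded_pos.
  apply: (@modulus_small _ _ (M * hnorm H2 y)) => e e0; have [n hn] := cl e e0.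
  have [hun pun] := hu n.
  have -> : phi l = - hip H2 (T (u n - l)) y.
    have -> : u n - l = (-1) *: l + u n by rewrite scaleN1r addrC.
    by rewrite -/(phi _) phiZD // pun addr0 mulN1r opprK.
  rewrite modulusN; apply: le_trans (cauchy_schwarz hH2 _ _) _ => //.
    by apply: hT; hs.
  rewrite mulrA ler_wpM2r ?hnorm_ge0 //; apply: le_trans (hM _ _) _; first by hs.
  by rewrite mulrC ler_wpM2r ?(ltW M0) // ltW // hn.
have [allN|] := pselect (forall x, hset H1 x -> phi x = 0).
  by exists 0; [hs|move=> x hx; rewrite -/(phi x) allN // hip0r].
move=> /existsNP[x0 /not_implyP[hx0 nx0]].
have [n [hn pn] perpn] := projection_exists hH1 cN hx0.
set w := x0 - n; have hw : hset H1 w by exact: hsetB.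
have pw : phi w = phi x0.
  have -> : w = (-1) *: n + x0 by rewrite scaleN1r addrC.
  by rewrite phiZD // pn mulr0 add0r.
have pw0 : phi w != 0 by rewrite pw; apply/eqP.
have ww0 : hip H1 w w != 0.
  apply/eqP => /(hip_eq0 hH1 hw) w0; move: pw0.
  by rewrite w0 /phi (lin0 hH1 lT) hip0l ?eqxx.
(* phi is determined by its value at w, which spans the complement of its kernel. *)
exists ((phi w / hip H1 w w)^*%C *: w); first by hs.
move=> x hx; rewrite -/(phi x) hipZr // conjcK.
have := perpn (x - (phi x / phi w) *: w); rewrite -/w => h; clearbody w.
have : hip H1 w (x - (phi x / phi w) *: w) = 0.
  apply: h; split; first by hs.
  have -> : x - (phi x / phi w) *: w = (- (phi x / phi w)) *: w + x.
    by rewrite scaleNr addrC.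
  by rewrite phiZD // mulNr divfK // addNr.
rewrite (hip_conj hH1 (y := w)) ?hipBl ?hipZl //; try hs.
move=> /eqP; rewrite conjc_eq0 subr_eq0 => /eqP ->.
by field; rewrite pw0.
Qed.

Lemma adjP y : hset H2 y -> hset H1 (adj H1 H2 T y) /\
  forall x, hset H1 x -> hip H2 (T x) y = hip H1 x (adj H1 H2 T y).
Proof. by move=> hy; have [z hz h] := riesz hy; rewrite (adj_unique hz h). Qed.

Lemma adj_hset y : hset H2 y -> hset H1 (adj H1 H2 T y).
Proof. by case/adjP. Qed.

Lemma adj_hip x y : hset H1 x -> hset H2 y ->
  hip H1 x (adj H1 H2 T y) = hip H2 (T x) y.
Proof. by move=> hx /adjP[_ ->]. Qed.

Lemma adj_hipl x y : hset H1 x -> hset H2 y ->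
  hip H1 (adj H1 H2 T y) x = hip H2 y (T x).
Proof.
move=> hx hy; have [hz h] := adjP hy.
by rewrite (hip_conj hH1 (x := x)) // -h // -(hip_conj hH2) //; apply: bounded_hset.
Qed.

End Adjoint.

Section Product.
Variable R : realType.
Local Open Scope complex_scope.
Variables (V W : lmodType R[i]) (H1 : hspace V) (H2 : hspace W).
Hypothesis (hH1 : is_hilbert H1) (hH2 : is_hilbert H2).

Lemma hnorm_hprod x y : hset H1 x -> hset H2 y ->
  hnorm (hprod H1 H2) (x, y) ^+ 2 = hnorm H1 x ^+ 2 + hnorm H2 y ^+ 2.
Proof.
move=> hx hy; rewrite {1}/hnorm /= sqr_sqrtr ReD -!sqr_hnorm //.
by rewrite addr_ge0 ?sqr_ge0.
Qed.

Lemma hnorm_hprod_ge x y : hset H1 x -> hset H2 y ->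
  hnorm H1 x <= hnorm (hprod H1 H2) (x, y) /\ hnorm H2 y <= hnorm (hprod H1 H2) (x, y).
Proof.
move=> hx hy; split; rewrite -(@ler_pXn2r _ 2) ?nnegrE ?hnorm_ge0 //
  hnorm_hprod // ?lerDl ?lerDr ?sqr_ge0 //.
Qed.

Lemma hnorm_hprod_le x y : hset H1 x -> hset H2 y ->
  hnorm (hprod H1 H2) (x, y) <= hnorm H1 x + hnorm H2 y.
Proof.
move=> hx hy; rewrite -(@ler_pXn2r _ 2) ?nnegrE ?addr_ge0 ?hnorm_ge0 //.
rewrite hnorm_hprod // sqrrD.
have : 0 <= hnorm H1 x * hnorm H2 y by rewrite mulr_ge0 ?hnorm_ge0.
lra.
Qed.

Lemma hprod_hilbert : is_hilbert (hprod H1 H2).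
Proof.
split.
- by split=> [|a [x1 x2] [y1 y2] [? ?] [? ?]]; split=> /=; hs.
- move=> a [x1 x2] [y1 y2] [z1 z2] [/= ? ?] [/= ? ?] [/= ? ?].
  by rewrite (hip_linear hH1) // (hip_linear hH2) // mulrDr addrACA.
- move=> [x1 x2] [y1 y2] [/= ? ?] [/= ? ?].
  by rewrite (hip_conj hH1 (x := x1)) // (hip_conj hH2 (x := x2)) // conjcD.
- by move=> [x1 x2] [/= ? ?]; rewrite addr_ge0 ?(hip_ge0 hH1) ?(hip_ge0 hH2).
- move=> [x1 x2] [/= h1 h2] /eqP; rewrite paddr_eq0 ?(hip_ge0 hH1) ?(hip_ge0 hH2) //.
  by move=> /andP[/eqP/(hip_eq0 hH1 h1) -> /eqP/(hip_eq0 hH2 h2) ->].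
move=> u hu cu.
have hu1 n : hset H1 (u n).1 by case: (hu n).
have hu2 n : hset H2 (u n).2 by case: (hu n).
have e m n : u m - u n = ((u m).1 - (u n).1, (u m).2 - (u n).2) by [].
have [||l1 hl1 c1] := hilbert_complete hH1 (u := fun n => (u n).1) => //.
  move=> r r0; have [N hN] := cu r r0; exists N => m n hm hn.
  apply: le_lt_trans (hN m n hm hn); rewrite e.
  by have [] := @hnorm_hprod_ge ((u m).1 - (u n).1) ((u m).2 - (u n).2); try hs.
have [||l2 hl2 c2] := hilbert_complete hH2 (u := fun n => (u n).2) => //.
  move=> r r0; have [N hN] := cu r r0; exists N => m n hm hn.
  apply: le_lt_trans (hN m n hm hn); rewrite e.
  by have [] := @hnorm_hprod_ge ((u m).1 - (u n).1) ((u m).2 - (u n).2); try hs.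
exists (l1, l2); first by split.
apply/hcvgP => r r0; have r2 : 0 < r / 2 by rewrite divr_gt0.
have /hcvgP/(_ _ r2)[N1 hN1] := c1; have /hcvgP/(_ _ r2)[N2 hN2] := c2.
exists (maxn N1 N2) => n; rewrite geq_max => /andP[h1 h2].
have -> : u n - (l1, l2) = ((u n).1 - l1, (u n).2 - l2) by [].
apply: le_lt_trans (hnorm_hprod_le _ _) _; try hs.
by rewrite [r]splitr ltrD ?hN1 ?hN2.
Qed.

End Product.

Lemma hset_pair (R : realType) (V W : lmodType R[i]) (H1 : hspace V) (H2 : hspace W) x y :
  hset H1 x -> hset H2 y -> hset (hprod H1 H2) (x, y).
Proof. by []. Qed.

#[global] Hint Resolve hprod_hilbert hset_pair : hil.

(** * Unitary operators from equal Gram matrices *)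

Section Subspaces.
Variable R : realType.
Local Open Scope complex_scope.
Implicit Types V W : lmodType R[i].

Lemma hcvg_unique V (H : hspace V) u l l' : is_hilbert H ->
  (forall n, hset H (u n)) -> hset H l -> hset H l' ->
  hcvg H u l -> hcvg H u l' -> l = l'.
Proof.
move=> hH hu hl hl' /hcvgP c /hcvgP c'.
apply/eqP; rewrite -subr_eq0; apply/eqP; apply: (hnorm_eq0 hH); first by hs.
apply/eqP; rewrite eq_le hnorm_ge0 andbT; apply/ler_addgt0Pr => /= e e0.
rewrite -[e]/(e : R) add0r.
have e2 : 0 < e / 2 by rewrite divr_gt0.
have [N hN] := c _ e2; have [N' hN'] := c' _ e2.
pose n := maxn N N'.
have -> : l - l' = (u n - l') - (u n - l) by rewrite opprB [RHS]addrC addrA subrK.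
apply: le_trans (hnormB hH _ _) _; try hs.
rewrite [leRHS]splitr lerD // ltW //; first by rewrite hN' // leq_maxr.
by rewrite hN // leq_maxl.
Qed.

Lemma complete_closed V (H : hspace V) M : is_hilbert H -> M `<=` hset H ->
  is_hilbert (hsub H M) -> closed_subspace H M.
Proof.
move=> hH sM hM; split=> //; first by case: hM.
move=> u l hu hl cl; have hu' n : hset H (u n) := sM _ (hu n).
have [|l' Ml' cl'] := hilbert_complete hM hu; first exact: hcvg_cauchy cl.
by rewrite (hcvg_unique hH hu' hl (sM _ Ml') cl cl').
Qed.

Lemma hsub_full V (H : hspace V) : hsub H (hset H) = H.
Proof. by case: H. Qed.

(** Isometric images of closed subspaces are complete, hence closed. *)
Lemma unitary_image_closed V W (H1 : hspace V) (H2 : hspace W) T M :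
  is_hilbert H1 -> is_hilbert H2 -> unitary H1 H2 T -> closed_subspace H1 M ->
  closed_subspace H2 [set T x | x in M].
Proof.
move=> hH1 hH2 uT cM; have sM := csub_sub cM.
apply: complete_closed => //; first by move=> _ [x /sM hx <-]; apply: (unitary_hset uT).
apply: (@unitary_hilbert _ _ _ (hsub H1 M) _ T); last exact: hsub_hilbert.
split.
- by move=> x Mx; exists x.
- by move=> a x y /sM hx /sM hy; apply: (unitary_lin uT).
- by move=> _ [x Mx <-]; exists x.
- by move=> x y /sM hx /sM hy; apply: (unitary_hip uT).
Qed.

Lemma hcvg_hprod V W (H1 : hspace V) (H2 : hspace W) u l :
  is_hilbert H1 -> is_hilbert H2 ->
  (forall n, hset (hprod H1 H2) (u n)) -> hset (hprod H1 H2) l ->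
  hcvg (hprod H1 H2) u l ->
  hcvg H1 (fun n => (u n).1) l.1 /\ hcvg H2 (fun n => (u n).2) l.2.
Proof.
move=> hH1 hH2 hu [hl1 hl2] /hcvgP c.
split; apply/hcvgP => e e0; have [N hN] := c e e0; exists N => n /hN;
  apply: le_lt_trans; have [h1 h2] := hu n;
  have [] := @hnorm_hprod_ge _ _ _ H1 H2 hH1 hH2 ((u n).1 - l.1) ((u n).2 - l.2);
  by try hs.
Qed.

Section Gram.
Variables (V W : lmodType R[i]) (H1 : hspace V) (H2 : hspace W).
Hypothesis (hH1 : is_hilbert H1) (hH2 : is_hilbert H2).
Variables (I : Type) (P : set I) (g : I -> V) (h : I -> W).
Hypothesis hg : forall i, P i -> hset H1 (g i).
Hypothesis hh : forall i, P i -> hset H2 (h i).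
Hypothesis gram : forall i j, P i -> P j -> hip H1 (g i) (g j) = hip H2 (h i) (h j).
Let S1 := closed_span H1 [set g i | i in P].
Let S2 := closed_span H2 [set h i | i in P].
Let H12 := hprod H1 H2.

(** The graph of the isometry g i |-> h i, obtained directly as a closed span
    so that no finite linear combination has to be manipulated. *)
Definition gram_graph := closed_span H12 [set (g i, h i) | i in P].

Let gens : [set (g i, h i) | i in P] `<=` hset H12.
Proof. by move=> _ [i Pi <-]; split; [apply: hg|apply: hh]. Qed.

Let hH12 : is_hilbert H12. Proof. exact: hprod_hilbert. Qed.

Let clG : closed_subspace H12 gram_graph.
Proof. exact: closed_span_closed. Qed.

Let subG p : gram_graph p -> hset H1 p.1 /\ hset H2 p.2.
Proof. by move=> /(csub_sub clG). Qed.

(** To agree with (g i, h i) is to be orthogonal to (g i, - h i), a closed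
    linear condition. It holds between generators, hence between a point of
    the graph and a generator, hence between two points of the graph. *)
Lemma gram_graph_iso p q : gram_graph p -> gram_graph q ->
  hip H1 p.1 q.1 = hip H2 p.2 q.2.
Proof.
have step1 r i : gram_graph r -> P i -> hip H1 r.1 (g i) = hip H2 r.2 (h i).
  move=> Gr Pi.
  have : perp H12 [set (g i, - h i) | i in P] r.
    apply: Gr => [|_ [j Pj <-]].
      apply: perp_closed => // _ [j Pj <-]; have := hg Pj; have := hh Pj.
      by move=> *; split=> /=; hs.
    split=> [|_ [k Pk <-]]; first by apply: gens; exists j.
    by rewrite /= hipNr ?hg ?hh ?gram ?subrr //; [apply: hh|apply: hh].
  case=> -[hr1 hr2] /(_ (g i, - h i)) /= e; apply/eqP; rewrite -subr_eq0; apply/eqP.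
  by rewrite -e; [rewrite hipNr //; apply: hh|exists i].
move=> Gp Gq; have [hp1 hp2] := subG Gp; have [hq1 hq2] := subG Gq.
have : perp H12 [set (q.1, - q.2) | q in gram_graph] p.
  apply: Gp => [|_ [j Pj <-]].
    apply: perp_closed => // _ [[r1 r2] /subG[/= h1 h2] <-].
    by split=> /=; hs.
  split=> [|_ [r Gr <-]]; first by apply: gens; exists j.
  have [hr1 hr2] := subG Gr; have gj := hg Pj; have hj := hh Pj.
  rewrite /= hipNr // (hip_conj hH1 (x := r.1)) // (hip_conj hH2 (x := r.2)) //.
  by rewrite step1 // subrr.
case=> _ /(_ (q.1, - q.2)) /= e; apply/eqP; rewrite -subr_eq0; apply/eqP.
by rewrite -e; [rewrite hipNr|exists q].
Qed.

Let c1 : [set g i | i in P] `<=` hset H1. Proof. by move=> _ [i /hg ? <-]. Qed.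
Let c2 : [set h i | i in P] `<=` hset H2. Proof. by move=> _ [i /hh ? <-]. Qed.
Let cS1 : closed_subspace H1 S1. Proof. exact: closed_span_closed. Qed.
Let cS2 : closed_subspace H2 S2. Proof. exact: closed_span_closed. Qed.

Let graph_span p : gram_graph p -> S1 p.1 /\ S2 p.2.
Proof.
move=> Gp; apply: (Gp [set p | S1 p.1 /\ S2 p.2]).
  split.
  - by move=> r [/(csub_sub cS1) ? /(csub_sub cS2) ?].
  - split; first by split; [exact: csub0 cS1|exact: csub0 cS2].
    by move=> a x y [? ?] [? ?]; split; [apply: (csubZD cS1)|apply: (csubZD cS2)].
  - move=> u l hu hl cl.
    have hu' n : hset (hprod H1 H2) (u n).
      by have [/(csub_sub cS1) ? /(csub_sub cS2) ?] := hu n.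
    have [cl1 cl2] := hcvg_hprod hH1 hH2 hu' hl cl.
    case: cS1 => _ _ k1; case: cS2 => _ _ k2; case: hl => hl1 hl2.
    by split; [apply: (k1 _ _ _ hl1 cl1)|apply: (k2 _ _ _ hl2 cl2)] => n; case: (hu n).
by move=> _ [i Pi <-]; split; apply: closed_span_gen; exists i.
Qed.

Let graph_norm p : gram_graph p -> hnorm H1 p.1 = hnorm H2 p.2.
Proof. by move=> Gp; rewrite /hnorm (gram_graph_iso Gp Gp). Qed.

(* A Cauchy sequence of components on one side lifts to a Cauchy sequence of
   graph points, the two components having equal norms. *)
Let graph_lim (u : nat -> V * W) : (forall n, gram_graph (u n)) ->
  (hcauchy H1 (fun n => (u n).1) \/ hcauchy H2 (fun n => (u n).2)) ->
  exists2 l, gram_graph l & hcvg H12 u l.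
Proof.
move=> Gu cu; have hu n : hset H12 (u n) := csub_sub clG (Gu n).
have cu1 : hcauchy H1 (fun n => (u n).1) /\ hcauchy H2 (fun n => (u n).2).
  by case: cu => cu; split=> // e /cu[N hN]; exists N => m n hm hn;
    have := graph_norm (csubB clG (Gu m) (Gu n)) => /= E; (rewrite E || rewrite -E); exact: hN.
have [|l hl cl] := hilbert_complete hH12 hu.
  move=> e e0; have e2 : 0 < e / 2 by rewrite divr_gt0.
  have [N1 hN1] := cu1.1 _ e2; have [N2 hN2] := cu1.2 _ e2.
  exists (maxn N1 N2) => m n; rewrite !geq_max => /andP[? ?] /andP[? ?].
  have -> : u m - u n = ((u m).1 - (u n).1, (u m).2 - (u n).2) by [].
  have [? ?] := hu m; have [? ?] := hu n.
  apply: le_lt_trans (hnorm_hprod_le _ _ _ _) _; try hs.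
  by rewrite [e]splitr ltrD ?hN1 ?hN2.
exists l => //; case: clG => _ _ k; exact: k hl cl.
Qed.

Let span_graph1 x : S1 x -> exists y, gram_graph (x, y).
Proof.
move=> Sx; apply: (Sx [set x | exists y, gram_graph (x, y)]).
  split.
  - by move=> r [y /subG[]].
  - split; first by exists 0; exact: csub0 clG.
    by move=> a r s [y Gy] [z Gz]; exists (a *: y + z); apply: (csubZD clG a Gy Gz).
  - move=> u l /choice[v hv] hl cl.
    have hul n : hset H1 (u n) by have [] := subG (hv n).
    have [||[l1 l2] Gl cl12] := @graph_lim (fun n => (u n, v n)) => //.
      by left; apply: hcvg_cauchy cl.
    have [hl1 hl2] := subG Gl.
    have [cl1 _] := hcvg_hprod hH1 hH2 (fun n => csub_sub clG (hv n)) (csub_sub clG Gl) cl12.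
    by exists l2; rewrite (hcvg_unique hH1 hul hl hl1 cl cl1).
by move=> _ [i Pi <-]; exists (h i); apply: closed_span_gen; exists i.
Qed.

Let span_graph2 y : S2 y -> exists x, gram_graph (x, y).
Proof.
move=> Sy; apply: (Sy [set y | exists x, gram_graph (x, y)]).
  split.
  - by move=> r [y' /subG[]].
  - split; first by exists 0; exact: csub0 clG.
    by move=> a r s [y' Gy] [z Gz]; exists (a *: y' + z); apply: (csubZD clG a Gy Gz).
  - move=> u l /choice[v hv] hl cl.
    have hul n : hset H2 (u n) by have [] := subG (hv n).
    have [||[l1 l2] Gl cl12] := @graph_lim (fun n => (v n, u n)) => //.
      by right; apply: hcvg_cauchy cl.
    have [hl1 hl2] := subG Gl.
    have [_ cl2] := hcvg_hprod hH1 hH2 (fun n => csub_sub clG (hv n)) (csub_sub clG Gl) cl12.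
    by exists l1; rewrite (hcvg_unique hH2 hul hl hl2 cl cl2).
by move=> _ [i Pi <-]; exists (g i); apply: closed_span_gen; exists i.
Qed.

(** The graph is closed and isometric, so its two projections are injective
    with closed ranges, which contain the generators. *)
Lemma gram_unitary : exists T, unitary (hsub H1 S1) (hsub H2 S2) T /\
  forall i, P i -> T (g i) = h i.
Proof.
have fG x y y' : gram_graph (x, y) -> gram_graph (x, y') -> y = y'.
  move=> Gy Gy'; have := graph_norm (csubB clG Gy Gy') => /=.
  rewrite subrr (hnorm0 hH1) => /esym /(hnorm_eq0 hH2) e.
  have [_ hy] := subG Gy; have [_ hy'] := subG Gy'.
  by apply/eqP; rewrite -subr_eq0 e //; hs.
pose T x := xget 0 [set y | gram_graph (x, y)].
have GT x : S1 x -> gram_graph (x, T x).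
  by move=> /span_graph1[y Gy]; apply: (@xgetI _ 0 [set y | gram_graph (x, y)] y Gy).
have TE x y : gram_graph (x, y) -> T x = y.
  by move=> Gxy; have [/GT Gx _] := graph_span Gxy; apply: fG Gx Gxy.
exists T; split; last by move=> i Pi; apply: TE; apply: closed_span_gen; exists i.
split.
- by move=> x /GT /graph_span[].
- by move=> a x y /GT Gx /GT Gy; apply: TE; apply: (csubZD clG a Gx Gy).
- move=> y /span_graph2[x Gxy]; exists x; last exact: TE.
  by have [] := graph_span Gxy.
- by move=> x y /GT Gx /GT Gy; rewrite /= -(gram_graph_iso Gx Gy).
Qed.

End Gram.
End Subspaces.

Section BoundedOps.
Variable R : realType.
Local Open Scope complex_scope.
Implicit Types V W : lmodType R[i].

Lemma bounded_id V (H : hspace V) : bounded_op H H id.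
Proof. by split=> //; exists 1 => x hx; rewrite mul1r. Qed.

Lemma bounded_zero V W (H1 : hspace V) (H2 : hspace W) : is_hilbert H2 ->
  bounded_op H1 H2 (fun=> 0).
Proof.
move=> hH2; split; [by move=> *; hs|by move=> a x y _ _; rewrite scaler0 addr0|].
by exists 0 => x hx; rewrite mul0r (hnorm0 hH2).
Qed.

Lemma bounded_comp V W X (H1 : hspace V) (H2 : hspace W) (H3 : hspace X) T S :
  is_hilbert H1 -> is_hilbert H2 -> is_hilbert H3 ->
  bounded_op H1 H2 T -> bounded_op H2 H3 S -> bounded_op H1 H3 (fun x => S (T x)).
Proof.
move=> hH1 hH2 hH3 bT bS; have hT := bounded_hset bT; have hS := bounded_hset bS.
split; first by move=> x hx; auto.
  by move=> a x y hx hy; rewrite (bounded_lin bT) // (bounded_lin bS) //; apply: hT.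
have [M M0 hM] := bounded_pos bT; have [N N0 hN] := bounded_pos bS.
exists (N * M) => x hx; apply: le_trans (hN _ (hT _ hx)) _.
by rewrite -mulrA ler_wpM2l ?(ltW N0) // hM.
Qed.

Lemma bounded_sum V W (H1 : hspace V) (H2 : hspace W) (I : Type) (r : seq I)
    (T : I -> V -> W) : is_hilbert H1 -> is_hilbert H2 ->
  (forall i, bounded_op H1 H2 (T i)) ->
  bounded_op H1 H2 (fun x => \sum_(i <- r) T i x).
Proof.
move=> hH1 hH2 bT; split.
- by move=> x hx; apply: hset_sum => // i; apply: (bounded_hset (bT i)).
- move=> a x y hx hy; rewrite scaler_sumr -big_split; apply: eq_bigr => i _.
  exact: (bounded_lin (bT i)).
have /choice[M hM] : forall i, exists M : R, forall x, hset H1 x ->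
    hnorm H2 (T i x) <= M * hnorm H1 x by move=> i; case: (bT i).
exists (\sum_(i <- r) M i) => x hx; rewrite mulr_suml.
apply: le_trans (hnorm_sum hH2 _ _ _) _; last by apply: ler_sum => i _; apply: hM.
by move=> i; apply: (bounded_hset (bT i)).
Qed.

Lemma bounded_pair V W X (H1 : hspace V) (H2 : hspace W) (H3 : hspace X) T S :
  is_hilbert H1 -> is_hilbert H2 -> is_hilbert H3 ->
  bounded_op H1 H2 T -> bounded_op H1 H3 S ->
  bounded_op H1 (hprod H2 H3) (fun x => (T x, S x)).
Proof.
move=> hH1 hH2 hH3 bT bS; have hT := bounded_hset bT; have hS := bounded_hset bS.
split; first by move=> x hx; split=> /=; auto.
  by move=> a x y hx hy; rewrite (bounded_lin bT) // (bounded_lin bS).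
have [M M0 hM] := bounded_pos bT; have [N N0 hN] := bounded_pos bS.
exists (M + N) => x hx; apply: le_trans (hnorm_hprod_le _ _ _ _) _; auto.
by rewrite mulrDl lerD ?hM ?hN.
Qed.

Lemma bounded_ext V W (H1 : hspace V) (H2 : hspace W) T S : is_hilbert H1 ->
  (forall x, hset H1 x -> T x = S x) -> bounded_op H1 H2 T -> bounded_op H1 H2 S.
Proof.
move=> hH1 e bT; split.
- by move=> x hx; rewrite -e //; apply: (bounded_hset bT).
- by move=> a x y hx hy; rewrite -!e ?(bounded_lin bT) //; hs.
- by case: bT => _ _ [M hM]; exists M => x hx; rewrite -e ?hM.
Qed.

Lemma unitary_bounded V W (H1 : hspace V) (H2 : hspace W) T :
  unitary H1 H2 T -> bounded_op H1 H2 T.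
Proof.
move=> uT; split; [exact: unitary_hset uT|exact: unitary_lin uT|].
by exists 1 => x hx; rewrite mul1r (unitary_hnorm uT).
Qed.

Lemma bounded_adj V W (H1 : hspace V) (H2 : hspace W) T :
  is_hilbert H1 -> is_hilbert H2 ->
  bounded_op H1 H2 T -> bounded_op H2 H1 (adj H1 H2 T).
Proof.
move=> hH1 hH2 bT; have ha := adj_hset hH1 hH2 bT; have hT := bounded_hset bT.
split=> //.
  move=> a x y hx hy; have hax := ha _ hx; have hay := ha _ hy.
  apply: (adj_unique hH1); first by hs.
  move=> z hz; have hTz := hT _ hz; rewrite !hipDr ?hipZr //; try hs.
  by rewrite !(adj_hip hH1 hH2 bT).
have [M M0 hM] := bounded_pos bT; exists M => y hy; have hay := ha _ hy.
have [->|n0] := eqVneq (hnorm H1 (adj H1 H2 T y)) 0.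
  by rewrite mulr_ge0 ?(ltW M0) ?hnorm_ge0.
have np : 0 < hnorm H1 (adj H1 H2 T y) by rewrite lt_neqAle eq_sym n0 hnorm_ge0.
rewrite -(ler_pM2l np) -expr2 sqr_hnorm // (adj_hip hH1 hH2 bT) //.
apply: le_trans (Re_cauchy_schwarz hH2 _ _) _; auto.
by rewrite mulrA [_ * M]mulrC ler_wpM2r ?hnorm_ge0 ?hM.
Qed.

End BoundedOps.

(** * Unconditional sums and Hilbert direct sums *)

Section UnconditionalSums.
Variables (R : realType) (I : choiceType).
Local Open Scope complex_scope.
Implicit Types (A F : set I) (f g : I -> R[i]).

Lemma fsets_union A F G : fsets A F -> fsets A G -> fsets A (F `|` G).
Proof. by move=> [? ?] [? ?]; split; [rewrite finite_setU|rewrite subUset]. Qed.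

Lemma has_usum_eq A f g s : (forall i, A i -> f i = g i) -> has_usum A f s -> has_usum A g s.
Proof.
move=> e h eps e0; have [F0 AF0 hF0] := h _ e0; exists F0 => // F AF sF.
rewrite (_ : \sum_(i \in F) g i = \sum_(i \in F) f i) ?hF0 //.
by apply: eq_fsbigr => i; rewrite inE => Fi; rewrite e //; exact: AF.2.
Qed.

Lemma has_usum_unique A f s t : has_usum A f s -> has_usum A f t -> s = t.
Proof.
move=> hs' ht; apply/eqP; rewrite -subr_eq0; apply/eqP/Normc.eq0_normc/eqP.
rewrite eq_le modulus_ge0 andbT; apply/ler_addgt0Pr => /= e e0.
rewrite -[e]/(e : R) add0r; have e2 : 0 < e / 2 by rewrite divr_gt0.
have [F0 AF0 hF0] := hs' _ e2; have [F1 AF1 hF1] := ht _ e2.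
have AF := fsets_union AF0 AF1.
have h0 := hF0 _ AF (@subsetUl _ _ _); have h1 := hF1 _ AF (@subsetUr _ _ _).
set S := \sum_(i \in _) f i in h0 h1.
have -> : s - t = (S - t) - (S - s) by rewrite opprB [RHS]addrC addrA subrK.
by apply: le_trans (modulusD _ _) _; rewrite modulusN [leRHS]splitr lerD // ltW.
Qed.

Lemma usumE A f s : has_usum A f s -> usum A f = s.
Proof. move=> h; have hu : has_usum A f (usum A f).
  exact: (@xgetI _ 0 [set s | has_usum A f s] s h).
exact: has_usum_unique hu h. Qed.

Lemma usum_eq A f g : (forall i, A i -> f i = g i) -> usum A f = usum A g.
Proof.
move=> e; rewrite /usum; congr (xget 0 _); apply/seteqP; split=> s /=.
  exact: has_usum_eq.
by apply: has_usum_eq => i Ai; rewrite e.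
Qed.

Lemma has_usum0 A : has_usum A (fun=> 0) (0 : R[i]).
Proof.
move=> e e0; exists set0; first exact: fsets_set0.
by move=> F _ _; rewrite fsbig1 // subr0 Normc.normc0.
Qed.

Lemma usum0 A f : (forall i, A i -> f i = 0) -> usum A f = 0.
Proof. by move=> h; apply: usumE; apply: has_usum_eq (has_usum0 A) => i /h ->. Qed.

Lemma has_usumZD A a f g s t : has_usum A f s -> has_usum A g t ->
  has_usum A (fun i => a * f i + g i) (a * s + t).
Proof.
move=> hs' ht e e0.
have m0 : 0 < Normc.normc a + 1 by rewrite ltr_wpDl ?modulus_ge0.
have e2 : 0 < e / 2 by rewrite divr_gt0.
have e3 : 0 < e / 2 / (Normc.normc a + 1) by rewrite divr_gt0.
have [F0 AF0 hF0] := hs' _ e3; have [F1 AF1 hF1] := ht _ e2.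
exists (F0 `|` F1); first exact: fsets_union.
move=> F AF; rewrite subUset => -[s0 s1]; have fF := AF.1.
rewrite fsbig_split // -mulr_fsumr opprD addrACA -mulrBr.
apply: le_lt_trans (modulusD _ _) _; rewrite Normc.normcM [e]splitr.
rewrite ler_ltD //; last exact: hF1.
apply: le_trans (_ : (Normc.normc a + 1) * (e / 2 / (Normc.normc a + 1)) <= _).
  by rewrite ler_pM ?modulus_ge0 ?lerDl // ltW // hF0.
by rewrite mulrC divfK ?gt_eqF.
Qed.

Lemma has_usum_conj A f s : has_usum A f s -> has_usum A (fun i => (f i)^*%C) s^*%C.
Proof.
move=> h e e0; have [F0 AF0 hF0] := h _ e0; exists F0 => // F AF sF.
rewrite fsbig_finite; last exact: AF.1.
rewrite -(rmorph_sum (@conjc R)) -fsbig_finite; last exact: AF.1.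
by rewrite -conjcN -conjcD modulus_conj hF0.
Qed.

Lemma has_usumD A f g s t : has_usum A f s -> has_usum A g t ->
  has_usum A (fun i => f i + g i) (s + t).
Proof.
move=> hf hg; rewrite -[s]mul1r.
by apply: has_usum_eq (has_usumZD 1 hf hg) => i _; rewrite mul1r.
Qed.

Lemma has_usum_sum A (J : Type) (r : seq J) (f : J -> I -> R[i]) (s : J -> R[i]) :
  (forall j, has_usum A (f j) (s j)) ->
  has_usum A (fun i => \sum_(j <- r) f j i) (\sum_(j <- r) s j).
Proof.
move=> h; elim: r => [|j r IH].
  by rewrite big_nil; apply: has_usum_eq (has_usum0 A) => i _; rewrite big_nil.
rewrite big_cons; apply: has_usum_eq (has_usumD (h j) IH) => i _.
by rewrite big_cons.
Qed.

Lemma fsum_EFin (F : set I) (f : I -> R) : finite_set F ->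
  (\sum_(i \in F) (f i)%:E = (\sum_(i \in F) f i)%:E)%E.
Proof. by move=> fF; rewrite !fsbig_finite // sumEFin. Qed.

Lemma esum_leP A (f : I -> R) (M : R) :
  (\esum_(i in A) (f i)%:E <= M%:E)%E <->
  (forall F, fsets A F -> \sum_(i \in F) f i <= M).
Proof.
split=> [h F AF|h].
  rewrite -lee_fin -fsum_EFin; last exact: AF.1.
  by apply: le_trans h; apply: ereal_sup_ubound; exists F.
apply: ge_ereal_sup => _ [F AF <-]; rewrite fsum_EFin ?lee_fin ?h //.
exact: AF.1.
Qed.

Lemma esum_finite A (f : I -> R) : (forall i, A i -> 0 <= f i) ->
  (\esum_(i in A) (f i)%:E < +oo)%E ->
  (\esum_(i in A) (f i)%:E = (fine (\esum_(i in A) (f i)%:E))%:E)%E.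
Proof.
move=> f0 h; rewrite fineK // ge0_fin_numE //.
by apply: esum_ge0 => i Ai; rewrite lee_fin f0.
Qed.

Lemma esum_ltyP A (f : I -> R) : (forall i, A i -> 0 <= f i) ->
  (\esum_(i in A) (f i)%:E < +oo)%E <->
  exists M : R, forall F, fsets A F -> \sum_(i \in F) f i <= M.
Proof.
move=> f0; split=> [h|[M /esum_leP h]]; last exact: le_lt_trans (ltry M).
by exists (fine (\esum_(i in A) (f i)%:E)); apply/esum_leP; rewrite -esum_finite.
Qed.

Lemma has_usum_ge0 A (f : I -> R) : (forall i, A i -> 0 <= f i) ->
  (\esum_(i in A) (f i)%:E < +oo)%E ->
  has_usum A (fun i => (f i)%:C) (fine (\esum_(i in A) (f i)%:E))%:C.
Proof.
move=> f0 h e e0; have E := esum_finite f0 h.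
set s := fine _ in E *.
have [|_ [F0 AF0 <-]] := @ub_ereal_sup_adherent _
    [set (\sum_(i \in F) (f i)%:E)%E | F in fsets A] e e0.
  by rewrite -/(esum A _) E.
rewrite -/(esum A _) E fsum_EFin; last exact: AF0.1.
rewrite -EFinB lte_fin => hF0; exists F0 => // F AF sF.
have fF := AF.1.
have -> : \sum_(i \in F) (f i)%:C = (\sum_(i \in F) f i)%:C :> R[i].
  by rewrite !fsbig_finite // rmorph_sum.
rewrite -rmorphB modulus_real distrC ger0_norm.
  have : \sum_(i \in F0) f i <= \sum_(i \in F) f i; last lra.
  rewrite [leRHS](fsbigID F0) // setIidr // lerDl.
  by apply: fsumr_ge0 => i [Fi _]; apply: f0; exact: AF.2.
rewrite subr_ge0; move: F AF {sF fF}; apply/esum_leP; by rewrite -E.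
Qed.

End UnconditionalSums.

Lemma usum_fin (R : realType) (I : finType) (f : I -> R[i]) : usum setT f = \sum_i f i.
Proof.
apply: usumE => e e0; exists setT; first by split=> //; apply: finite_finset.
move=> F _ sF; have -> : F = [set: I] by apply/seteqP; split.
rewrite (fsbigE (enum I)) ?enum_uniq //; last by move=> i _; rewrite mem_enum.
rewrite (eq_bigl xpredT) ?big_enum /= ?subrr ?Normc.normc0 // => i.
by rewrite in_setT.
Qed.

Section DirectSum.
Variables (R : realType) (I : choiceType) (V : lmodType R[i]) (A : set I).
Variable H : I -> hspace V.
Hypothesis hH : forall i, A i -> is_hilbert (H i).
Local Open Scope complex_scope.
Local Notation HD := (hdsum A H).

Lemma hdsum_hset f i : hset HD f -> A i -> hset (H i) (f i).
Proof. by case=> h _ _; apply: h. Qed.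

Lemma hdsum_out f i : hset HD f -> ~ A i -> f i = 0.
Proof. by case=> _ h _; apply: h. Qed.

Lemma square_summableP (f : I -> V) : square_summable A H f <->
  exists M : R, forall F, fsets A F -> \sum_(i \in F) hnorm (H i) (f i) ^+ 2 <= M.
Proof. by apply: esum_ltyP => i _; apply: sqr_ge0. Qed.

Lemma hdsum_linear : linear_set (hset HD).
Proof.
split.
  split=> // [i Ai|]; first by have := hH Ai => ?; hs.
  apply/square_summableP; exists 0 => F AF; rewrite fsbig1 // => i Fi.
  by rewrite (hnorm0 (hH (AF.2 _ Fi))) expr0n.
move=> a f g [hf f0 /square_summableP[M hM]] [hg g0 /square_summableP[N hN]].
have hfA i : A i -> hset (H i) (f i) by move=> Ai; apply: hf.
split.
- by move=> i Ai; have hi := hH Ai; rewrite !fctE; apply: hsetZD; auto.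
- by move=> i nA; rewrite /= !fctE f0 ?g0 ?scaler0 ?addr0.
apply/square_summableP.
pose c := 2 * Normc.normc a ^+ 2.
exists (c * M + 2 * N) => F AF; have fF := AF.1.
apply: (@le_trans _ _ (\sum_(i \in F) (c * hnorm (H i) (f i) ^+ 2 + 2 * hnorm (H i) (g i) ^+ 2))).
  rewrite !fsbig_finite // [leLHS]big_seq [leRHS]big_seq.
  apply: ler_sum => i; rewrite in_fset_set // inE => Fi.
  have Ai := AF.2 _ Fi; have hi := hH Ai; have fi := hf i Ai; have gi := hg i Ai.
  have := sqr_ge0 (hnorm (H i) (a *: f i - g i)).
  rewrite !fctE !(sqr_hnormD hi) ?(hnormN hi) ?(hipNr hi) ?ReN ?(hnormZ hi) ?exprMn; try hs.
  rewrite /c; set x := hnorm _ _ ^+ 2; set y := hnorm _ _ ^+ 2.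
  rewrite -[2 * _ * y]mulrA; set z := _ ^+ 2 * y; lra.
have := hM F AF; have := hN F AF; rewrite !fsbig_finite // => hN' hM'.
rewrite big_split -!mulr_sumr lerD // ler_wpM2l //.
by rewrite /c mulr_ge0 ?sqr_ge0.
Qed.

Lemma hdsum_has_usum_sqr f : hset HD f ->
  has_usum A (fun i => hip (H i) (f i) (f i))
    (fine (\esum_(i in A) (hnorm (H i) (f i) ^+ 2)%:E))%:C.
Proof.
move=> [hf f0 sf]; apply: has_usum_eq (has_usum_ge0 _ sf).
  by move=> i Ai; rewrite (hipxx (hH Ai)) //; apply: hf.
by move=> i _; apply: sqr_ge0.
Qed.

Lemma sqr_hnorm_hdsum f : hset HD f ->
  hnorm HD f ^+ 2 = fine (\esum_(i in A) (hnorm (H i) (f i) ^+ 2)%:E).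
Proof.
move=> hf; rewrite /hnorm /= (usumE (hdsum_has_usum_sqr hf)) Re_ReC sqr_sqrtr //.
by apply: fine_ge0; apply: esum_ge0 => i _; rewrite lee_fin sqr_ge0.
Qed.

Lemma hdsum_sumP f M : hset HD f -> hnorm HD f ^+ 2 <= M <->
  (forall F, fsets A F -> \sum_(i \in F) hnorm (H i) (f i) ^+ 2 <= M).
Proof.
move=> hf; rewrite sqr_hnorm_hdsum // -esum_leP -lee_fin -esum_finite //.
  by move=> i _; apply: sqr_ge0.
by case: hf.
Qed.

(** The sums of inner products converge unconditionally: by polarization they
    are combinations of convergent sums of squared norms. *)
Lemma hdsum_has_usum f g : hset HD f -> hset HD g ->
  has_usum A (fun i => hip (H i) (f i) (g i)) (hip HD f g).
Proof.
move=> hf hg; have [l0 lD] := hdsum_linear.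
suff [s h] : exists s, has_usum A (fun i => hip (H i) (f i) (g i)) s.
  by rewrite /= (usumE h).
have S a : {s | has_usum A (fun i => hip (H i) (f i + a *: g i) (f i + a *: g i)) s}.
  apply: cid; eexists; apply: (@has_usum_eq _ _ _
    (fun i => hip (H i) ((a *: g + f) i) ((a *: g + f) i))).
    by move=> i _; rewrite /= !fctE addrC.
  exact: hdsum_has_usum_sqr (lD a _ _ hg hf).
have [s1 S1] := S 1; have [s2 S2] := S (-1).
have [s3 S3] := S 'i%C; have [s4 S4] := S (- 'i%C).
have T := has_usumZD 4%:R^-1 (has_usumZD (- 'i%C) S4
  (has_usumZD 'i%C S3 (has_usumZD (-1) S2 S1))) (@has_usum0 R _ A).
eexists; apply: has_usum_eq T.
move=> i Ai; have hi := hH Ai.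
rewrite (polarization hi (hdsum_hset hf Ai) (hdsum_hset hg Ai)) addr0.
by rewrite !scaleN1r !scale1r !scaleNr; congr (_ * _); ring.
Qed.

Lemma hdsum_comp_le f i : hset HD f -> A i -> hnorm (H i) (f i) <= hnorm HD f.
Proof.
move=> hf Ai; rewrite -(@ler_pXn2r _ 2) ?nnegrE ?hnorm_ge0 //.
have /(hdsum_sumP _ hf)/(_ [set i]) := lexx (hnorm HD f ^+ 2).
by rewrite fsbig_set1; apply; split=> // j ->.
Qed.

Lemma cvg_hnorm_dist i (u : nat -> V) l x : A i -> (forall n, hset (H i) (u n)) ->
  hset (H i) l -> hset (H i) x -> hcvg (H i) u l ->
  (fun n => hnorm (H i) (x - u n)) @ \oo --> hnorm (H i) (x - l).
Proof.
move=> Ai hu hl hx /hcvgP cl; have hi := hH Ai.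
apply/cvgrPdist_lt => e e0; have [N hN] := cl e e0; exists N => // n /hN.
apply: le_lt_trans; rewrite ler_distlC; apply/andP; split.
  rewrite lerBlDr; have -> : x - l = (x - u n) + (u n - l) by rewrite addrA subrK.
  by apply: (hnormD hi); hs.
have -> : x - u n = (x - l) - (u n - l) by rewrite opprB addrA subrK.
by apply: (hnormB hi); hs.
Qed.

Lemma cvg_seq_sum (s : seq I) (f : nat -> I -> R) (l : I -> R) :
  (forall i, i \in s -> f ^~ i @ \oo --> l i) ->
  (fun n => \sum_(i <- s) f n i) @ \oo --> \sum_(i <- s) l i.
Proof.
elim: s => [|i s IH] hf.
  by rewrite big_nil; under eq_fun do rewrite big_nil; exact: cvg_cst.
rewrite big_cons; under eq_fun do rewrite big_cons.
apply: cvgD; first by apply: hf; rewrite mem_head.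
by apply: IH => j js; apply: hf; rewrite in_cons js orbT.
Qed.

(** Completeness: a Cauchy sequence converges in each component, and the bound
    on a finite partial sum of squared distances between terms of the sequence
    passes to the limit. *)
Lemma hdsum_hilbert : is_hilbert HD.
Proof.
have lHD := hdsum_linear; split=> //.
- move=> a f g z hf hg hz; apply: usumE.
  apply: has_usum_eq (has_usumZD a (hdsum_has_usum hf hz) (hdsum_has_usum hg hz)).
  by move=> i Ai; rewrite -(hip_linear (hH Ai)) //; apply: hdsum_hset.
- move=> f g hf hg; apply: usumE.
  apply: has_usum_eq (has_usum_conj (hdsum_has_usum hf hg)) => i Ai.
  by rewrite -(hip_conj (hH Ai)) //; apply: hdsum_hset.
- move=> f hf; rewrite /= (usumE (hdsum_has_usum_sqr hf)) ler0c fine_ge0 //.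
  by apply: esum_ge0 => i _; rewrite lee_fin sqr_ge0.
- move=> f hf h; apply/funext => i; have [Ai|nA] := pselect (A i); last first.
    by rewrite (hdsum_out hf nA).
  apply: (hnorm_eq0 (hH Ai)); first exact: hdsum_hset.
  apply/eqP; rewrite eq_le hnorm_ge0 andbT.
  by apply: le_trans (hdsum_comp_le hf Ai) _; rewrite /hnorm h /= sqrtr0.
move=> u hu cu.
have hB m n : hset HD (u m - u n).
  by rewrite -scaleN1r addrC; apply: lHD.2.
have /choice[l hl] : forall i, exists l, (A i -> hset (H i) l /\ hcvg (H i) (u ^~ i) l) /\
    (~ A i -> l = 0).
  move=> i; have [Ai|nA] := pselect (A i); last by exists 0.
  have [||l hl cl] := hilbert_complete (hH Ai) (u := u ^~ i).
  - by move=> n; apply: hdsum_hset.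
  - move=> e /cu[N hN]; exists N => m n hm hn; apply: le_lt_trans (hN m n hm hn).
    exact: (hdsum_comp_le (hB m n) Ai).
  - by exists l.
have hul n i : A i -> hset (H i) (u n i - l i).
  by move=> Ai; have hi := hH Ai; have [/(_ Ai)[? _] _] := hl i;
    have := hdsum_hset (hu n) Ai => ?; hs.
have tail e : 0 < e -> exists N, forall n, (N <= n)%N -> forall F, fsets A F ->
    \sum_(i \in F) hnorm (H i) (u n i - l i) ^+ 2 <= e ^+ 2.
  move=> e0; have [N hN] := cu _ e0; exists N => n hn F AF; have fF := AF.1.
  rewrite fsbig_finite //; pose s := finmap.enum_fset (fset_set F).
  have cS : (fun m => \sum_(i <- s) hnorm (H i) (u n i - u m i) ^+ 2)
      @ \oo --> \sum_(i <- s) hnorm (H i) (u n i - l i) ^+ 2.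
    apply: (@cvg_seq_sum s (fun m i => hnorm (H i) (u n i - u m i) ^+ 2)
      (fun i => hnorm (H i) (u n i - l i) ^+ 2)) => i; rewrite [_ \in s]in_fset_set // inE => /AF.2 Ai.
    have [/(_ Ai)[hli cli] _] := hl i.
    have c := cvg_hnorm_dist Ai (fun m => hdsum_hset (hu m) Ai) hli (hdsum_hset (hu n) Ai) cli.
    by under eq_fun do rewrite expr2; rewrite expr2; apply: cvgM.
  apply: (cvgr_to_le cS).
  exists N => // m hm /=; rewrite -fsbig_finite //.
  apply: le_trans (_ : hnorm HD (u n - u m) ^+ 2 <= _); last first.
    by rewrite ler_pXn2r ?nnegrE ?hnorm_ge0 ?(ltW e0) // ltW // hN.
  exact: ((hdsum_sumP _ (hB n m)).1 (lexx _) F AF).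
have hDl e N : 0 < e -> (forall F, fsets A F ->
    \sum_(i \in F) hnorm (H i) (u N i - l i) ^+ 2 <= e) -> hset HD (u N - l).
  move=> e0 h; split; first by move=> i Ai; apply: hul.
    by move=> i nA; rewrite !fctE (hdsum_out (hu N) nA) (hl i).2 // subrr.
  by apply/square_summableP; exists e.
exists l.
  have [N hN] := tail 1 ltr01; have := hN N (leqnn N); rewrite expr1n => h.
  have := hDl 1 N ltr01 h => hul'; have -> : l = (-1) *: (u N - l) + u N.
    by rewrite scaleN1r opprB subrK.
  exact: lHD.2.
apply/hcvgP => e e0; have e2 : 0 < e / 2 by rewrite divr_gt0.
have [N hN] := tail _ e2; exists N => n hn; have h := hN n hn.
have hd : hset HD (u n - l) by apply: hDl h; rewrite exprn_gt0.
have := (hdsum_sumP ((e / 2) ^+ 2) hd).2 h.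
rewrite ler_pXn2r ?nnegrE ?hnorm_ge0 ?(ltW e2) // => /le_lt_trans -> //.
by rewrite ltr_pdivrMr // mulr2n mulrDr mulr1 ltrDl.
Qed.

End DirectSum.

Section FiniteDirectSum.
Variables (R : realType) (I : finType) (V : lmodType R[i]).
Variable H : I -> hspace V.
Hypothesis hH : forall i, is_hilbert (H i).
Local Open Scope complex_scope.
Local Notation HD := (hdsum setT H).

Lemma hdsum_fin_hset f : (forall i, hset (H i) (f i)) -> hset HD f.
Proof.
move=> hf; split=> [i _|i nI|]; [exact: hf|by case: nI|].
apply/square_summableP.
exists (\sum_i hnorm (H i) (f i) ^+ 2) => F [fF _].
rewrite fsbig_finite // [leRHS](bigID (fun i => i \in F)) /=.
rewrite -[leLHS]addr0 lerD //; last by apply: sumr_ge0 => i _; apply: sqr_ge0.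
rewrite -[leRHS]big_filter le_eqVlt; apply/orP; left; apply/eqP; apply: perm_big.
apply: uniq_perm; rewrite ?finmap.fset_uniq ?filter_uniq ?index_enum_uniq //.
by move=> i; rewrite in_fset_set // mem_filter mem_index_enum andbT.
Qed.

Lemma hdsum_fin_hip f g : hip HD f g = \sum_i hip (H i) (f i) (g i).
Proof. exact: usum_fin. Qed.

Lemma hdsum_fin_hilbert : is_hilbert HD.
Proof. exact: hdsum_hilbert. Qed.

Lemma sqr_hnorm_hdsum_fin f : (forall i, hset (H i) (f i)) ->
  hnorm HD f ^+ 2 = \sum_i hnorm (H i) (f i) ^+ 2.
Proof.
move=> hf; rewrite (sqr_hnorm hdsum_fin_hilbert); last exact: hdsum_fin_hset.
rewrite hdsum_fin_hip Re_sum; apply: eq_bigr => i _.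
by rewrite sqr_hnorm.
Qed.

End FiniteDirectSum.

(** * Reproducing kernel spaces of factored kernels *)

Section ReproducingKernel.
Variables (R : realType) (d : nat) (VX VG : lmodType R[i]).
Variables (X : hspace VX) (G : hspace VG) (K : kernel d VG).
Variable Gam : Zd d -> VX -> VG.
Hypothesis (hX : is_hilbert X) (hG : is_hilbert G).
Hypothesis bGam : forall n, bounded_op X G (Gam n).
Hypothesis KE : forall n m g, hset G g -> K n m g = Gam n (adj X G (Gam m) g).
Local Open Scope complex_scope.

Let P : set (Zd d * VG) := [set p | hset G p.2].
Let gen (p : Zd d * VG) := adj X G (Gam p.1) p.2.
Let S1 := closed_span X [set gen p | p in P].
Let genX p : P p -> hset X (gen p). Proof. exact: adj_hset. Qed.
Let gens : [set gen p | p in P] `<=` hset X. Proof. by move=> _ [p /genX ? <-]. Qed.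
Let cS1 : closed_subspace X S1. Proof. exact: closed_span_closed. Qed.

(* A vector orthogonal to the ranges of all Gam_n^* is killed by all Gam_n. *)
Let perp_ker x : hset X x -> (forall y, S1 y -> hip X x y = 0) -> forall n, Gam n x = 0.
Proof.
move=> hx px n; have hgx := bounded_hset (bGam n) hx.
apply: (hip_inj hG) => //; first by hs.
move=> u hu; rewrite hip0l // -(adj_hip hX hG (bGam n)) //; apply: px.
by apply: closed_span_gen; exists (n, u).
Qed.

Let ker_perp x : hset X x -> (forall n, Gam n x = 0) -> forall y, S1 y -> hip X x y = 0.
Proof.
move=> hx kx y Sy; have : perp X [set x] y.
  apply: Sy; first by apply: perp_closed => // z ->.
  move=> _ [[n u] Pu <-]; split; first exact: genX.
  by move=> z ->; rewrite (adj_hipl hX hG (bGam n)) // kx hip0r.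
case=> hy /(_ x erefl); rewrite (hip_conj hX (x := x)) // => /eqP.
by rewrite conjc_eq0 => /eqP.
Qed.

(** The reproducing kernel space of K is the range of x |-> (Gam_n x)_n, with
    the norm of the orthogonal complement of its kernel. *)
Lemma rkhs_exists : is_rkhs G K (rkhs G K).
Proof.
pose F x : Zd d -> VG := fun n => Gam n x.
pose Fi f := xget 0 [set x | S1 x /\ F x = f].
pose HR := HSpace [set F x | x in S1] (fun f g => hip X (Fi f) (Fi g)).
have linF a x y : hset X x -> hset X y -> F (a *: x + y) = a *: F x + F y.
  by move=> hx hy; apply/funext => n; rewrite /F (bounded_lin (bGam n)).
have FiK x : S1 x -> Fi (F x) = x.
  move=> Sx; have [Sy e] := @xgetI _ 0 [set y | S1 y /\ F y = F x] x (conj Sx erefl).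
  rewrite -/(Fi _) in Sy e; set y := Fi _ in Sy e *.
  have hx := csub_sub cS1 Sx; have hy := csub_sub cS1 Sy.
  apply/eqP; rewrite -subr_eq0; apply/eqP; apply: (hip_eq0 hX); first by hs.
  apply: ker_perp; [by hs| |exact: (csubB cS1)] => n.
  have := congr1 (@^~ n) e; rewrite /F /= => en.
  by rewrite (linB hX (bounded_lin (bGam n))) // en subrr.
have uF : unitary (hsub X S1) HR F.
  split.
  - by move=> x Sx; exists x.
  - by move=> a x y Sx Sy; apply: linF; apply: (csub_sub cS1).
  - by move=> _ [x Sx <-]; exists x.
  - by move=> x y Sx Sy; rewrite /= !FiK.
have hR : is_rkhs G K HR.
  split.
  - by apply: unitary_hilbert uF _; apply: hsub_hilbert.
  - move=> _ n [x Sx <-]; apply: (bounded_hset (bGam n)); exact: (csub_sub cS1).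
  - move=> m u hu; exists (gen (m, u)).
      by apply: closed_span_gen; exists (m, u).
    by apply/funext => n; rewrite /F /ksec KE.
  move=> _ m u [x Sx <-] hu.
  have -> : ksec K m u = F (gen (m, u)) by apply/funext => n; rewrite /F /ksec KE.
  rewrite /= !FiK //; last by apply: closed_span_gen; exists (m, u).
  by rewrite (adj_hip hX hG (bGam m)) //; apply: (csub_sub cS1).
exact: (@xgetI _ _ [set H | is_rkhs G K H] HR hR).
Qed.

Section Factor.
Variable H : hspace (Zd d -> VG).
Hypothesis hK : is_rkhs G K H.

Let hH : is_hilbert H. Proof. by case: hK. Qed.
Let hHG f n : hset H f -> hset G (f n). Proof. by case: hK => _ h _ _; apply: h. Qed.
Let hsec m u : hset G u -> hset H (ksec K m u).
Proof. by case: hK => _ _ h _; apply: h. Qed.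
Let repr f m u : hset H f -> hset G u -> hip H f (ksec K m u) = hip G (f m) u.
Proof. by case: hK => _ _ _ h; apply: h. Qed.

Let gram p q : P p -> P q ->
  hip X (gen p) (gen q) = hip H (ksec K p.1 p.2) (ksec K q.1 q.2).
Proof.
move=> Pp Pq; rewrite repr //; last exact: hsec.
rewrite (adj_hip hX hG (bGam q.1)) //; first by rewrite /ksec KE.
exact: genX.
Qed.

(* The vectors Gam_m^* u and [K]_m u have the same Gram matrix, given by K,
   and the latter are total by the reproducing property. *)
Let T_exists : exists T, unitary (hsub X S1) H T /\
  forall x, S1 x -> T x = (fun n => Gam n x).
Proof.
have [T [uT hT]] := gram_unitary hX hH genX (fun p => @hsec p.1 p.2) gram.
have tot : closed_span H [set ksec K p.1 p.2 | p in P] = hset H.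
  apply: closed_span_total => //; first by move=> _ [p Pp <-]; apply: hsec.
  move=> f hf pf; apply/funext => n; apply: (hip_inj hG); [exact: hHG|by hs|].
  move=> u hu; rewrite hip0l // -repr //; apply: pf; by exists (n, u).
rewrite tot hsub_full -/S1 in uT.
exists T; split=> // x Sx; apply/funext => n; have hTx := unitary_hset uT Sx.
have hx := csub_sub cS1 Sx.
apply: (hip_inj hG); [exact: hHG|exact: (bounded_hset (bGam n))|] => u hu.
rewrite -repr // -[ksec K n u]/(ksec K (n, u).1 (n, u).2) -(hT (n, u)) //.
rewrite (unitary_hip uT) //; last by apply: closed_span_gen; exists (n, u).
by rewrite /= /gen (adj_hip hX hG (bGam n)).
Qed.

(** The part of x orthogonal to the ranges of all Gam_n^* is killed by every
    Gam_n, so x may be replaced by its projection to their closed span, which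
    is unitarily equivalent to H(K) since both carry the Gram matrix K. *)
Lemma rkhs_factor_hset x : hset X x -> hset H (fun n => Gam n x).
Proof.
move=> hx; have [T [uT TE]] := T_exists.
have [m Sm pm] := projection_exists hX cS1 hx; have hm := csub_sub cS1 Sm.
have -> : (fun n => Gam n x) = T m.
  rewrite TE //; apply/funext => n; apply/eqP; rewrite -subr_eq0; apply/eqP.
  rewrite -(linB hX (bounded_lin (bGam n))) //; apply: perp_ker => //; by hs.
exact: (unitary_hset uT).
Qed.

(** Injectivity means that no part of the state space is orthogonal to the
    ranges of the Gam_n^*. *)
Lemma rkhs_factor_unitary :
  (forall x, hset X x -> (forall n, Gam n x = 0) -> x = 0) ->
  unitary X H (fun x n => Gam n x).
Proof.
move=> inj; have [T [uT TE]] := T_exists.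
have S1E : S1 = hset X.
  apply: (csub_total hX cS1) => x hx px; apply: inj => // n; exact: perp_ker.
move: uT; rewrite S1E hsub_full => -[h1 h2 h3 h4]; split.
- by move=> x hx; rewrite -TE ?S1E //; apply: h1.
- by move=> a x y hx hy; rewrite -!TE ?S1E //; [apply: h2|hs].
- by move=> y /h3[x hx <-]; exists x => //; rewrite -TE ?S1E.
- by move=> x y hx hy; rewrite -!TE ?S1E //; apply: h4.
Qed.

End Factor.
End ReproducingKernel.

(** * Formal resolvents over the integer lattice *)

Section Levels.
Variable d : nat.
Implicit Types n m : Zd d.

Definition lev n : int := \sum_i n 0 i.

Lemma levD n m : lev (n + m) = lev n + lev m.
Proof. by rewrite /lev -big_split; apply: eq_bigr => i _; rewrite mxE. Qed.

Lemma levN n : lev (- n) = - lev n.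
Proof. by rewrite /lev -sumrN; apply: eq_bigr => i _; rewrite mxE. Qed.

Lemma lev0 : lev 0 = 0.
Proof. by rewrite /lev big1 // => i _; rewrite mxE. Qed.

Lemma lev_evec k : lev (evec k) = 1.
Proof.
rewrite /lev (bigD1 k) //= big1 ?addr0 => [|i /negPf ik]; rewrite mxE eqxx ?eqxx //.
by rewrite ik.
Qed.

Lemma nonneg_subE n k : nonneg_idx (n - evec k) -> nonneg_idx n.
Proof.
move=> h i; apply: le_trans (h i) _; rewrite !mxE lerBlDr lerDl.
by case: (_ && _).
Qed.

Lemma nonneg0 : nonneg_idx (0 : Zd d). Proof. by move=> i; rewrite mxE. Qed.

Lemma nonneg_Nevec k : ~ nonneg_idx (- evec k : Zd d).
Proof. by move=> /(_ k); rewrite !mxE !eqxx. Qed.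

Lemma nonneg_lev n : nonneg_idx n -> lev n = (\sum_i absz (n 0%R i))%N :> int.
Proof.
move=> h; rewrite /lev (big_morph Posz PoszD erefl); apply: eq_bigr => i _.
by rewrite gez0_abs //; exact: h.
Qed.

Lemma nonneg_lev_ge0 n : nonneg_idx n -> 0 <= lev n.
Proof. by move=> /nonneg_lev ->. Qed.

Lemma nonneg_lev0 n : nonneg_idx n -> lev n = 0 -> n = 0.
Proof.
move=> h l0; apply/rowP => i; rewrite mxE.
by apply: (psumr_eq0P (P := xpredT) (F := fun i => n 0 i)).
Qed.

(** Induction along the semigroup Z_+^d, for statements about coefficients
    supported in it. *)
Lemma Zd_ind (P : Zd d -> Prop) : (forall n, ~ nonneg_idx n -> P n) ->
  (forall n, nonneg_idx n -> (forall k, P (n - evec k)) -> P n) -> forall n, P n.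
Proof.
move=> P0 PS n; have [j] := ubnP `|lev n|%N.
elim: j n => // j IH n lj; have [nn|/P0//] := pselect (nonneg_idx n).
apply: PS => // k; have [nk|/P0//] := pselect (nonneg_idx (n - evec k)).
apply: IH; have := nonneg_lev_ge0 nk; rewrite levD levN lev_evec in lj *.
by lia.
Qed.

Definition simplex (j : nat) : set (Zd d) := [set n | nonneg_idx n /\ lev n = j].

Lemma simplex_subE j k n : nonneg_idx (n - evec k) ->
  simplex j.+1 n -> simplex j (n - evec k).
Proof. by move=> nk [nn ln]; split=> //; rewrite levD levN lev_evec ln; lia. Qed.

Lemma simplexP n : nonneg_idx n -> exists j, simplex j n.
Proof. by move=> nn; exists (\sum_i absz (n 0%R i))%N; split=> //; apply: nonneg_lev. Qed.

End Levels.

Section FormalPowers.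
Variables (R : realType) (d : nat) (V : lmodType R[i]).
Variable cs : 'I_d.+1 -> hspace V.
Hypothesis hcs : forall k, is_hilbert (cs k).
Local Notation X := (hdsum setT cs).
Local Notation VX := ('I_d.+1 -> V).
Local Open Scope complex_scope.

Lemma hX : is_hilbert X. Proof. exact: hdsum_fin_hilbert. Qed.

Lemma stateP (x : VX) : hset X x <-> forall k, hset (cs k) (x k).
Proof.
split=> [[h _ _] k|]; first exact: h.
exact: hdsum_fin_hset.
Qed.

Lemma proj_hset k x : hset X x -> hset X (cproj k x).
Proof.
move=> /stateP hx; apply/stateP => j; rewrite /Defs.proj; case: ifP => // _.
by have := hcs j => ?; hs.
Qed.

Lemma proj_linear k a (x y : VX) : cproj k (a *: x + y) = a *: cproj k x + cproj k y.
Proof.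
apply/funext => j; rewrite /Defs.proj !fctE; case: ifP => //.
by rewrite scaler0 addr0.
Qed.

Lemma proj0 k : cproj k (0 : VX) = 0.
Proof. by apply/funext => j; rewrite /Defs.proj; case: ifP. Qed.

Lemma projD k (x y : VX) : cproj k (x + y) = cproj k x + cproj k y.
Proof. by rewrite -[x in LHS]scale1r proj_linear scale1r. Qed.

Lemma proj_sum (I : Type) (r : seq I) k (F : I -> VX) :
  cproj k (\sum_(i <- r) F i) = \sum_(i <- r) cproj k (F i).
Proof. by apply: (big_morph (@Defs.proj R d V k) (projD k) (proj0 k)). Qed.

Lemma projK k (x : VX) : cproj k (cproj k x) = cproj k x.
Proof. by apply/funext => j; rewrite /Defs.proj; case: eqP. Qed.

Lemma sum_proj (x : VX) : \sum_k cproj k x = x.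
Proof.
apply/funext => j; rewrite fct_sumE (bigD1 j) //= big1 ?addr0 /Defs.proj ?eqxx //.
by move=> i /negPf; rewrite eq_sym => ->.
Qed.

Lemma hip_proj k x y : hset X x -> hset X y -> hip X (cproj k x) y = hip X x (cproj k y).
Proof.
move=> /stateP hx /stateP hy; rewrite !hdsum_fin_hip; apply: eq_bigr => j _.
rewrite /Defs.proj; case: ifP => // _.
by rewrite (hip0l (hcs j)) // (hip0r (hcs j)).
Qed.

Lemma sqr_hnorm_proj x : hset X x ->
  hnorm X x ^+ 2 = \sum_k hnorm X (cproj k x) ^+ 2.
Proof.
move=> hx; rewrite (sqr_hnorm hX hx) -{1}(sum_proj x) (hip_suml hX) //; last first.
  by move=> k; apply: proj_hset.
rewrite Re_sum; apply: eq_bigr => k _; rewrite (sqr_hnorm hX) //.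
  by rewrite -[in RHS]hip_proj ?projK //; apply: proj_hset.
exact: proj_hset.
Qed.

Lemma hnorm_proj_le k x : hset X x -> hnorm X (cproj k x) <= hnorm X x.
Proof.
move=> hx; rewrite -(@ler_pXn2r _ 2) ?nnegrE ?hnorm_ge0 // sqr_hnorm_proj //.
rewrite [leRHS]sqr_hnorm_proj // [leRHS](bigD1 k) //= (bigD1 k) //= projK lerD2l.
rewrite big1 => [|j jk]; first by apply: sumr_ge0 => j _; apply: sqr_ge0.
suff -> : cproj j (cproj k x) = 0 by rewrite hnorm0 ?expr0n //; apply: hX.
by apply/funext => i; rewrite /Defs.proj; case: eqP => // ->; rewrite (negPf jk).
exact: proj_hset.
Qed.

Lemma bounded_proj k : bounded_op X X (cproj k).
Proof.
split; [exact: proj_hset|by move=> a x y _ _; exact: proj_linear|].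
by exists 1 => x hx; rewrite mul1r hnorm_proj_le.
Qed.

Section Resolvent.
Variable T : VX -> VX.
Hypothesis bT : bounded_op X X T.
Let T0 : T 0 = 0. Proof. exact: lin0 hX (bounded_lin bT). Qed.
Let hT x : hset X x -> hset X (T x). Proof. exact: bounded_hset. Qed.

Lemma bounded_Zpow j n : bounded_op X X (Zpow T j n).
Proof.
elim: j n => [|j IH] n.
  have [e|e] := eqVneq n 0.
    by apply: bounded_ext (bounded_id X) => [|x _]; [exact: hX|rewrite /= e eqxx].
  by apply: bounded_ext (bounded_zero X hX) => [|x _]; [exact: hX|rewrite /= (negPf e)].
apply: (@bounded_sum _ _ _ X X) => [||k]; [exact: hX|exact: hX|].
apply: (bounded_comp (H2 := X) hX hX hX _ (bounded_proj k)).
exact: (bounded_comp hX hX hX (IH _) bT).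
Qed.

Lemma bounded_resolvent n : bounded_op X X (resolvent T n).
Proof. exact: bounded_Zpow. Qed.

Lemma Zpow_out j n x : ~ simplex j n -> Zpow T j n x = 0.
Proof.
elim: j n => [|j IH] n nj /=.
  by case: eqP => // n0; case: nj; rewrite n0; split; [exact: nonneg0|exact: lev0].
rewrite big1 // => k _; rewrite IH ?T0 ?proj0 // => -[nk lk]; apply: nj.
split; first exact: nonneg_subE nk.
by move: lk; rewrite levD levN lev_evec; lia.
Qed.

Lemma resolvent_out n x : ~ nonneg_idx n -> resolvent T n x = 0.
Proof. by move=> nn; apply: Zpow_out => -[]. Qed.

Lemma resolvent_Zpow j n x : simplex j n -> resolvent T n x = Zpow T j n x.
Proof. by case=> nn; rewrite (nonneg_lev nn) /resolvent => -[->]. Qed.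

Lemma Zpow_recr j n x : hset X x ->
  Zpow T j.+1 n x = \sum_k Zpow T j (n - evec k) (cproj k (T x)).
Proof.
move=> hx; elim: j n => [|j IH] n.
  by apply: eq_bigr => k _ /=; case: ifP => // _; rewrite T0 proj0.
rewrite [LHS]/=; under eq_bigr => k _ do rewrite -/(Zpow T j.+1 (n - evec k) x) IH.
have hp m l : hset X (Zpow T j m (cproj l (T x))).
  by apply: (bounded_hset (bounded_Zpow j m)); apply: proj_hset; apply: hT.
rewrite (eq_bigr (fun k => \sum_l cproj k
    (T (Zpow T j (n - evec k - evec l) (cproj l (T x)))))); last first.
  by move=> k _; rewrite (lin_sum hX (bounded_lin bT)) ?proj_sum.
rewrite exchange_big; apply: eq_bigr => l _ /=; apply: eq_bigr => k _.
by rewrite addrAC.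
Qed.

Lemma resolvent0 x : resolvent T 0 x = x.
Proof.
rewrite (resolvent_Zpow (j := 0)) /= ?eqxx //.
by split; [exact: nonneg0|exact: lev0].
Qed.

(** Expand (I - Z T)^(-1) = I + Z T (I - Z T)^(-1), that is, split off the
    last step of a formal trajectory. *)
Lemma resolvent_recl n x :
  resolvent T n x = delta0 n x + \sum_k cproj k (T (resolvent T (n - evec k) x)).
Proof.
have [nn|nn] := pselect (nonneg_idx n); last first.
  rewrite resolvent_out // big1 => [|k _].
    by rewrite /delta0; case: eqP => [e|]; [case: nn; rewrite e; exact: nonneg0|rewrite addr0].
  by rewrite resolvent_out ?T0 ?proj0 // => /nonneg_subE.
have [[|j] sj] := simplexP nn.
  have n0 : n = 0 by case: sj => _; apply: nonneg_lev0.
  rewrite n0 resolvent0 /delta0 eqxx big1 ?addr0 // => k _.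
  by rewrite sub0r resolvent_out ?T0 ?proj0 //; apply: nonneg_Nevec.
rewrite (resolvent_Zpow _ sj) /delta0; case: eqP => [n0|_].
  by case: sj => _; rewrite n0 lev0.
rewrite add0r; apply: eq_bigr => k _; rewrite -/(Zpow T j (n - evec k) x).
congr (cproj k (T _)).
have [nk|nk] := pselect (nonneg_idx (n - evec k)).
  by rewrite (resolvent_Zpow _ (simplex_subE nk sj)).
by rewrite resolvent_out // Zpow_out // => -[].
Qed.

(** Expand (I - Z T)^(-1) = I + (I - Z T)^(-1) Z T, that is, split off the
    first step of a formal trajectory. *)
Lemma resolvent_recr n x : hset X x ->
  resolvent T n x = delta0 n x + \sum_k resolvent T (n - evec k) (cproj k (T x)).
Proof.
move=> hx; have [nn|nn] := pselect (nonneg_idx n); last first.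
  rewrite resolvent_out // big1 => [|k _].
    by rewrite /delta0; case: eqP => [e|]; [case: nn; rewrite e; exact: nonneg0|rewrite addr0].
  by rewrite resolvent_out // => /nonneg_subE.
have [[|j] sj] := simplexP nn.
  have n0 : n = 0 by case: sj => _; apply: nonneg_lev0.
  rewrite n0 resolvent0 /delta0 eqxx big1 ?addr0 // => k _.
  by rewrite sub0r resolvent_out //; apply: nonneg_Nevec.
rewrite (resolvent_Zpow _ sj) Zpow_recr // /delta0; case: eqP => [n0|_].
  by case: sj => _; rewrite n0 lev0.
rewrite add0r; apply: eq_bigr => k _.
have [nk|nk] := pselect (nonneg_idx (n - evec k)).
  by rewrite (resolvent_Zpow _ (simplex_subE nk sj)).
by rewrite resolvent_out // Zpow_out // => -[].
Qed.

(** Coefficient of z^n in (I - Z T)^(-1) Z. *)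
Definition resZ n x := \sum_k resolvent T (n - evec k) (cproj k x).

Lemma bounded_resZ n : bounded_op X X (resZ n).
Proof.
apply: (@bounded_sum _ _ _ X X) => [||k]; [exact: hX|exact: hX|].
exact: (bounded_comp hX hX hX (bounded_proj k) (bounded_resolvent _)).
Qed.

Lemma resZ_out n x : ~ nonneg_idx n -> resZ n x = 0.
Proof. by move=> nn; apply: big1 => k _; rewrite resolvent_out // => /nonneg_subE. Qed.

Lemma resZ_recl n x : hset X x -> resZ n x =
  \sum_k delta0 (n - evec k) (cproj k x) + \sum_k cproj k (T (resZ (n - evec k) x)).
Proof.
move=> hx; rewrite /resZ; under eq_bigr => k _ do rewrite resolvent_recl.
have hp m k : hset X (resolvent T m (cproj k x)).
  by apply: (bounded_hset (bounded_resolvent m)); apply: proj_hset.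
rewrite big_split /=; congr (_ + _); rewrite exchange_big; apply: eq_bigr => l _ /=.
rewrite (lin_sum hX (bounded_lin bT)) ?proj_sum //.
by apply: eq_bigr => k _; rewrite addrAC.
Qed.

Lemma resZ_recr n x : hset X x -> resZ n x =
  \sum_k delta0 (n - evec k) (cproj k x) + \sum_k resZ (n - evec k) (T (cproj k x)).
Proof.
move=> hx; rewrite /resZ -big_split; apply: eq_bigr => k _.
by rewrite resolvent_recr //; exact: proj_hset.
Qed.

End Resolvent.

Lemma resolvent_ext T T' n x : bounded_op X X T ->
  (forall y, hset X y -> T y = T' y) -> hset X x -> resolvent T n x = resolvent T' n x.
Proof.
move=> bT e hx; rewrite /resolvent; move: (\sum_i absz (n 0%R i))%N => j.
elim: j n => [|j IH] n //=.
apply: eq_bigr => k _; rewrite -IH e //.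
by apply: (bounded_hset (bounded_Zpow bT j _)).
Qed.

(** Reversing a product of alternating factors Z and T gives a product of the
    same shape, so (I - Z T)^(-1) Z has the formal adjoint built from the adjoint
    of T. One side is unfolded from the left and the other from the right. *)
Lemma resZ_adj T T' : bounded_op X X T -> bounded_op X X T' ->
  (forall x y, hset X x -> hset X y -> hip X (T x) y = hip X x (T' y)) ->
  forall n x y, hset X x -> hset X y -> hip X (resZ T n x) y = hip X x (resZ T' n y).
Proof.
move=> bT bT' TT' n x + hx; elim/Zd_ind: n => [n nn|n nn IH] y hy.
  by rewrite !resZ_out // (hip0l hX) // (hip0r hX).
have hz k : hset X (resZ T k x) by apply: (bounded_hset (bounded_resZ bT k)).
have hTz k : hset X (T (resZ T k x)) by apply: (bounded_hset bT).
have hpx k := proj_hset k hx; have hpy k := proj_hset k hy.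
have hpT k l : hset X (cproj l (T (resZ T k x))) by apply: proj_hset.
have hTy k : hset X (T' (cproj k y)) by apply: (bounded_hset bT').
have hz' k l : hset X (resZ T' k (T' (cproj l y))).
  exact: (bounded_hset (bounded_resZ bT' k)).
have X_ := hX.
rewrite resZ_recl // resZ_recr // (hipDl hX) ?(hipDr hX); try hs.
rewrite !(hip_suml hX) ?(hip_sumr hX) //; try by move=> k; hs.
congr (_ + _); apply: eq_bigr => k _.
  rewrite /delta0; case: ifP => _; first exact: hip_proj.
  by rewrite (hip0l hX) // (hip0r hX).
by rewrite hip_proj // TT' // IH.
Qed.

End FormalPowers.

(** * Formal transfer functions and observations of a colligation *)

Section Blocks.
Variables (R : realType) (d : nat) (VE VEs V : lmodType R[i]).
Variables (E : hspace VE) (Es : hspace VEs) (U : colligation d V VE VEs).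
Hypothesis (hE : is_hilbert E) (hEs : is_hilbert Es) (hU : GR_unitary E Es U).
Local Notation X := (state U).

Lemma state_hilbert : is_hilbert X.
Proof. by case: hU => hcs _; exact: hX. Qed.

Let hXX := state_hilbert.
Let hXE : is_hilbert (hprod X E). Proof. exact: hprod_hilbert. Qed.
Let hXEs : is_hilbert (hprod X Es). Proof. exact: hprod_hilbert. Qed.
Let uU : unitary (hprod X E) (hprod X Es) (cmap U). Proof. by case: hU. Qed.

Lemma cmap_hset x e : hset X x -> hset E e ->
  hset X (cmap U (x, e)).1 /\ hset Es (cmap U (x, e)).2.
Proof. by move=> hx he; have := unitary_hset uU (x := (x, e)); apply; split. Qed.

Lemma cmapE x e : hset X x -> hset E e ->
  cmap U (x, e) = (blockA U x + blockB U e, blockC U x + blockD U e).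
Proof.
move=> hx he; have -> : (x, e) = (x, 0) + (0, e).
  by rewrite -[RHS]/(x + 0, 0 + e) addr0 add0r.
rewrite (linD (H1 := hprod X E) (unitary_lin uU)) //; hs.
Qed.

Lemma blockAE x e : hset X x -> hset E e -> (cmap U (x, e)).1 = blockA U x + blockB U e.
Proof. by move=> hx he; rewrite cmapE. Qed.

Lemma blockCE x e : hset X x -> hset E e -> (cmap U (x, e)).2 = blockC U x + blockD U e.
Proof. by move=> hx he; rewrite cmapE. Qed.

Let inl_bounded : bounded_op X (hprod X E) (fun x => (x, 0)).
Proof. exact: (bounded_pair hXX hXX hE (bounded_id X) (bounded_zero X hE)). Qed.

Let inr_bounded : bounded_op E (hprod X E) (fun e => (0, e)).
Proof. exact: (bounded_pair hE hXX hE (bounded_zero E hXX) (bounded_id E)). Qed.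

Let fst_bounded : bounded_op (hprod X Es) X (fun p => p.1).
Proof.
split; [by move=> x []|by []|exists 1 => -[x y] [/= hx hy]; rewrite mul1r].
by have [] := hnorm_hprod_ge hXX hEs hx hy.
Qed.

Let snd_bounded : bounded_op (hprod X Es) Es (fun p => p.2).
Proof.
split; [by move=> x []|by []|exists 1 => -[x y] [/= hx hy]; rewrite mul1r].
by have [] := hnorm_hprod_ge hXX hEs hx hy.
Qed.

Lemma bounded_blockA : bounded_op X X (blockA U).
Proof.
apply: (bounded_comp hXX hXEs hXX _ fst_bounded).
exact: (bounded_comp hXX hXE hXEs inl_bounded (unitary_bounded uU)).
Qed.

Lemma bounded_blockB : bounded_op E X (blockB U).
Proof.
apply: (bounded_comp hE hXEs hXX _ fst_bounded).
exact: (bounded_comp hE hXE hXEs inr_bounded (unitary_bounded uU)).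
Qed.

Lemma bounded_blockC : bounded_op X Es (blockC U).
Proof.
apply: (bounded_comp hXX hXEs hEs _ snd_bounded).
exact: (bounded_comp hXX hXE hXEs inl_bounded (unitary_bounded uU)).
Qed.

Lemma bounded_blockD : bounded_op E Es (blockD U).
Proof.
apply: (bounded_comp hE hXEs hEs _ snd_bounded).
exact: (bounded_comp hE hXE hXEs inr_bounded (unitary_bounded uU)).
Qed.

Lemma blockA_hset x : hset X x -> hset X (blockA U x).
Proof. exact: (bounded_hset bounded_blockA). Qed.
Lemma blockB_hset e : hset E e -> hset X (blockB U e).
Proof. exact: (bounded_hset bounded_blockB). Qed.
Lemma blockC_hset x : hset X x -> hset Es (blockC U x).
Proof. exact: (bounded_hset bounded_blockC). Qed.
Lemma blockD_hset e : hset E e -> hset Es (blockD U e).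
Proof. exact: (bounded_hset bounded_blockD). Qed.

Lemma blockA_contr x : hset X x -> hnorm X (blockA U x) <= hnorm X x.
Proof.
move=> hx; have hx0 : hset (hprod X E) (x, 0) by hs.
have [h1 h2] := unitary_hset uU hx0.
have := unitary_hnorm uU hx0; rewrite [cmap _ _]surjective_pairing => e.
have -> : hnorm X x = hnorm (hprod X E) (x, 0).
  apply/eqP; rewrite -(@eqrXn2 _ 2) ?hnorm_ge0 // hnorm_hprod //; last by hs.
  by rewrite (hnorm0 hE) expr0n addr0.
by rewrite -e; have [] := hnorm_hprod_ge hXX hEs h1 h2.
Qed.

(** Coefficient of z^n in D + C (I - Z A)^(-1) Z B. *)
Definition transfer (n : Zd d) e :=
  delta0 n (blockD U e) + blockC U (resZ (blockA U) n (blockB U e)).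

Lemma resolvent_hset n x : hset X x -> hset X (resolvent (blockA U) n x).
Proof. by case: hU => hcs _; apply: (bounded_hset (bounded_resolvent hcs bounded_blockA n)). Qed.

Lemma resZ_hset n x : hset X x -> hset X (resZ (blockA U) n x).
Proof. by case: hU => hcs _; apply: (bounded_hset (bounded_resZ hcs bounded_blockA n)). Qed.

Lemma cproj_hset k x : hset X x -> hset X (cproj k x).
Proof. by case: hU => hcs _; apply: proj_hset. Qed.

Lemma blockC_resZ n x : hset X x ->
  blockC U (resZ (blockA U) n x) =
  \sum_k blockC U (resolvent (blockA U) (n - evec k) (cproj k x)).
Proof.
move=> hx; apply: (lin_sum hXX (bounded_lin bounded_blockC)) => k.
by apply: resolvent_hset; apply: cproj_hset.
Qed.

(** With y = A x + B e and e' = C x + D e, expanding (I - Z A)^(-1) x = x + (I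
    - Z A)^(-1) Z A x turns one step of the colligation into C (I - Z A)^(-1)
    x + transfer e = e' + C (I - Z A)^(-1) Z y. *)
Lemma formal_output x e m : hset X x -> hset E e ->
  blockC U (resolvent (blockA U) m x) + transfer m e =
  delta0 m (cmap U (x, e)).2 + blockC U (resZ (blockA U) m (cmap U (x, e)).1).
Proof.
move=> hx he; case: (hU) => hcs _.
have hAx := blockA_hset hx; have hBe := blockB_hset he.
have hCx := blockC_hset hx; have hDe := blockD_hset he.
rewrite (resolvent_recr hcs bounded_blockA) // -/(resZ _ m _) cmapE //=.
have lC := bounded_lin bounded_blockC.
rewrite (linD lC) ?(lin_delta0 hXX lC) //; try exact: resZ_hset; last by hs.
have lZ := bounded_lin (bounded_resZ hcs bounded_blockA m).
rewrite (linD lZ) // (linD lC) //; try exact: resZ_hset.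
rewrite /transfer; set p := blockC U (resZ _ _ (blockA _ _)).
set q := blockC U (resZ _ _ (blockB _ _)).
have -> : delta0 m (blockC U x + blockD U e) = delta0 m (blockC U x) + delta0 m (blockD U e).
  by rewrite /delta0; case: ifP; rewrite ?addr0.
by rewrite addrACA.
Qed.

Lemma transfer_hset n e : hset E e -> hset Es (transfer n e).
Proof.
move=> he; apply: hsetD => //; first by apply: hset_delta0 => //; exact: blockD_hset.
by apply: blockC_hset; apply: resZ_hset; apply: blockB_hset.
Qed.

Lemma transfer_out n e : ~ nonneg_idx n -> transfer n e = 0.
Proof.
move=> nn; case: (hU) => hcs _; rewrite /transfer (resZ_out hcs bounded_blockA) //.
rewrite (lin0 hXX (bounded_lin bounded_blockC)) addr0 /delta0; case: eqP => // n0.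
by case: nn; rewrite n0; apply: nonneg0.
Qed.

(** The inverse of U, as a colligation with input space E_*; its blocks are the
    adjoints of those of U. *)
Definition dual : colligation d V VEs VE :=
  Colligation (cspace U) (uinv (hprod X E) (cmap U)).

Lemma dual_unitary : GR_unitary Es E dual.
Proof. by case: hU => hcs _; split=> //; exact: unitary_uinv. Qed.

Lemma dual_hip p q : hset (hprod X E) p -> hset (hprod X Es) q ->
  hip (hprod X Es) (cmap U p) q = hip (hprod X E) p (cmap dual q).
Proof.
move=> hp hq; have [hu e] := uinvP uU hq.
by rewrite -{1}e (unitary_hip uU).
Qed.

Lemma cmap_dualK p : hset (hprod X E) p -> cmap dual (cmap U p) = p.
Proof. by move=> hp; exact: (uinvK uU). Qed.

Lemma dual_cmapK q : hset (hprod X Es) q -> cmap U (cmap dual q) = q.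
Proof. by move=> hq; have [] := uinvP uU hq. Qed.

End Blocks.

#[global] Hint Resolve state_hilbert blockA_hset blockB_hset blockC_hset blockD_hset
  resolvent_hset resZ_hset cproj_hset transfer_hset dual_unitary : hil.

Section Duality.
Variables (R : realType) (d : nat) (VE VEs V : lmodType R[i]).
Variables (E : hspace VE) (Es : hspace VEs) (U : colligation d V VE VEs).
Hypothesis (hE : is_hilbert E) (hEs : is_hilbert Es) (hU : GR_unitary E Es U).
Local Notation X := (state U).
Local Notation U' := (dual E U).

Let hXX : is_hilbert X := state_hilbert hU.
Let hU' : GR_unitary Es E U' := dual_unitary hE hU.
Let hcs : forall k, is_hilbert (cspace U k). Proof. by case: hU. Qed.

Let dualE x e y e' : hset X x -> hset E e -> hset X y -> hset Es e' ->
  hip X (cmap U (x, e)).1 y + hip Es (cmap U (x, e)).2 e' =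
  hip X x (cmap U' (y, e')).1 + hip E e (cmap U' (y, e')).2.
Proof.
move=> hx he hy he'.
exact: (@dual_hip _ _ _ _ _ E Es U hU (x, e) (y, e') (conj hx he) (conj hy he')).
Qed.

Lemma blockA_dual x y : hset X x -> hset X y ->
  hip X (blockA U x) y = hip X x (blockA U' y).
Proof.
move=> hx hy; have := dualE hx (hset0 hE) hy (hset0 hEs).
have [_ h1] := cmap_hset hU hx (hset0 hE); have [_ h2] := cmap_hset hU' hy (hset0 hEs).
by rewrite (hip0r hEs) // (hip0l hE) // !addr0.
Qed.

Lemma blockB_dual e y : hset E e -> hset X y ->
  hip X (blockB U e) y = hip E e (blockC U' y).
Proof.
move=> he hy; have := dualE (hset0 hXX) he hy (hset0 hEs).
have [_ h1] := cmap_hset hU (hset0 hXX) he; have [h2 _] := cmap_hset hU' hy (hset0 hEs).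
by rewrite (hip0r hEs) // (hip0l hXX) // addr0 add0r.
Qed.

Lemma blockC_dual x e : hset X x -> hset Es e ->
  hip Es (blockC U x) e = hip X x (blockB U' e).
Proof.
move=> hx he; have := dualE hx (hset0 hE) (hset0 hXX) he.
have [h1 _] := cmap_hset hU hx (hset0 hE); have [_ h2] := cmap_hset hU' (hset0 hXX) he.
by rewrite (hip0r hXX) // (hip0l hE) // addr0 add0r.
Qed.

Lemma blockD_dual e e' : hset E e -> hset Es e' ->
  hip Es (blockD U e) e' = hip E e (blockD U' e').
Proof.
move=> he he'; have := dualE (hset0 hXX) he (hset0 hXX) he'.
have [h1 _] := cmap_hset hU (hset0 hXX) he; have [h2 _] := cmap_hset hU' (hset0 hXX) he'.
by rewrite (hip0r hXX) // (hip0l hXX) // !add0r.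
Qed.

Lemma adj_blockA y : hset X y -> adj X X (blockA U) y = blockA U' y.
Proof.
move=> hy; apply: (adj_unique hXX); first exact: (blockA_hset hEs hE hU').
by move=> x hx; apply: blockA_dual.
Qed.

Lemma adj_blockB y : hset X y -> adj E X (blockB U) y = blockC U' y.
Proof.
move=> hy; apply: (adj_unique hE); first exact: (blockC_hset hEs hE hU').
by move=> x hx; apply: blockB_dual.
Qed.

Lemma adj_blockC e : hset Es e -> adj X Es (blockC U) e = blockB U' e.
Proof.
move=> he; apply: (adj_unique hXX); first exact: (blockB_hset hEs hE hU').
by move=> x hx; apply: blockC_dual.
Qed.

(** The transfer function of the dual colligation is the formal adjoint of the
    original one, because (I - Z A)^(-1) Z has a formal adjoint of the same
    shape. *)
Lemma transfer_dual n e e' : hset E e -> hset Es e' ->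
  hip Es (transfer U n e) e' = hip E e (transfer U' n e').
Proof.
move=> he he'; rewrite /transfer.
have hB := blockB_hset hE hEs hU he; have hB' := blockB_hset hEs hE hU' he'.
have hD := blockD_hset hE hEs hU he; have hD' := blockD_hset hEs hE hU' he'.
have hZ := resZ_hset hE hEs hU n hB; have hZ' := resZ_hset hEs hE hU' n hB'.
have hC := blockC_hset hE hEs hU hZ; have hC' := blockC_hset hEs hE hU' hZ'.
rewrite (hipDl hEs) ?(hipDr hE); try hs; congr (_ + _).
  rewrite /delta0; case: ifP => _; first exact: blockD_dual.
  by rewrite (hip0l hEs) // (hip0r hE).
rewrite blockC_dual // -blockB_dual //.
apply: (resZ_adj hcs) => //; first exact: bounded_blockA hE hEs hU.
  exact: bounded_blockA hEs hE hU'.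
exact: blockA_dual.
Qed.

(** Both components of Gamma_k have the same form, for U and for its dual, so
    that each fact about observations has to be proved for one component only.
    *)
Lemma GammaE k n x : hset X x -> Gamma E U k n x =
  (blockC U (resolvent (blockA U) n (cproj k x)),
   blockC U' (resolvent (blockA U') (- evec k - n) (cproj k x))).
Proof.
move=> hx; have hp := cproj_hset hU k hx.
have bA' := bounded_blockA hEs hE hU'.
have e : resolvent (adj X X (blockA U)) (- evec k - n) (cproj k x) =
    resolvent (blockA U') (- evec k - n) (cproj k x).
  by apply/esym; apply: (resolvent_ext hcs _ bA') => // y hy; rewrite adj_blockA.
by rewrite /Gamma e adj_blockB //; apply: (resolvent_hset hEs hE hU').
Qed.

Lemma bounded_Gamma k n : bounded_op X (hprod Es E) (Gamma E U k n).
Proof.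
apply: (@bounded_ext _ _ _ X _ (fun x => (blockC U (resolvent (blockA U) n (cproj k x)),
   blockC U' (resolvent (blockA U') (- evec k - n) (cproj k x))))) => //.
  by move=> x hx; rewrite GammaE.
have bp := bounded_proj hcs k.
have br := bounded_resolvent hcs (bounded_blockA hE hEs hU) n.
have br' := bounded_resolvent hcs (bounded_blockA hEs hE hU') (- evec k - n).
apply: bounded_pair => //.
  apply: (bounded_comp (H2 := X)) (bounded_blockC hE hEs hU) => //.
  exact: (bounded_comp (H2 := X)) bp br.
apply: (bounded_comp (H2 := X)) (bounded_blockC hEs hE hU') => //.
exact: (bounded_comp (H2 := X)) bp br'.
Qed.

(** Summation over k removes the projections. Multiplication by z_k before
    summing replaces (I - Z A)^(-1) by (I - Z A)^(-1) Z in the first component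
    and has the opposite effect in the second one, where negative powers of
    z_k occur. *)
Lemma sum_Gamma1 m x : hset X x ->
  \sum_k (Gamma E U k m x).1 = blockC U (resolvent (blockA U) m x).
Proof.
move=> hx; under eq_bigr => k _ do rewrite GammaE //=.
rewrite -{2}(sum_proj x) (lin_sum hXX (bounded_lin (bounded_resolvent hcs (bounded_blockA hE hEs hU) m))).
  rewrite (lin_sum hXX (bounded_lin (bounded_blockC hE hEs hU))) // => k.
  by apply: (resolvent_hset hE hEs hU); apply: (cproj_hset hU).
by move=> k; apply: (cproj_hset hU).
Qed.

Lemma sum_Gamma1S m x : hset X x ->
  \sum_k (Gamma E U k (m - evec k) x).1 = blockC U (resZ (blockA U) m x).
Proof.
by move=> hx; rewrite (blockC_resZ hE hEs hU).
Qed.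

Lemma sum_Gamma2 m x : hset X x ->
  \sum_k (Gamma E U k m x).2 = blockC U' (resZ (blockA U') (- m) x).
Proof.
move=> hx; rewrite (blockC_resZ hEs hE hU') //.
by apply: eq_bigr => k _; rewrite GammaE //= addrC.
Qed.

Lemma sum_Gamma2S m x : hset X x ->
  \sum_k (Gamma E U k (m - evec k) x).2 = blockC U' (resolvent (blockA U') (- m) x).
Proof.
move=> hx; have e k : - evec k - (m - evec k) = - m.
  by rewrite opprB addKr.
under eq_bigr => k _ do rewrite GammaE //= e.
rewrite -{2}(sum_proj x) (lin_sum hXX (bounded_lin (bounded_resolvent hcs (bounded_blockA hEs hE hU') (- m)))).
  rewrite (lin_sum hXX (bounded_lin (bounded_blockC hEs hE hU'))) // => k.
  by apply: (resolvent_hset hEs hE hU'); apply: (cproj_hset hU).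
by move=> k; apply: (cproj_hset hU).
Qed.

(** This relation between the observations of a state and its z_k-shifted
    observations after one step is [formal_output] for U in the first
    component and for its dual in the second one. It determines U once the
    maps x |-> Gamma_k(z) x are known. *)
Lemma colligation_identity x e m : hset X x -> hset E e ->
  let y := (cmap U (x, e)).1 in let e' := (cmap U (x, e)).2 in
  \sum_k Gamma E U k (m - evec k) y + (delta0 m e', transfer U' (- m) e') =
  \sum_k Gamma E U k m x + (transfer U m e, delta0 m e).
Proof.
move=> hx he y e'; have [hy he'] := cmap_hset hU hx he; rewrite -/y -/e' in hy he'.
have pairE (F : 'I_d.+1 -> VEs * VE) : \sum_k F k = (\sum_k (F k).1, \sum_k (F k).2).
  rewrite [LHS]surjective_pairing; congr (_, _).
    by apply: (big_morph fst).
  by apply: (big_morph snd).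
rewrite [\sum_k Gamma E U k (m - _) y]pairE [\sum_k Gamma E U k m x]pairE.
rewrite sum_Gamma1 // sum_Gamma1S // sum_Gamma2 // sum_Gamma2S //.
congr (_, _) => /=.
  by rewrite addrC (formal_output hE hEs hU).
rewrite (formal_output hEs hE hU') // /y /e' -surjective_pairing.
rewrite (cmap_dualK hE hU) /=; last by split.
rewrite addrC; congr (_ + _); rewrite /delta0 oppr_eq0 //.
Qed.

(** The dual colligation maps (x, 0) to (A^* x, B^* x) = (A^* x, 0), and U
    maps this back to (x, 0). *)
Lemma blocks_on_kerC x : hset X x -> blockC U' x = 0 ->
  blockA U (blockA U' x) = x /\ blockC U (blockA U' x) = 0.
Proof.
move=> hx Cx; have e : cmap U' (x, 0) = (blockA U' x, 0).
  by rewrite -Cx [LHS]surjective_pairing.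
have k : cmap U (blockA U' x, 0) = (x, 0) by rewrite -e (dual_cmapK hU (hset_pair hx (hset0 hEs))).
by split; [exact: (congr1 fst k)|exact: (congr1 snd k)].
Qed.

End Duality.

Section Connectedness.
Variables (R : realType) (d : nat) (VE VEs V : lmodType R[i]).
Variables (E : hspace VE) (Es : hspace VEs) (U : colligation d V VE VEs).
Hypothesis (hE : is_hilbert E) (hEs : is_hilbert Es) (hU : GR_unitary E Es U).
Local Notation X := (state U).
Local Notation U' := (dual E U).
Let hXX : is_hilbert X := state_hilbert hU.
Let hU' : GR_unitary Es E U' := dual_unitary hE hU.
Let hcs : forall k, is_hilbert (cspace U k). Proof. by case: hU. Qed.

Let hip_eq0C x y : hset X x -> hset X y -> hip X x y = 0 -> hip X y x = 0.
Proof. by move=> hx hy h; rewrite (hip_conj hXX (x := x)) // h conjc0. Qed.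

Let conjA x y : hset X x -> hset X y -> hip X (blockA U' x) y = hip X x (blockA U y).
Proof.
move=> hx hy; have h1 := blockA_hset hE hEs hU hy; have h2 := blockA_hset hEs hE hU' hx.
by rewrite (hip_conj hXX (x := y)) // -(blockA_dual hE hEs hU) // -(hip_conj hXX).
Qed.

Let conjC x e : hset X x -> hset E e -> hip E (blockC U' x) e = hip X x (blockB U e).
Proof.
move=> hx he; have h1 := blockB_hset hE hEs hU he; have h2 := blockC_hset hEs hE hU' hx.
by rewrite (hip_conj hE (x := e)) // -(blockB_dual hE hEs hU) // -(hip_conj hXX).
Qed.

(** Used for N the orthogonal complement of a reducing subspace. *)
Lemma resolvent_stable (N : set ('I_d.+1 -> V)) T n x : linear_set N ->
  (forall x, N x -> N (T x)) -> (forall k x, N x -> N (cproj k x)) ->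
  N x -> N (resolvent T n x).
Proof.
move=> [N0 NZD] NT NP Nx; rewrite /resolvent; move: (\sum_i absz (n 0%R i))%N => j.
elim: j n => [|j IH] n /=; first by case: ifP.
elim/big_ind: _ => // [y z Ny Nz|k _]; last by apply: NP; apply: NT.
by rewrite -[y]scale1r; apply: NZD.
Qed.

(** The orthogonal complement of a reducing subspace that contains im B and im
    C^* is again reducing and lies in the kernels of C and B^*. Hence no
    Gamma_k sees its elements. *)
Lemma closely_connected_of_inj :
  (forall x, hset X x -> (forall k n, Gamma E U k n x = 0) -> x = 0) ->
  closely_connected E Es U.
Proof.
move=> inj M cM MB MC MA MA' MP; apply: (csub_total hXX cM) => x0 hx0 px0.
have sM := csub_sub cM.
have N0 : perp X M x0 by [].
have lN : linear_set (perp X M) by case: (perp_closed hXX sM).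
have NP k x : perp X M x -> perp X M (cproj k x).
  case=> hx px; split; first exact: (cproj_hset hU).
  by move=> y My; rewrite (hip_proj hcs) ?px //; [exact: MP|exact: sM].
have NA x : perp X M x -> perp X M (blockA U x).
  case=> hx px; split; first exact: (blockA_hset hE hEs hU).
  move=> y My; have hy := sM _ My; rewrite (blockA_dual hE hEs hU) //.
  by rewrite -(adj_blockA hE hEs hU) // px //; apply: MA'.
have NA' x : perp X M x -> perp X M (blockA U' x).
  case=> hx px; split; first exact: (blockA_hset hEs hE hU').
  by move=> y My; have hy := sM _ My; rewrite conjA // px //; apply: MA.
apply: inj => // k n; rewrite (GammaE hE hEs hU) //.
have [h1 p1] := resolvent_stable n lN NA NP (NP k _ N0).
have [h2 p2] := resolvent_stable (- evec k - n) lN NA' NP (NP k _ N0).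
have hC1 := blockC_hset hE hEs hU h1; have hC2 := blockC_hset hEs hE hU' h2.
congr (_, _).
  apply: (hip_inj hEs) => // [|e he]; first by hs.
  rewrite (hip0l hEs) // (blockC_dual hE hU) // -(adj_blockC hE hEs hU) //.
  by apply: p1; apply: MC.
apply: (hip_inj hE) => // [|e he]; first by hs.
by rewrite (hip0l hE) // conjC // p2 //; apply: MB.
Qed.

(** The orthogonal complement of such an N is one of the subspaces that close
    connectedness speaks of. *)
Lemma closely_connected_trivial (N : set ('I_d.+1 -> V)) :
  closely_connected E Es U -> N `<=` hset X ->
  (forall x, N x -> blockC U x = 0) -> (forall x, N x -> blockC U' x = 0) ->
  (forall x, N x -> N (blockA U x)) -> (forall x, N x -> N (blockA U' x)) ->
  (forall k x, N x -> N (cproj k x)) -> forall x, N x -> x = 0.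
Proof.
move=> cc sN NC NC' NA NA' NP x Nx.
suff M_full : perp X N = hset X.
  have /= [hx px] : perp X N x by rewrite M_full; apply: sN.
  by apply: (hip_eq0 hXX) => //; apply: px.
apply: cc.
- exact: perp_closed.
- move=> e he; have hB := blockB_hset hE hEs hU he; split=> // n Nn.
  have hn := sN _ Nn; apply: hip_eq0C => //.
  by rewrite -conjC // NC' // (hip0l hE).
- move=> e he; rewrite (adj_blockC hE hEs hU) //.
  have hB := blockB_hset hEs hE hU' he; split=> // n Nn.
  have hn := sN _ Nn; apply: hip_eq0C => //.
  by rewrite -(blockC_dual hE hU) // NC // (hip0l hEs).
- move=> y [hy py]; split; first exact: (blockA_hset hE hEs hU).
  by move=> n Nn; have hn := sN _ Nn; rewrite (blockA_dual hE hEs hU) // py //; apply: NA'.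
- move=> y [hy py]; rewrite (adj_blockA hE hEs hU) //.
  split; first exact: (blockA_hset hEs hE hU').
  by move=> n Nn; have hn := sN _ Nn; rewrite conjA // py //; apply: NA.
- move=> k y [hy py]; split; first exact: (cproj_hset hU).
  by move=> n Nn; have hn := sN _ Nn; rewrite (hip_proj hcs) // py //; apply: NP.
Qed.

End Connectedness.

(** * The functional model *)

Section AbelianGroups.

Lemma zmod_cancel (W : zmodType) (a b c d : W) : a - b + (c - d) + (b + d) = a + c.
Proof. by rewrite addrACA !subrK. Qed.

Lemma pairD (W W' : zmodType) (p q : (W * W')%type) : p + q = (p.1 + q.1, p.2 + q.2).
Proof. by []. Qed.

End AbelianGroups.

Section Model.
Variables (R : realType) (d : nat) (VE VEs : lmodType R[i]).
Variables (E : hspace VE) (Es : hspace VEs).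
Variables (Sn : Zd d -> VE -> VEs) (K : 'I_d.+1 -> kernel d (VEs * VE)%type).
Hypothesis (hE : is_hilbert E) (hEs : is_hilbert Es).
Hypothesis bSn : forall n, bounded_op E Es (Sn n).
Hypothesis hK : augmented_agler_decomposition E Es Sn K.
Local Notation G := (hprod Es E).
Local Notation H := (HK E Es K).
Local Notation X := (hdsum setT H).
Local Notation HD := (hprod X E).
Local Notation HR := (hprod X Es).
Local Notation VF := ('I_d.+1 -> Zd d -> VEs * VE)%type.

Let hG : is_hilbert G. Proof. exact: hprod_hilbert. Qed.

Lemma HK_rkhs k : is_rkhs G (K k) (H k).
Proof.
case: hK => _ /(_ k)[W [Y [F [hY bF _ _ KE]]]] _.
exact: rkhs_exists hY hG bF KE.
Qed.

Lemma HK_hilbert k : is_hilbert (H k). Proof. by case: (HK_rkhs k). Qed.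
Let hH := HK_hilbert.
Let hXX : is_hilbert X. Proof. exact: hX. Qed.
Let hHD : is_hilbert HD. Proof. exact: hprod_hilbert. Qed.
Let hHR : is_hilbert HR. Proof. exact: hprod_hilbert. Qed.

Lemma HK_coef k f n : hset (H k) f -> hset G (f n).
Proof. by case: (HK_rkhs k) => _ h _ _; apply: h. Qed.

Lemma HK_sec k m g : hset G g -> hset (H k) (ksec (K k) m g).
Proof. by case: (HK_rkhs k) => _ _ h _; apply: h. Qed.

Lemma HK_repr k f m g : hset (H k) f -> hset G g ->
  hip (H k) f (ksec (K k) m g) = hip G (f m) g.
Proof. by case: (HK_rkhs k) => _ _ _ h; apply: h. Qed.

(** The pairing of f_n with (u, 0) is the inner product of f with the section
    [K_k]_n (u, 0), and this section is 0 because H_k(n)^* (u, 0) = 0 outside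
    the support of the first component. *)
Lemma HK_support1 k f n : hset (H k) f -> ~ nonneg_idx n -> (f n).1 = 0.
Proof.
move=> hf nn; have [h1 h2] := HK_coef n hf.
case: hK => _ /(_ k)[W [Y [F [hY bF F1 _ KE]]]] _.
apply: (hip_inj hEs) => //; first by hs.
move=> u hu; rewrite (hip0l hEs) //; have hu0 : hset G (u, 0) by hs.
have := HK_repr n hf hu0; rewrite /= (hip0r hE) // addr0 => <-.
have -> : ksec (K k) n (u, 0) = 0; last by rewrite (hip0r (hH k)).
apply/funext => m; rewrite /ksec KE //.
have -> : adj Y G (F n) (u, 0) = 0; last exact: lin0 hY (bounded_lin (bF m)).
apply: (adj_unique hY); first by hs.
move=> x hx; have [_ h] := bounded_hset (bF n) hx.
by rewrite /= F1 // (hip0l hEs) // (hip0r hE) // (hip0r hY) // addr0.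
Qed.

Lemma HK_support2 k f n : hset (H k) f -> ~ nonneg_idx (- evec k - n) -> (f n).2 = 0.
Proof.
move=> hf nn; have [h1 h2] := HK_coef n hf.
case: hK => _ /(_ k)[W [Y [F [hY bF _ F2 KE]]]] _.
apply: (hip_inj hE) => //; first by hs.
move=> u hu; rewrite (hip0l hE) //; have hu0 : hset G (0, u) by hs.
have := HK_repr n hf hu0; rewrite /= (hip0r hEs) // add0r => <-.
have -> : ksec (K k) n (0, u) = 0; last by rewrite (hip0r (hH k)).
apply/funext => m; rewrite /ksec KE //.
have -> : adj Y G (F n) (0, u) = 0; last exact: lin0 hY (bounded_lin (bF m)).
apply: (adj_unique hY); first by hs.
move=> x hx; have [h _] := bounded_hset (bF n) hx.
by rewrite /= F2 // (hip0l hE) // (hip0r hEs) // (hip0r hY) // addr0.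
Qed.

Let hXk x k : hset X x -> hset (H k) (x k). Proof. by move=> /stateP. Qed.
Let hXkn x k n : hset X x -> hset G (x k n).
Proof. by move=> hx; apply: HK_coef; apply: hXk. Qed.

(** Coefficients of sum_k f_k(z) + (S(z) e, e) and of
    sum_k z_k f_k(z) + (e', S(z)^* e'): they represent the inner products with
    the generators of D and of R. *)
Definition obsD (p : VF * VE) (m : Zd d) : VEs * VE :=
  \sum_k p.1 k m + (Sn m p.2, delta0 m p.2).

Definition obsR (q : VF * VEs) (m : Zd d) : VEs * VE :=
  \sum_k q.1 k (m - evec k) + (delta0 m q.2, adj E Es (Sn (- m)) q.2).

Let hadj n e : hset Es e -> hset E (adj E Es (Sn n) e).
Proof. exact: adj_hset. Qed.
Let hSn n e : hset E e -> hset Es (Sn n e). Proof. exact: (bounded_hset (bSn n)). Qed.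

Lemma obsD_hset p m : hset HD p -> hset G (obsD p m).
Proof.
move=> [h1 h2]; apply: hsetD => //; last by split=> /=; [exact: hSn|hs].
by apply: hset_sum => // k; apply: hXkn.
Qed.

Lemma obsR_hset q m : hset HR q -> hset G (obsR q m).
Proof.
move=> [h1 h2]; apply: hsetD => //; last by split=> /=; [hs|exact: hadj].
by apply: hset_sum => // k; apply: hXkn.
Qed.

Lemma genD_hset m es e : hset Es es -> hset E e -> hset HD (genD E Es Sn K m es e).
Proof.
move=> h1 h2; split=> /=; last by have := hadj m h1 => ?; hs.
by apply/stateP => k; apply: HK_sec.
Qed.

Lemma genR_hset m es e : hset Es es -> hset E e -> hset HR (genR Sn K m es e).
Proof.
move=> h1 h2; split=> /=; last by have := hSn (- m) h2 => ?; hs.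
by apply/stateP => k; apply: HK_sec.
Qed.

Let hip_delta0 (W : lmodType R[i]) (Y : hspace W) (hY : is_hilbert Y) (n : Zd d) x y :
  hset Y x -> hset Y y -> hip Y (delta0 n x) y = hip Y x (delta0 n y).
Proof.
move=> hx hy; rewrite /delta0; case: ifP => // _.
by rewrite (hip0l hY) // (hip0r hY).
Qed.

Lemma hip_genD p m es e : hset HD p -> hset Es es -> hset E e ->
  hip HD p (genD E Es Sn K m es e) = hip G (obsD p m) (es, e).
Proof.
move=> hp h1 h2; case: (hp) => hx he; have hg : hset G (es, e) by hs.
rewrite /obsD (hipDl hG) //; first last.
- by split=> /=; [exact: hSn|hs].
- by apply: hset_sum => // k; apply: hXkn.
rewrite (hip_suml hG) //; last by move=> k; apply: hXkn.
rewrite -[LHS]/(hip X p.1 (genD E Es Sn K m es e).1 +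
  hip E p.2 (adj E Es (Sn m) es + delta0 m e)).
rewrite hdsum_fin_hip; congr (_ + _).
  by apply: eq_bigr => k _; rewrite /= HK_repr //; apply: hXk.
have ha := hadj m h1; have hs' := hSn m he.
by rewrite (hipDr hE) ?(adj_hip hE hEs (bSn m)) //= -?(hip_delta0 hE) //; hs.
Qed.

Lemma hip_genR q m es e : hset HR q -> hset Es es -> hset E e ->
  hip HR q (genR Sn K m es e) = hip G (obsR q m) (es, e).
Proof.
move=> hp h1 h2; case: (hp) => hx he; have hg : hset G (es, e) by hs.
rewrite /obsR (hipDl hG) //; first last.
- by split=> /=; [hs|exact: hadj].
- by apply: hset_sum => // k; apply: hXkn.
rewrite (hip_suml hG) //; last by move=> k; apply: hXkn.
rewrite -[LHS]/(hip X q.1 (genR Sn K m es e).1 +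
  hip Es q.2 (delta0 m es + Sn (- m) e)).
rewrite hdsum_fin_hip; congr (_ + _).
  by apply: eq_bigr => k _; rewrite /= HK_repr //; apply: hXk.
have ha := hadj (- m) he; have hs' := hSn (- m) h2.
rewrite (hipDr hEs) //; last by hs.
rewrite -[RHS]/(hip Es (delta0 m q.2) es + hip E (adj E Es (Sn (- m)) q.2) e).
by rewrite (hip_delta0 hEs) // (adj_hipl hE hEs (bSn (- m))).
Qed.

Let delta0D (W : lmodType R[i]) (n : Zd d) (x y : W) :
  delta0 n (x + y) = delta0 n x + delta0 n y.
Proof. by rewrite /delta0; case: ifP; rewrite ?addr0. Qed.

(** Splitting the sum of the Agler decomposition into its shifted and its
    unshifted part, and moving the entries of the left-hand side to the
    appropriate sides, gives the observations of the generators. With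
    [hip_genD] and [hip_genR] it says that the generators of D and of R have
    the same Gram matrix. *)
Lemma agler_obs m n es e : hset Es es -> hset E e ->
  obsD (genD E Es Sn K m es e) n = obsR (genR Sn K m es e) n.
Proof.
move=> h1 h2; case: hK => _ _ /(_ n m (es, e)); case/(_ (conj h1 h2)).
rewrite sumrB => ag; rewrite /obsD /obsR /=.
have ha := hadj m h1; have hSm := hSn (- m) h2.
have ba := bounded_adj hE hEs (bSn (- n)).
set A := \sum_k K k n m (es, e) in ag *.
set B := \sum_k K k (n - _) (m - _) (es, e) in ag *.
have -> : A = agler_lhs E Es Sn n m (es, e) + B by rewrite ag subrK.
rewrite addrAC addrC; congr (_ + _).
rewrite /agler_lhs /= (linD (bounded_lin (bSn n))) //; last by hs.
rewrite (lin_delta0 hE (bounded_lin (bSn n))) // !delta0D.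
rewrite (linD (bounded_lin ba)) //; last by hs.
rewrite (lin_delta0 hEs (bounded_lin ba)) //.
rewrite pairD /=; congr (_, _); exact: zmod_cancel.
Qed.

Hypothesis hscc : strictly_closely_connected E Es K.

Let gensD : [set x | exists m es e, [/\ hset Es es, hset E e &
  x = genD E Es Sn K m es e]] `<=` hset HD.
Proof. by move=> _ [m [es [e [h1 h2 ->]]]]; apply: genD_hset. Qed.

Let gensR : [set x | exists m es e, [/\ hset Es es, hset E e &
  x = genR Sn K m es e]] `<=` hset HR.
Proof. by move=> _ [m [es [e [h1 h2 ->]]]]; apply: genR_hset. Qed.

Let hip_eq0G u : hset G u -> (forall es e, hset Es es -> hset E e ->
  hip G u (es, e) = 0) -> u = 0.
Proof.
move=> hu h; apply: (hip_inj hG) => // [|[es e] [h1 h2]]; first by hs.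
by rewrite (hip0l hG) // h.
Qed.

(** A vector orthogonal to the generators of D satisfies
    sum_k f_k(z) + (S(z) e, e) = 0. The coefficient of z^0 of the second component
    only contains e, whence e = 0 and injectivity of the sum map applies. *)
Lemma spaceD_full : spaceD E Es Sn K = hset HD.
Proof.
apply: (closed_span_total hHD gensD) => -[f e0] hp pp; case: (hp) => /= hf he0.
have o0 m : obsD (f, e0) m = 0.
  apply: hip_eq0G => [|es e h1 h2]; first exact: obsD_hset.
  by rewrite -hip_genD //; apply: pp; exists m, es, e.
have e00 : e0 = 0.
  have := congr1 snd (o0 0); rewrite /obsD pairD /= raddf_sum big1 ?add0r => [|k _].
    by rewrite /delta0 eqxx.
  by apply: (HK_support2 (k := k)); [apply: hXk|rewrite subr0; apply: nonneg_Nevec].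
rewrite e00 in hp o0 *; congr (_, _).
case: hscc => inj _; apply: inj => //; first exact: hset0 hXX.
apply/funext => m; have := o0 m.
rewrite /obsD /= (lin0 hE (bounded_lin (bSn m))) /delta0 if_same addr0 => e1.
rewrite /sum_map !fct_sumE e1 big1 //.
Qed.

(** As for D, with the coefficient of z^0 of the first component and the sum
    map on the spaces z_k H(K_k). *)
Lemma spaceR_full : spaceR E Es Sn K = hset HR.
Proof.
apply: (closed_span_total hHR gensR) => -[f e0] hp pp; case: (hp) => /= hf he0.
have o0 m : obsR (f, e0) m = 0.
  apply: hip_eq0G => [|es e h1 h2]; first exact: obsR_hset.
  by rewrite -hip_genR //; apply: pp; exists m, es, e.
have e00 : e0 = 0.
  have := congr1 fst (o0 0); rewrite /obsR pairD /= raddf_sum big1 ?add0r => [|k _].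
    by rewrite /delta0 eqxx.
  by apply: (HK_support1 (k := k)); [apply: hXk|rewrite sub0r; apply: nonneg_Nevec].
rewrite e00 in hp o0 *; congr (_, _).
pose g k := zmul (evec k) (f k).
suff g0 : g = 0.
  apply/funext => k; apply/funext => m; have := congr1 (fun g => g k (m + evec k)) g0.
  by rewrite /g /zmul addrK.
case: hscc => _ inj; apply: inj.
- by apply/stateP => k; exists (f k) => //; apply: hXk.
- apply/stateP => k; exists 0; first exact: hset0 (hH k).
  by apply/funext.
apply/funext => m; have := o0 m.
rewrite /obsR /= (lin0 hEs (bounded_lin (bounded_adj hE hEs (bSn (- m))))).
rewrite /delta0 if_same addr0 => e1.
by rewrite /sum_map !fct_sumE [RHS]big1.
Qed.

Lemma V_exists : exists V, is_V E Es Sn K V.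
Proof.
pose P := [set t : Zd d * VEs * VE | hset Es t.1.2 /\ hset E t.2].
pose g (t : Zd d * VEs * VE) := genD E Es Sn K t.1.1 t.1.2 t.2.
pose h (t : Zd d * VEs * VE) := genR Sn K t.1.1 t.1.2 t.2.
have [|||T [uT hT]] := @gram_unitary _ _ _ _ _ hHD hHR _ P g h.
- by move=> t [h1 h2]; apply: genD_hset.
- by move=> t [h1 h2]; apply: genR_hset.
- move=> t t' [h1 h2] [h1' h2'].
  rewrite hip_genD ?hip_genR ?agler_obs //; first exact: genR_hset.
  exact: genD_hset.
exists T; split; last by move=> m es e h1 h2; apply: (hT (m, es, e)).
have gE : [set g i | i in P] = [set x | exists m es e, [/\ hset Es es, hset E e &
    x = genD E Es Sn K m es e]].
  apply/seteqP; split=> [_ [[[m es] e] [/= h1 h2] <-]|_ [m [es [e [h1 h2 ->]]]]].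
    by exists m, es, e.
  by exists (m, es, e).
have hE' : [set h i | i in P] = [set x | exists m es e, [/\ hset Es es, hset E e &
    x = genR Sn K m es e]].
  apply/seteqP; split=> [_ [[[m es] e] [/= h1 h2] <-]|_ [m [es [e [h1 h2 ->]]]]].
    by exists m, es, e.
  by exists (m, es, e).
by rewrite gE hE' in uT.
Qed.

Section WithV.
Variable V : VF * VE -> VF * VEs.
Hypothesis hV : is_V E Es Sn K V.
Let U := Colligation H V.
Let U' := dual E U.

Lemma V_unitary : unitary HD HR V.
Proof. by case: hV; rewrite spaceD_full spaceR_full !hsub_full. Qed.

Lemma model_GR : GR_unitary E Es U.
Proof. by split; [exact: hH|exact: V_unitary]. Qed.

Let hU := model_GR.
Let hU' : GR_unitary Es E U' := dual_unitary hE hU.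

(** On generators g of D one has <V p, V g> = <p, g>, and both sides are
    observations. *)
Lemma V_obs p m : hset HD p -> obsR (V p) m = obsD p m.
Proof.
move=> hp; have hVp := unitary_hset V_unitary hp.
apply: (hip_inj hG); [exact: obsR_hset|exact: obsD_hset|].
move=> [es e] [h1 h2]; rewrite -hip_genD // -hip_genR //; case: hV => _ <- //.
by rewrite (unitary_hip V_unitary) //; apply: genD_hset.
Qed.

(** The generators of R are total, so a vector is determined by its
    observations. *)
Lemma V_unique p q : hset HD p -> hset HR q -> (forall m, obsR q m = obsD p m) -> V p = q.
Proof.
move=> hp hq h; have hVp := unitary_hset V_unitary hp.
have hd := hsetB hHR hVp hq.
apply/eqP; rewrite -subr_eq0; apply/eqP.
have cl : perp HR [set V p - q] = hset HR.
  rewrite -spaceR_full; apply/seteqP; split.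
    by rewrite spaceR_full => x [].
  apply: closed_span_min; first by apply: perp_closed => // x ->.
  move=> _ [m [es [e [h1 h2 ->]]]]; have hg := genR_hset m h1 h2.
  split=> // _ ->; rewrite (hip_conj hHR (x := V p - q)) //.
  by rewrite (hipBl hHR) // !hip_genR // h V_obs // subrr conjc0.
have /= [_] : perp HR [set V p - q] (V p - q) by rewrite cl.
by move=> /(_ _ erefl) /(hip_eq0 hHR hd).
Qed.

Let bC : bounded_op X Es (blockC U) := bounded_blockC hE hEs hU.
Let bC' : bounded_op X E (blockC U') := bounded_blockC hEs hE hU'.

Lemma model_state x m : hset X x ->
  \sum_k blockA U x k (m - evec k) + (delta0 m (blockC U x), adj E Es (Sn (- m)) (blockC U x))
  = \sum_k x k m.
Proof.
move=> hx; have hp : hset HD (x, 0) by hs.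
have := V_obs m hp; rewrite /obsR /obsD /= => ->.
by rewrite (lin0 hE (bounded_lin (bSn m))) /delta0 if_same addr0.
Qed.

Lemma model_dual_state x m : hset X x ->
  \sum_k x k (m - evec k) =
  \sum_k blockA U' x k m + (Sn m (blockC U' x), delta0 m (blockC U' x)).
Proof.
move=> hx; have hq : hset HR (x, 0) by hs.
have [h1 h2] := cmap_hset hU' hx (hset0 hEs).
have := V_obs m (p := cmap U' (x, 0)) (conj h1 h2).
rewrite [V _](dual_cmapK hU hq) /obsR /obsD /= => <-.
rewrite (lin0 hEs (bounded_lin (bounded_adj hE hEs (bSn (- m))))).
by rewrite /delta0 if_same addr0.
Qed.

Let sum_pair1 (F : 'I_d.+1 -> VEs * VE) : (\sum_k F k).1 = \sum_k (F k).1.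
Proof. exact: (big_morph fst). Qed.
Let sum_pair2 (F : 'I_d.+1 -> VEs * VE) : (\sum_k F k).2 = \sum_k (F k).2.
Proof. exact: (big_morph snd). Qed.

(** The output series of the free state evolution of x is x itself: both obey
    the same recursion, and the supports of the elements of H(K_k) provide the
    initial values. *)
Lemma model_resolvent x m : hset X x ->
  blockC U (resolvent (blockA U) m x) = \sum_k (x k m).1.
Proof.
elim/Zd_ind: m x => [m nm|m nm IH] x hx.
  rewrite (resolvent_out hH (bounded_blockA hE hEs hU)) //.
  rewrite (lin0 hXX (bounded_lin bC)) big1 // => k _.
  by apply: (HK_support1 (k := k)) => //; apply: hXk.
have hA := blockA_hset hE hEs hU hx.
have hP k := proj_hset hH k hA.
have hr k : hset X (resolvent (blockA U) (m - evec k) (cproj k (blockA U x))).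
  exact: (resolvent_hset hE hEs hU).
rewrite (resolvent_recr hH (bounded_blockA hE hEs hU)) //.
rewrite (linD (bounded_lin bC)) //; first last.
- exact: hset_sum.
- exact: hset_delta0.
rewrite (lin_sum hXX (bounded_lin bC)) // (lin_delta0 hXX (bounded_lin bC)) //.
rewrite -sum_pair1 -model_state // pairD /= sum_pair1 addrC; congr (_ + _).
apply: eq_bigr => k _; rewrite IH // (bigD1 k) //= /Defs.proj eqxx.
by rewrite big1 ?addr0 // => j /negPf ->.
Qed.

Lemma model_dual_resolvent x p : hset X x ->
  blockC U' (resolvent (blockA U') p x) = \sum_k (x k (- evec k - p)).2.
Proof.
elim/Zd_ind: p x => [p np|p np IH] x hx.
  rewrite (resolvent_out hH (bounded_blockA hEs hE hU')) //.
  rewrite (lin0 hXX (bounded_lin bC')) big1 // => k _.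
  by apply: (HK_support2 (k := k)); [apply: hXk|rewrite opprB addrC subrK].
have hA := blockA_hset hEs hE hU' hx.
have hP k := proj_hset hH k hA.
have hr k : hset X (resolvent (blockA U') (p - evec k) (cproj k (blockA U' x))).
  exact: (resolvent_hset hEs hE hU').
rewrite (resolvent_recr hH (bounded_blockA hEs hE hU')) //.
rewrite (linD (bounded_lin bC')) //; first last.
- exact: hset_sum.
- exact: hset_delta0.
rewrite (lin_sum hXX (bounded_lin bC')) // (lin_delta0 hXX (bounded_lin bC')) //.
under [RHS]eq_bigr => k _ do rewrite addrC.
rewrite -sum_pair2 model_dual_state // pairD /= sum_pair2 addrC.
congr (_ + _); last by rewrite /delta0 oppr_eq0.
apply: eq_bigr => k _; rewrite IH // (bigD1 k) //= /Defs.proj eqxx.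
rewrite opprB addrA addNr add0r big1 ?addr0 // => j /negPf -> //.
Qed.

(** The state space of the model consists of its own observations;
    compatibility and close connectedness are consequences. *)
Lemma model_Gamma k n x : hset X x -> Gamma E U k n x = x k n.
Proof.
move=> hx; have hp := proj_hset hH k hx.
rewrite (GammaE hE hEs hU) // model_resolvent // model_dual_resolvent //.
rewrite [RHS]surjective_pairing; congr (_, _); rewrite (bigD1 k) //= /Defs.proj eqxx.
  by rewrite big1 ?addr0 // => j /negPf ->.
have -> : - evec k - (- evec k - n) = n by rewrite opprB opprK addrC addrK.
by rewrite big1 ?addr0 // => j /negPf ->.
Qed.

Lemma model_transfer n e : hset E e -> transfer U n e = Sn n e.
Proof.
move=> he; have hp : hset HD (0, e) by hs.
have hB := blockB_hset hE hEs hU he.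
have := congr1 fst (V_obs n hp); rewrite /obsR /obsD !pairD /= !sum_pair1.
rewrite [X in _ = X + _]big1 // add0r => <-.
rewrite /transfer addrC; congr (_ + _); rewrite (blockC_resZ hE hEs hU) //.
apply: eq_bigr => k _; rewrite model_resolvent; last exact: proj_hset.
rewrite (bigD1 k) //= /Defs.proj eqxx.
by rewrite big1 ?addr0 // => j /negPf ->.
Qed.

Lemma model_compatible : compatible E Es U K.
Proof.
move=> k n m g hg.
pose z : VF := fun j => if j == k then ksec (K k) m g else 0.
have hz : hset X z.
  apply/stateP => j; rewrite /z; case: eqP => [->|_]; first exact: HK_sec.
  exact: hset0 (hH j).
have -> : adj (state U) G (Gamma E U k m) g = z.
  apply: (adj_unique hXX) => // x hx; rewrite model_Gamma //.
  rewrite -(HK_repr m (hXk k hx)) // hdsum_fin_hip (bigD1 k) //= /z eqxx.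
  rewrite big1 ?addr0 // => j /negPf ->; rewrite (hip0r (hH j)) //; exact: hXk.
by rewrite model_Gamma // /z eqxx.
Qed.

Lemma model_closely_connected : closely_connected E Es U.
Proof.
apply: (closely_connected_of_inj hE hEs hU) => x hx h.
by apply/funext => k; apply/funext => n; rewrite -model_Gamma // h.
Qed.

End WithV.
End Model.

(** * From formal series to functions on the polydisk *)

Section Slices.
Variables (R : realType) (d : nat) (V : lmodType R[i]).
Local Open Scope complex_scope.
Implicit Types (z : 'rV[R[i]]_d.+1) (f : Zd d -> V) (n : Zd d).

Lemma finite_simplex j : finite_set (simplex j : set (Zd d)).
Proof.
pose F (g : {ffun 'I_d.+1 -> 'I_j.+1}) : Zd d := \row_i (g i : nat)%:Z.
apply: (@sub_finite_set _ _ (F @` setT)); last exact/finite_image/finite_finset.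
move=> n [nn ln].
have le i : (`|n 0%R i| < j.+1)%N.
  rewrite ltnS -lez_nat gez0_abs; last exact: nn.
  rewrite -ln /lev (bigD1 i) //= lerDl; apply: sumr_ge0 => k _; exact: nn.
exists [ffun i => Ordinal (le i)] => //; apply/rowP => i.
by rewrite mxE ffunE /= gez0_abs //; exact: nn.
Qed.

(** The homogeneous part of degree j of the formal series f, evaluated at z. *)
Definition slice z j f := \sum_(n \in simplex j) zmon z n *: f n.

Lemma slice_eq z j f g : (forall n, simplex j n -> f n = g n) -> slice z j f = slice z j g.
Proof. by move=> e; apply: eq_fsbigr => n; rewrite inE => /e ->. Qed.

Lemma sliceE z j f : slice z j f =
  \sum_(n <- finmap.enum_fset (fset_set (simplex j : set (Zd d)))) zmon z n *: f n.
Proof. by rewrite /slice fsbig_finite //; exact: finite_simplex. Qed.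

Lemma slice0 z f : slice z 0 f = f 0.
Proof.
have e : simplex 0 = [set 0 : Zd d].
  apply/seteqP; split=> [n [nn ln]|n ->]; first exact: nonneg_lev0.
  by split; [exact: nonneg0|exact: lev0].
rewrite /slice e fsbig_set1 /zmon big1 ?scale1r // => k _.
by rewrite mxE.
Qed.

Lemma slice_sum z j (f : 'I_d.+1 -> Zd d -> V) :
  slice z j (fun n => \sum_k f k n) = \sum_k slice z j (f k).
Proof.
rewrite sliceE; under eq_bigr => n _ do rewrite scaler_sumr.
by rewrite exchange_big; apply: eq_bigr => k _; rewrite sliceE.
Qed.

Lemma zmon_addE z n k : nonneg_idx n -> zmon z (n + evec k) = z 0 k * zmon z n.
Proof.
move=> nn; rewrite /zmon (bigD1 k) //= [in RHS](bigD1 k) //= mulrA; congr (_ * _).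
  rewrite !mxE !eqxx /=; have := nn k; case: (n 0 k) => // a _.
  by rewrite -[a%:Z + 1]/((a + 1)%N%:Z) addn1; exact: exprS.
by apply: eq_bigr => i ik; rewrite !mxE (negPf ik) andbF addr0.
Qed.

(** Multiplication by z_k maps the monomials of degree j to those of degree j
    + 1 that z_k divides; at the others the shifted coefficient is 0. *)
Lemma slice_shift z j k f : (forall n, ~ nonneg_idx n -> f n = 0) ->
  slice z j.+1 (fun n => f (n - evec k)) = z 0 k *: slice z j f.
Proof.
move=> f0; rewrite (sliceE z j f) scaler_sumr.
pose D : set (Zd d) := [set n + evec k | n in simplex j].
transitivity (\sum_(n \in D) zmon z n *: f (n - evec k)).
  apply/esym/fsbig_widen.
    move=> _ [n [nn ln] <-]; split; last by rewrite levD lev_evec ln; lia.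
    by move=> i; rewrite mxE addr_ge0 ?nn // mxE; case: (_ && _).
  move=> n [sn nD]; rewrite /= f0 ?scaler0 // => nk; apply: nD.
  by exists (n - evec k); rewrite ?subrK //; apply: simplex_subE.
rewrite fsbig_image; last by move=> n m _ _ /addIr.
rewrite fsbig_finite; last exact: finite_simplex.
rewrite big_seq [RHS]big_seq; apply: eq_bigr => n.
rewrite in_fset_set ?inE; last exact: finite_simplex.
by move=> [nn _]; rewrite addrK zmon_addE // scalerA.
Qed.

Lemma lin_slice (W : lmodType R[i]) (H : hspace V) (T : V -> W) z j f :
  is_hilbert H -> linear_on H T -> (forall n, hset H (f n)) ->
  T (slice z j f) = \sum_(n \in simplex j) zmon z n *: T (f n).
Proof.
move=> hH lT hf; rewrite sliceE (lin_sum hH lT) => [|n]; last by hs.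
rewrite fsbig_finite; last exact: finite_simplex.
by apply: eq_bigr => n _; rewrite (linZ hH lT).
Qed.

Lemma slice_hset (H : hspace V) z j f :
  is_hilbert H -> (forall n, hset H (f n)) -> hset H (slice z j f).
Proof. by move=> hH hf; rewrite sliceE; apply: hset_sum => // n; hs. Qed.

Lemma sliceB z j f g : slice z j (fun n => f n - g n) = slice z j f - slice z j g.
Proof. by rewrite !sliceE -sumrB; apply: eq_bigr => n _; rewrite scalerBr. Qed.

End Slices.

Section Neumann.
Variables (R : realType) (V : lmodType R[i]) (X : hspace V) (T : V -> V).
Hypothesis (hX : is_hilbert X) (bT : bounded_op X X T).
Variable r : R.
Hypothesis (r1 : r < 1) (contr : forall x, hset X x -> hnorm X (T x) <= r * hnorm X x).
Let lT := bounded_lin bT.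
Let hT x : hset X x -> hset X (T x). Proof. exact: (bounded_hset bT). Qed.

Let below x : hset X x -> (1 - r) * hnorm X x <= hnorm X (x - T x).
Proof.
move=> hx; have hTx := hT hx; have hd : hset X (x - T x) by hs.
have := hnorm_le_dist hX hx hTx; have := contr hx; lra.
Qed.

(** The range of I - T is closed since I - T is bounded below, and dense because
    <y, y> = <T y, y> forces y = 0. *)
Lemma contraction_inverse : exists2 S, bounded_op X X S &
  (forall x, hset X x -> S (x - T x) = x) /\ (forall x, hset X x -> S x - T (S x) = x).
Proof.
have r0 : 0 < 1 - r by rewrite subr_gt0.
pose Q x := x - T x.
have hQ x : hset X x -> hset X (Q x) by move=> hx; have := hT hx; rewrite /Q => ?; hs.
have QZD a x y : hset X x -> hset X y -> Q (a *: x + y) = a *: Q x + Q y.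
  by move=> hx hy; rewrite /Q lT // scalerBr opprD addrACA.
have QB x y : hset X x -> hset X y -> Q (x - y) = Q x - Q y.
  by move=> hx hy; rewrite addrC -scaleN1r QZD // scaleN1r addrC.
have Qinj x y : hset X x -> hset X y -> Q x = Q y -> x = y.
  move=> hx hy e; apply/eqP; rewrite -subr_eq0; apply/eqP.
  have hd : hset X (x - y) by hs.
  apply: (hnorm_eq0 hX hd); apply/eqP; rewrite eq_le hnorm_ge0 andbT.
  have := below hd; rewrite -/(Q _) QB // e subrr (hnorm0 hX).
  by rewrite pmulr_rle0.
pose M := [set Q x | x in hset X].
have Q0 : Q 0 = 0 by rewrite /Q (lin0 hX lT) subr0.
have cM : closed_subspace X M.
  split.
  - by move=> _ [x hx <-]; apply: hQ.
  - split; first by exists 0 => //; hs.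
    by move=> a _ _ [x hx <-] [y hy <-]; exists (a *: x + y); [hs|rewrite QZD].
  move=> u l hu hl cl.
  have /choice[v hv] : forall n, exists x, hset X x /\ Q x = u n.
    by move=> n; have [x hx e] := hu n; exists x.
  have hvn n : hset X (v n) by case: (hv n).
  have hun n : hset X (u n) by rewrite -(hv n).2; apply: hQ.
  have [||x hx cx] := hilbert_complete hX (u := v) => //.
    move=> e e0; have e1 : 0 < (1 - r) * e by rewrite mulr_gt0.
    have [N hN] := hcvg_cauchy hX hun hl cl e1; exists N => m n hm hn.
    have hd : hset X (v m - v n) by have := hvn m; have := hvn n => *; hs.
    rewrite -(ltr_pM2l r0); apply: le_lt_trans (hN m n hm hn).
    by rewrite -(hv m).2 -(hv n).2 -QB //; apply: below.
  exists x => //; apply: (hcvg_unique hX hun _ hl _ cl); first exact: hQ.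
  apply/hcvgP => e e0; have [C C0 hC] := bounded_pos bT.
  have e1 : 0 < e / (1 + C) by rewrite divr_gt0 // ltr_pwDl // ltW.
  have /hcvgP/(_ _ e1)[N hN] := cx; exists N => n hn.
  have hd : hset X (v n - x) by have := hvn n => ?; hs.
  rewrite -(hv n).2 -QB //; apply: le_lt_trans (hnormB hX hd (hT hd)) _.
  apply: le_lt_trans (_ : (1 + C) * hnorm X (v n - x) < e).
    by have := hC _ hd; lra.
  by rewrite -ltr_pdivlMl ?[_^-1 * _]mulrC ?hN // ltr_pwDl // ltW.
have MX : M = hset X.
  apply: (csub_total hX cM) => y hy py.
  have := py _ (ex_intro2 _ _ y hy erefl); have hTy := hT hy.
  rewrite /Q (hipBr hX) // => /eqP; rewrite subr_eq0 => /eqP e.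
  have := sqr_hnorm hX hy; rewrite e => e2.
  have := Re_cauchy_schwarz hX hy hTy; rewrite -e2 => h1.
  apply: (hnorm_eq0 hX hy); apply/eqP; rewrite eq_le hnorm_ge0 andbT leNgt.
  apply/negP => n0; move: h1; rewrite expr2 ler_pM2l // => h1.
  have := contr hy => h2; have : (1 - r) * hnorm X y <= 0 by lra.
  by rewrite pmulr_rle0 // leNgt n0.
pose S y := xget 0 [set x | hset X x /\ Q x = y].
have SP y : hset X y -> hset X (S y) /\ Q (S y) = y.
  move=> hy; have [x hx e] : M y by rewrite MX.
  exact: (@xgetI _ 0 [set x | hset X x /\ Q x = y] x (conj hx e)).
exists S; last first.
  split=> x hx; last by have [_] := SP _ hx.
  by have [h1 h2] := SP _ (hQ _ hx); apply: Qinj h2.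
split.
- by move=> x /SP[].
- move=> a x y hx hy; have [h1 e1] := SP _ hx; have [h2 e2] := SP _ hy.
  have hxy : hset X (a *: x + y) by hs.
  have [h3 e3] := SP _ hxy; apply: Qinj => //; first by hs.
  by rewrite QZD // e1 e2 e3.
exists (1 - r)^-1 => x hx; have [h1 e1] := SP _ hx.
by rewrite -ler_pdivrMl ?invr_gt0 // invrK -{2}e1; apply: below.
Qed.

End Neumann.

Section Realization.
Variables (R : realType) (d : nat) (VE VEs V : lmodType R[i]).
Variables (E : hspace VE) (Es : hspace VEs) (U : colligation d V VE VEs).
Hypothesis (hE : is_hilbert E) (hEs : is_hilbert Es) (hU : GR_unitary E Es U).
Local Notation X := (state U).
Let hXX : is_hilbert X := state_hilbert hU.
Let hcs : forall k, is_hilbert (cspace U k). Proof. by case: hU. Qed.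
Let bA := bounded_blockA hE hEs hU.
Let bC := bounded_blockC hE hEs hU.
Local Open Scope complex_scope.

Section AtPoint.
Variable z : 'rV[R[i]]_d.+1.
Hypothesis hz : polydisk z.
Let TA x := Zop z (blockA U x).

Lemma bounded_Zop : bounded_op X X (Zop z).
Proof.
apply: (@bounded_ext _ _ _ X X (fun x => \sum_k z 0 k *: cproj k x)) => //.
apply: bounded_sum => // k; have [h1 h2 [M hM]] := bounded_proj hcs k.
split.
- by move=> x hx; apply: hsetZ => //; apply: h1.
- by move=> a x y hx hy; rewrite h2 // scalerDr !scalerA mulrC.
exists (Normc.normc (z 0 k) * M) => x hx; rewrite (hnormZ hXX) -?mulrA.
  by rewrite ler_wpM2l ?modulus_ge0 // hM.
exact: h1.
Qed.

(** On the k-th summand Z(z) is multiplication by z_k, so the constant is the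
    maximum of the |z_k|. *)
Lemma Zop_contr : exists2 r : R, 0 <= r < 1 & forall x, hset X x ->
  hnorm X (Zop z x) <= r * hnorm X x.
Proof.
pose r : R := \big[Order.max/0]_k Normc.normc (z 0 k).
have r0 : 0 <= r by rewrite /r; apply: bigmax_ge_id.
exists r; first by rewrite r0 /r; apply/bigmax_ltP; split=> // k _; apply: hz.
move=> x hx; have hZ := bounded_hset bounded_Zop hx.
rewrite -(@ler_pXn2r _ 2) ?nnegrE ?mulr_ge0 ?hnorm_ge0 // exprMn.
rewrite (sqr_hnorm_proj hcs hZ) (sqr_hnorm_proj hcs hx) mulr_sumr.
apply: ler_sum => k _; have hp := proj_hset hcs k hx.
have -> : cproj k (Zop z x) = z 0 k *: cproj k x.
  apply/funext => j; rewrite /Zop /Defs.proj; case: eqP => [->|jk].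
    rewrite fct_sumE (bigD1 k) //= !fctE eqxx big1 ?addr0 // => i /negPf ik.
    by rewrite !fctE eq_sym ik scaler0.
  by rewrite !fctE; case: eqP => // _; rewrite scaler0.
rewrite (hnormZ hXX) // exprMn ler_wpM2r ?sqr_ge0 //.
rewrite ler_pXn2r ?nnegrE ?modulus_ge0 //.
exact: le_bigmax.
Qed.

Lemma bounded_TA : bounded_op X X TA.
Proof. exact: (bounded_comp hXX hXX hXX bA bounded_Zop). Qed.

Lemma iter_TA_bounded j : bounded_op X X (iter j TA).
Proof.
elim: j => [|j IH]; first exact: bounded_id.
exact: (bounded_comp hXX hXX hXX IH bounded_TA).
Qed.

Lemma slice_resZ j : (forall x, hset X x -> slice z j (resolvent (blockA U) ^~ x) = iter j TA x) ->
  forall x, hset X x -> slice z j.+1 (resZ (blockA U) ^~ x) = iter j TA (Zop z x).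
Proof.
move=> IH x hx; rewrite /resZ (slice_sum _ _ (fun k n => resolvent _ (n - evec k) _)).
have hp k := proj_hset hcs k hx; have lI := bounded_lin (iter_TA_bounded j).
rewrite /Zop (lin_sum hXX lI) => [|k]; last by apply: hsetZ => //; apply: hp.
apply: eq_bigr => k _.
rewrite (slice_shift z j k (f := resolvent (blockA U) ^~ (cproj k x))).
  by rewrite IH // (linZ hXX lI).
by move=> n nn; rewrite (resolvent_out hcs bA).
Qed.

(** The coefficient of z^n collects the products of j factors P_k A in which
    each index k occurs n_k times, and Z(z) A is the sum of the z_k P_k A. *)
Lemma slice_resolvent j x : hset X x ->
  slice z j (resolvent (blockA U) ^~ x) = iter j TA x.
Proof.
elim: j x => [|j IH] x hx; first by rewrite slice0 resolvent0.
rewrite iterSr -slice_resZ //; last exact: (blockA_hset hE hEs hU).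
apply: slice_eq => n [_ ln]; rewrite (resolvent_recr hcs bA) // -/(resZ _ _ _).
by rewrite /delta0; case: eqP => [n0|_]; [move: ln; rewrite n0 lev0|rewrite add0r].
Qed.

Lemma slice_transfer0 e : slice z 0 (transfer U ^~ e) = blockD U e.
Proof.
rewrite slice0 /transfer /delta0 eqxx /resZ big1 => [|k _].
  by rewrite (lin0 hXX (bounded_lin bC)) addr0.
by rewrite sub0r (resolvent_out hcs bA) //; apply: nonneg_Nevec.
Qed.

Lemma slice_transferS j e : hset E e ->
  slice z j.+1 (transfer U ^~ e) = blockC U (iter j TA (Zop z (blockB U e))).
Proof.
move=> he; have hB := blockB_hset hE hEs hU he.
rewrite -slice_resZ // ?(lin_slice _ _ hXX (bounded_lin bC)).
- apply: slice_eq => n [_ ln]; rewrite /transfer /delta0; case: eqP => [n0|_].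
    by move: ln; rewrite n0 lev0.
  by rewrite add0r.
- by move=> n; apply: (resZ_hset hE hEs hU).
- by move=> x hx; apply: slice_resolvent.
Qed.

Definition transfer_sum J e := \sum_(j < J.+1) slice z j (transfer U ^~ e).

(** Iterating T x = x + Z A T x leaves after J steps the remainder (Z A)^J T
    x, whose norm is at most a constant times r^J. *)
Lemma transfer_sum_cvg T : (forall x, hset X x -> hset X (T x)) ->
  (forall x, hset X x -> T x - Zop z (blockA U (T x)) = x) ->
  forall e, hset E e -> forall eps : R, 0 < eps -> exists J0, forall J, (J0 <= J)%N ->
    hnorm Es (blockD U e + blockC U (T (Zop z (blockB U e))) - transfer_sum J e) <= eps.
Proof.
move=> hT TE e he eps eps0.
have hB := bounded_hset bounded_Zop (blockB_hset hE hEs hU he).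
set x := Zop z (blockB U e) in hB *; have hTx := hT _ hB.
have hI j y : hset X y -> hset X (iter j TA y).
  exact: (bounded_hset (iter_TA_bounded j)).
have T_unfold J : T x = \sum_(j < J) iter j TA x + iter J TA (T x).
  elim: J => [|J IH]; first by rewrite big_ord0 add0r.
  rewrite big_ord_recr /= {1}IH -addrA; congr (_ + _).
  have e1 : T x = x + TA (T x) by rewrite -{2}(TE _ hB) subrK.
  rewrite {1}e1 (linD (bounded_lin (iter_TA_bounded J))) //; last first.
    exact: (hI 1%N).
  by rewrite -[TA (T x)]/(iter 1 TA (T x)) -iterD addn1.
have [r /andP[r0 r1] hr] := Zop_contr.
have hTA y : hset X y -> hnorm X (TA y) <= r * hnorm X y.
  move=> hy; have hAy := blockA_hset hE hEs hU hy.
  apply: le_trans (hr _ hAy) _; rewrite ler_wpM2l //.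
  exact: (blockA_contr hE hEs hU).
have hiter J y : hset X y -> hnorm X (iter J TA y) <= r ^+ J * hnorm X y.
  move=> hy; elim: J => [|J IH]; first by rewrite mul1r.
  apply: le_trans (hTA _ (hI J _ hy)) _; rewrite exprS -mulrA.
  by rewrite ler_wpM2l.
have [M M0 hM] := bounded_pos bC.
have c : (fun J => M * (r ^+ J * hnorm X (T x))) @ \oo --> (0 : R).
  rewrite -[0](mulr0 M); apply: cvgMr; rewrite -[0](mul0r (hnorm X (T x))).
  by apply: cvgMl; apply: cvg_expr; rewrite ger0_norm.
move/cvgrPdist_le/(_ _ eps0): c => [J0 _ hJ0].
exists J0 => J hJ; have hh := hJ0 J hJ.
have -> : blockD U e + blockC U (T x) - transfer_sum J e = blockC U (iter J TA (T x)).
  rewrite /transfer_sum big_ord_recl slice_transfer0 /= opprD addrACA subrr add0r.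
  rewrite {1}(T_unfold J) (linD (bounded_lin bC)); [| |exact: hI]; last first.
    by apply: (hset_sum (H := X)) => // j; exact: hI.
  rewrite (lin_sum hXX (bounded_lin bC)) => [|j]; last exact: hI.
  rewrite addrAC; under [X in _ - X]eq_bigr => j _ do rewrite slice_transferS //.
  by rewrite subrr add0r.
apply: le_trans (hM _ (hI _ _ hTx)) _.
apply: le_trans (_ : M * (r ^+ J * hnorm X (T x)) <= _).
  by rewrite ler_wpM2l ?(ltW M0) // hiter.
apply: le_trans hh; rewrite /= sub0r normrN; exact: ler_norm.
Qed.

Lemma Zop_inverse : exists2 T, bounded_op X X T &
  (forall x, hset X x -> T (x - Zop z (blockA U x)) = x) /\
  (forall x, hset X x -> T x - Zop z (blockA U (T x)) = x).
Proof.
have [r /andP[r0 r1] hr] := Zop_contr.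
apply: (contraction_inverse hXX bounded_TA r1) => x hx.
have hAy := blockA_hset hE hEs hU hx.
apply: le_trans (hr _ hAy) _; rewrite ler_wpM2l //.
exact: (blockA_contr hE hEs hU).
Qed.

End AtPoint.

End Realization.

Section PowerSeries.
Variables (R : realType) (V : lmodType R[i]) (H : hspace V).
Hypothesis hH : is_hilbert H.
Local Open Scope complex_scope.

(** The partial sums tend to 0, in the form in which Taylor and Neumann series
    provide it. *)
Definition small_sums (s : nat -> V) := forall eps : R, 0 < eps ->
  exists J0, forall J, (J0 <= J)%N -> hnorm H (\sum_(j < J.+1) s j) <= eps.

Lemma geometric_half (q : R) n : 0 <= q <= 2^-1 -> \sum_(i < n) q ^+ i <= 2.
Proof.
move=> /andP[q0 q1]; elim: n => [|n IH]; first by rewrite big_ord0.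
rewrite big_ord_recl expr0; under eq_bigr => i _ do rewrite exprS.
rewrite -mulr_sumr; have : 0 <= \sum_(i < n) q ^+ i.
  by apply: sumr_ge0 => i _; rewrite exprn_ge0.
set s := \sum_(i < n) _ in IH *; nra.
Qed.

Section Constant.
Variable b : nat -> V.
Hypothesis hb : forall j, hset H (b j).
Hypothesis vanish : forall t : R, 0 < t < 1 -> small_sums (fun j => (t%:C ^+ j) *: b j).

(* At t = 1/2 each term is a difference of two partial sums. *)
Let coef_bound : exists2 M : R, 0 <= M & forall j, hnorm H (b j) <= M * 2 ^+ j.
Proof.
(* Up to J0 the terms are bounded by the sum in M, and later ones by 2. *)
pose t : R := 2^-1; have t01 : 0 < t < 1.
  by rewrite /t invr_gt0 invf_lt1 //; apply/andP; split=> //; rewrite ltr1n.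
have [J0 hJ0] := vanish t01 ltr01.
have hs' j : hset H (t%:C ^+ j *: b j) by have := hb j => ?; hs.
have nE j : hnorm H (t%:C ^+ j *: b j) = t ^+ j * hnorm H (b j).
  rewrite (hnormZ hH) // -rmorphXn modulus_real ger0_norm // exprn_ge0 // ltW //.
  by case/andP: t01.
pose M := 2 + \sum_(i < J0.+1) hnorm H (t%:C ^+ i *: b i).
have s0 : 0 <= \sum_(i < J0.+1) hnorm H (t%:C ^+ i *: b i).
  by apply: sumr_ge0 => i _; apply: hnorm_ge0.
exists M => [|j]; first by rewrite /M addr_ge0.
have : hnorm H (t%:C ^+ j *: b j) <= M.
  have [jJ|jJ] := leqP j J0.
    rewrite /M (bigD1 (Ordinal (jJ : (j < J0.+1)%N))) //=.
    have : 0 <= \sum_(i < J0.+1 | i != Ordinal (jJ : (j < J0.+1)%N))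
      hnorm H (t%:C ^+ i *: b i) by apply: sumr_ge0 => i _; apply: hnorm_ge0.
    by have := hnorm_ge0 H (t%:C ^+ j *: b j); lra.
  have [i ji] : exists i, j = i.+1 by case: j jJ => // i _; exists i.
  have h1 := hJ0 j (ltnW jJ).
  have h2 : hnorm H (\sum_(k < j) t%:C ^+ k *: b k) <= 1.
    by rewrite ji; apply: hJ0; rewrite ji in jJ.
  have e : t%:C ^+ j *: b j = \sum_(k < j.+1) t%:C ^+ k *: b k - \sum_(k < j) t%:C ^+ k *: b k.
    by rewrite big_ord_recr /= addrC addrK.
  rewrite e; apply: le_trans (hnormB hH _ _) _; try exact: hset_sum.
  by rewrite /M; lra.
rewrite nE => h; have p : 0 < (2 : R) ^+ j by rewrite exprn_gt0.
by rewrite -ler_pdivrMr // mulrC -exprVn.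
Qed.

(** As the norm of b j is at most M 2^j, for t <= 1/4 the terms of index at
    least 1 add up to at most 4 t M; then let t tend to 0. *)
Lemma small_sums_coef0 : b 0%N = 0.
Proof.
have [M M0 hM] := coef_bound.
apply: (hnorm_eq0 hH) => //; apply/eqP; rewrite eq_le hnorm_ge0 andbT.
apply/ler_addgt0Pr => /= e e0; rewrite -[e]/(e : R) add0r.
(* The tail is at most 4 t M <= e / 2 for this t. *)
pose t : R := Num.min (4^-1) (e / (8 * (M + 1))).
have t0 : 0 < t by rewrite lt_min invr_gt0 // divr_gt0 //; lra.
have t4 : t <= 4^-1 by rewrite ge_min lexx.
have te : t * (8 * (M + 1)) <= e.
  by rewrite -ler_pdivlMr ?ge_min ?lexx ?orbT //; lra.
have t01 : 0 < t < 1 by rewrite t0; apply: le_lt_trans t4 _; rewrite invf_lt1 // ltr1n.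
have e2 : 0 < e / 2 by rewrite divr_gt0.
have [J0 hJ0] := vanish t01 e2; have := hJ0 J0 (leqnn J0).
rewrite big_ord_recl expr0 scale1r => h.
have hs' j : hset H (t%:C ^+ j *: b j) by have := hb j => ?; hs.
set s := \sum_(j < J0) _ in h; have hsum : hset H s by apply: hset_sum.
have sle : hnorm H s <= 4 * t * M.
  apply: le_trans (hnorm_sum hH _ _ _) _; first by move=> i; apply: hs'.
  apply: (@le_trans _ _ (\sum_(j < J0) (2 * t * M) * (2 * t) ^+ j)).
    apply: ler_sum => j _; rewrite (hnormZ hH) // -rmorphXn modulus_real.
    rewrite ger0_norm ?exprn_ge0 ?(ltW t0) //.
    apply: le_trans (ler_wpM2l _ (hM _)) _; first by rewrite exprn_ge0 ?ltW.
    rewrite lift0 !exprS exprMn le_eqVlt; apply/orP; left; apply/eqP; ring.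
  rewrite -mulr_sumr; have := @geometric_half (2 * t) J0.
  have -> : 0 <= 2 * t <= 2^-1 by apply/andP; split; lra.
  move=> /(_ isT); have : 0 <= 2 * t * M by rewrite !mulr_ge0 // ltW.
  move=> p g; rewrite (_ : 4 * t * M = (2 * t * M) * 2); last by ring.
  exact: ler_wpM2l.
have -> : b 0%N = (b 0%N + s) - s by rewrite addrK.
have hb0 := hb 0%N; apply: le_trans (hnormB hH _ _) _; [by hs|by []|].
have : 0 <= t * M by rewrite mulr_ge0 // ltW.
lra.
Qed.

End Constant.

(** Once b 0 = 0 is known, division by t gives the same hypothesis for the
    shifted sequence. *)
Lemma small_sums_coef (b : nat -> V) : (forall j, hset H (b j)) ->
  (forall t : R, 0 < t < 1 -> small_sums (fun j => (t%:C ^+ j) *: b j)) ->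
  forall j, b j = 0.
Proof.
move=> hb vb j; elim: j b hb vb => [|j IH] b hb vb; first exact: small_sums_coef0.
apply: (IH (fun j => b j.+1)) => // t t01 eps e0; case/andP: (t01) => t0 t1.
have b0 : b 0%N = 0 by apply: small_sums_coef0.
have e1 : 0 < t * eps by rewrite mulr_gt0.
have [J0 hJ0] := vb t t01 _ e1; exists J0 => J hJ.
have := hJ0 J.+1 (leqW hJ); rewrite big_ord_recl b0 scaler0 add0r.
have -> : \sum_(i < J.+1) t%:C ^+ lift ord0 i *: b (lift ord0 i) =
    t%:C *: \sum_(i < J.+1) t%:C ^+ i *: b i.+1.
  by rewrite scaler_sumr; apply: eq_bigr => i _; rewrite lift0 exprS scalerA.
rewrite (hnormZ hH) ?modulus_real ?gtr0_norm ?ler_pM2l //.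
by apply: hset_sum => // i; have := hb i.+1 => ?; hs.
Qed.

End PowerSeries.

Section Kronecker.

Lemma digits_inj N D (a b : nat -> nat) : (forall k, a k < N)%N -> (forall k, b k < N)%N ->
  (\sum_(k < D) a k * N ^ k = \sum_(k < D) b k * N ^ k)%N ->
  forall k, (k < D)%N -> a k = b k.
Proof.
elim: D a b => // D IH a b ha hb.
have e (c : nat -> nat) : (\sum_(k < D.+1) c k * N ^ k =
    (\sum_(k < D) c k.+1 * N ^ k) * N + c 0)%N.
  rewrite big_ord_recl expn0 muln1 addnC big_distrl; congr (_ + _)%N.
  by apply: eq_bigr => i _; rewrite lift0 expnSr mulnA.
rewrite !e => eq.
have e0 : a 0%N = b 0%N.
  by have := congr1 (modn ^~ N) eq; rewrite /= !modnMDl !modn_small.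
move: eq; rewrite e0 => /addIn /eqP; rewrite eqn_pmul2r; last by apply: leq_ltn_trans (ha 0%N).
move=> /eqP eq [|k] // kD; apply: (IH (fun k => a k.+1) (fun k => b k.+1)) => //.
Qed.

End Kronecker.

Section TaylorUniqueness.
Variables (R : realType) (d : nat) (V : lmodType R[i]) (H : hspace V).
Hypothesis hH : is_hilbert H.
Local Open Scope complex_scope.

Lemma zmon_scale (t : R[i]) (z : 'rV[R[i]]_d.+1) j n : simplex j n ->
  zmon (t *: z) n = t ^+ j * zmon z n.
Proof.
move=> [nn ln]; rewrite /zmon.
rewrite (eq_bigr (fun k => t ^+ `|n 0%R k|%N * z 0 k ^ n 0 k)) => [|k _].
  rewrite big_split /= prodrXr; congr (t ^+ _ * _).
  by move: (nonneg_lev nn); rewrite ln => -[].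
rewrite mxE; have := nn k; case: (n 0 k) => // a _.
exact: exprMn.
Qed.

(** Uniqueness of power series in several variables. Scaling z separates the
    homogeneous parts; on a fixed homogeneous part the substitution
    z_k = s^(N^k) separates the monomials, as digits in base N. *)
Lemma slices_unique (c : Zd d -> V) : (forall n, hset H (c n)) ->
  (forall z, polydisk z -> small_sums H (fun j => slice z j c)) ->
  forall n, nonneg_idx n -> c n = 0.
Proof.
move=> hc small n0 nn0; have [j sn0] := simplexP nn0.
have hsl z i : hset H (slice z i c) by apply: slice_hset.
have slice_zero z : polydisk z -> slice z j c = 0.
  move=> hz; apply: (small_sums_coef hH (b := fun j => slice z j c)) => // t /andP[t0 t1].
  have hz' : polydisk (t%:C *: z).
    move=> k; rewrite mxE Normc.normcM modulus_real gtr0_norm //.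
    by apply: le_lt_trans (hz k); rewrite ler_piMl ?modulus_ge0 // ltW.
  move=> eps e0; have [J0 hJ0] := small _ hz' _ e0; exists J0 => J hJ.
  have -> : \sum_(i < J.+1) t%:C ^+ i *: slice z i c = \sum_(i < J.+1) slice (t%:C *: z) i c.
    apply: eq_bigr => i _; rewrite !sliceE scaler_sumr big_seq [RHS]big_seq.
    apply: eq_bigr => m; rewrite in_fset_set ?inE; last exact: finite_simplex.
    by move=> sm; rewrite (zmon_scale _ _ sm) scalerA.
  exact: hJ0.
(* Exponents of degree j are digits in base j + 1; kap n is the exponent of s in z^n
   when z_k = s^(N^k). *)
pose N := j.+1; pose kap (n : Zd d) := (\sum_(k < d.+1) `|n 0%R k| * N ^ k)%N.
pose r := finmap.enum_fset (fset_set (simplex j : set (Zd d))).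
have rP n : n \in r -> simplex j n.
  by rewrite in_fset_set ?inE //; exact: finite_simplex.
pose W := (\sum_(n <- r) kap n)%N.
have kW n : n \in r -> (kap n < W.+1)%N.
  by move=> nr; rewrite ltnS /W (big_rem n) //= leq_addr.
pose b w := \sum_(n <- r) (if kap n == w then c n else 0).
have hb w : hset H (b w).
  by apply: hset_sum => // n; case: ifP => _ //; hs.
have b0 : forall w, b w = 0.
  apply: (small_sums_coef hH) => // s /andP[s0 s1] eps e0; exists W => J hJ.
  pose z : 'rV[R[i]]_d.+1 := \row_k s%:C ^+ (N ^ k).
  have hz : polydisk z.
    move=> k; rewrite mxE -rmorphXn modulus_real ger0_norm; last by rewrite exprn_ge0 // ltW.
    by rewrite exprn_ilt1 ?(ltW s0) ?expn_eq0.
  have zE n : n \in r -> zmon z n = s%:C ^+ kap n.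
    move=> /rP[nn _]; rewrite /zmon /kap -prodrXr; apply: eq_bigr => k _.
    rewrite mxE; have := nn k; case: (n 0 k) => // a _; rewrite mulnC exprM.
    by [].
  have -> : \sum_(w < J.+1) s%:C ^+ w *: b w = slice z j c.
    rewrite sliceE -/r; under eq_bigr => w _ do rewrite scaler_sumr.
    rewrite exchange_big big_seq [RHS]big_seq; apply: eq_bigr => n nr /=.
    have kJ : (kap n < J.+1)%N := leq_trans (kW n nr) (hJ : (W.+1 <= J.+1)%N).
    rewrite (bigD1 (Ordinal kJ)) //= eqxx zE // big1 ?addr0 // => w wk.
    case: eqP => [e|_]; last by rewrite scaler0.
    by case/eqP: wk; apply: val_inj; rewrite /= e.
  by rewrite slice_zero // (hnorm0 hH) ltW.
have := b0 (kap n0); have n0r : n0 \in r.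
  by rewrite in_fset_set ?inE //; exact: finite_simplex.
rewrite /b (bigD1_seq n0) ?finmap.fset_uniq //= eqxx big_seq_cond big1 ?addr0 //.
move=> n /andP[nr nn0']; case: eqP => // e; case/eqP: nn0'.
have lt m : m \in r -> forall k, (`|m 0%R (inord k : 'I_d.+1)| < N)%N.
  move=> /rP[nn lm] k; rewrite ltnS -lez_nat gez0_abs; last exact: nn.
  rewrite -lm /lev (bigD1 (inord k)) //= lerDl; apply: sumr_ge0 => i _; exact: nn.
have dig := @digits_inj N d.+1 (fun k => `|n 0%R (inord k : 'I_d.+1)|%N)
  (fun k => `|n0 0%R (inord k : 'I_d.+1)|%N) (lt n nr) (lt n0 n0r).
apply/rowP => k; have [nn _] := rP n nr.
have := dig _ k (ltn_ord k); rewrite inord_val => {}dig.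
rewrite -[LHS]gez0_abs ?nn // -[RHS]gez0_abs ?nn0 //.
have kI (m : Zd d) : (\sum_(i < d.+1) `|m 0%R (inord i : 'I_d.+1)| * N ^ i)%N = kap m.
  by apply: eq_bigr => i _; rewrite inord_val.
by congr Posz; apply: dig; rewrite !kI.
Qed.

End TaylorUniqueness.

Section Taylor.
Variables (R : realType) (d : nat) (VE VEs V : lmodType R[i]).
Variables (E : hspace VE) (Es : hspace VEs).
Variables (S : 'rV[R[i]]_d.+1 -> VE -> VEs) (Sn : Zd d -> VE -> VEs).
Hypothesis (hE : is_hilbert E) (hEs : is_hilbert Es).
Hypothesis (hS : schur_class E Es S) (hSn : taylor_series E Es S Sn).

Fixpoint ball (J : nat) : set (Zd d) :=
  if J is j.+1 then ball j `|` simplex j.+1 else simplex 0.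

Lemma ballP J n : ball J n <-> nonneg_idx n /\ lev n <= J%:Z.
Proof.
elim: J => [|J IH] /=.
  split=> [[nn ->]//|[nn ln]]; split=> //; have := nonneg_lev_ge0 nn; lia.
split=> [[/IH[nn ln]|[nn ln]]|[nn ln]]; first by split=> //; lia.
  by split=> //; rewrite ln.
have [le|lt] := lerP (lev n) J%:Z; first by left; apply/IH.
by right; split=> //; lia.
Qed.

Lemma ball_finite J : finite_set (ball J).
Proof.
elim: J => [|J IH] /=; first exact: finite_simplex.
by rewrite finite_setU; split=> //; exact: finite_simplex.
Qed.

Lemma ball_sum (W : lmodType R[i]) (f : Zd d -> W) J :
  \sum_(n \in ball J) f n = \sum_(j < J.+1) \sum_(n \in simplex j) f n.
Proof.
elim: J => [|J IH]; first by rewrite big_ord_recr big_ord0 /= add0r.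
rewrite big_ord_recr -IH; apply: fsbigU0; [exact: ball_finite|exact: finite_simplex|].
by move=> n [/ballP[_ ln] [_ ln']]; move: ln; rewrite ln'; lia.
Qed.

(** Unconditional convergence allows summation by total degree. *)
Lemma taylor_slices z e : polydisk z -> hset E e -> forall eps : R, 0 < eps ->
  exists J0, forall J, (J0 <= J)%N ->
    hnorm Es (\sum_(j < J.+1) slice z j (Sn ^~ e) - S z e) <= eps.
Proof.
move=> hz he eps eps0; case: hSn => _ S0 /(_ z hz).
have e1 : 0 < eps / (hnorm E e + 1) by rewrite divr_gt0 // ltr_wpDl ?hnorm_ge0.
move=> /(_ _ e1)[F0 fF0 hF0].
pose r := finmap.enum_fset (fset_set F0).
exists (\sum_(n <- r) absz (lev n))%N => J hJ.
have := hF0 (F0 `|` ball J); rewrite finite_setU => /(_ (conj fF0 (ball_finite J))).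
move=> /(_ (@subsetUl _ _ _) e he).
rewrite -(@fsbig_widen _ _ _ _ (ball J)).
- rewrite ball_sum => /le_trans; apply.
  rewrite mulrAC ler_pdivrMr ?ltr_wpDl ?hnorm_ge0 //.
  by rewrite ler_wpM2l ?(ltW eps0) // lerDl.
- exact: subsetUr.
move=> n [[F0n|//] nB] /=; rewrite S0 ?scaler0 // => nn; apply: nB; apply/ballP.
split=> //; have nr : n \in r by rewrite in_fset_set // inE.
move: hJ; rewrite (big_rem n) //=; have := nonneg_lev_ge0 nn; lia.
Qed.

Variable U : colligation d V VE VEs.
Hypothesis hU : GR_unitary E Es U.

Let hSz z e : polydisk z -> hset E e -> hset Es (S z e).
Proof. by case: hS => h _ _ hz; apply: (bounded_hset (h z hz)). Qed.

Let hSne n e : hset E e -> hset Es (Sn n e).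
Proof. by case: hSn => h _ _; apply: (bounded_hset (h n)). Qed.

Let hsumS z J e : hset E e -> hset Es (\sum_(j < J.+1) slice z j (Sn ^~ e)).
Proof. by move=> he; apply: hset_sum => // j; apply: slice_hset => // n; apply: hSne. Qed.

Let hsumT z J e : hset E e -> hset Es (transfer_sum U z J e).
Proof.
move=> he; apply: hset_sum => // j; apply: slice_hset => // n.
exact: (transfer_hset hE hEs hU).
Qed.

(** For fixed z and e the two sides are limits of the same partial sums. *)
Lemma realizes_of_transfer : (forall n e, hset E e -> transfer U n e = Sn n e) ->
  realizes E U S.
Proof.
move=> tr z hz; have [T bT [T1 T2]] := Zop_inverse hE hEs hU hz.
exists T; first by split.
move=> e he; have hT := bounded_hset bT.
have hZ := bounded_hset (bounded_Zop hU z) (blockB_hset hE hEs hU he).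
have hC := blockC_hset hE hEs hU (hT _ hZ).
have hD := blockD_hset hE hEs hU he; have hSe := hSz hz he.
apply/eqP; rewrite -subr_eq0; apply/eqP; set q := blockD U e + _.
have hq : hset Es q by rewrite /q; hs.
apply: (hnorm_eq0 hEs); first by hs.
apply/eqP; rewrite eq_le hnorm_ge0 andbT; apply/ler_addgt0Pr => /= eps e0.
rewrite -[eps]/(eps : R) add0r; have e2 : 0 < eps / 2 by rewrite divr_gt0.
have [J1 h1] := transfer_sum_cvg hE hEs hU hz hT T2 he e2.
have [J2 h2] := taylor_slices hz he e2.
pose J := maxn J1 J2; have {}h1 := h1 J (leq_maxl _ _); have {}h2 := h2 J (leq_maxr _ _).
have e1 : transfer_sum U z J e = \sum_(j < J.+1) slice z j (Sn ^~ e).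
  by apply: eq_bigr => j _; apply: slice_eq => n _; apply: tr.
rewrite -/q e1 in h1; have hs' := hsumS z J he; set s := \sum_(j < _) _ in h1 h2 hs'.
have -> : S z e - q = - (q - s) - (s - S z e) by rewrite !opprB [RHS]addrC addrA subrK.
apply: le_trans (hnormB hEs _ _) _; try hs.
have hqs := hsetB hEs hq hs'.
by rewrite (hnormN hEs hqs) [leRHS]splitr lerD.
Qed.

(** The homogeneous parts of the difference of the two series have partial
    sums tending to 0 at every point of the polydisk. *)
Lemma transfer_of_realizes : realizes E U S ->
  forall n e, hset E e -> transfer U n e = Sn n e.
Proof.
move=> rz n e he; have [nn|nn] := pselect (nonneg_idx n); last first.
  by rewrite (transfer_out hE hEs hU) //; case: hSn => _ -> .
apply/esym/eqP; rewrite -subr_eq0; apply/eqP.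
have htr m := transfer_hset hE hEs hU m he; have hSm m := hSne m he.
apply: (slices_unique hEs (c := fun n => Sn n e - transfer U n e)) => // [m|z hz eps e0].
  by have := htr m; have := hSm m => *; hs.
have [T [bT _ T2] TE] := rz z hz; have hT := bounded_hset bT.
have e2 : 0 < eps / 2 by rewrite divr_gt0.
have [J1 h1] := transfer_sum_cvg hE hEs hU hz hT T2 he e2.
have [J2 h2] := taylor_slices hz he e2.
exists (maxn J1 J2) => J; rewrite geq_max => /andP[/h1 {}h1 /h2 {}h2].
rewrite -TE // in h1; have hSe := hSz hz he.
have hs1 := hsumS z J he; have hs2 := hsumT z J he.
have -> : \sum_(j < J.+1) slice z j (fun n => Sn n e - transfer U n e) =
    (\sum_(j < J.+1) slice z j (Sn ^~ e) - S z e) + (S z e - transfer_sum U z J e).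
  rewrite addrA subrK /transfer_sum -sumrB; apply: eq_bigr => j _; exact: sliceB.
by apply: le_trans (hnormD hEs _ _) _; [hs|hs|rewrite [leRHS]splitr lerD].
Qed.

End Taylor.

(** * Uniqueness of the colligation *)

Section Uniqueness.
Variables (R : realType) (d : nat) (VE VEs W : lmodType R[i]).
Variables (E : hspace VE) (Es : hspace VEs).
Variables (Sn : Zd d -> VE -> VEs) (K : 'I_d.+1 -> kernel d (VEs * VE)%type).
Hypothesis (hE : is_hilbert E) (hEs : is_hilbert Es).
Hypothesis bSn : forall n, bounded_op E Es (Sn n).
Hypothesis hK : augmented_agler_decomposition E Es Sn K.
Hypothesis hscc : strictly_closely_connected E Es K.
Local Notation G := (hprod Es E).
Local Notation H := (HK E Es K).
Local Notation X := (hdsum setT H).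

Variable U : colligation d W VE VEs.
Hypothesis hU : GR_unitary E Es U.
Hypothesis hcomp : compatible E Es U K.
Hypothesis htr : forall n e, hset E e -> transfer U n e = Sn n e.
Hypothesis hcc : closely_connected E Es U.
Local Notation Y := (cspace U).
Local Notation U' := (dual E U).
Let hY : forall k, is_hilbert (Y k). Proof. by case: hU. Qed.
Let hS : is_hilbert (state U) := state_hilbert hU.
Let hU' : GR_unitary Es E U' := dual_unitary hE hU.
Let hG : is_hilbert G. Proof. exact: hprod_hilbert. Qed.
Let bG := bounded_Gamma hE hEs hU.

Definition inj (k : 'I_d.+1) (x : W) : 'I_d.+1 -> W := fun j => if j == k then x else 0.

Let injE k x : cproj k x = inj k (x k).
Proof. by apply/funext => j; rewrite /Defs.proj /inj; case: eqP => [->|]. Qed.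

Let inj_hset k x : hset (Y k) x -> hset (state U) (inj k x).
Proof.
move=> hx; apply/stateP => j; rewrite /inj; case: eqP => [->//|_].
exact: hset0.
Qed.

Let inj_hip k x y : hset (Y k) x -> hset (state U) y ->
  hip (state U) (inj k x) y = hip (Y k) x (y k).
Proof.
move=> hx /stateP hy; rewrite hdsum_fin_hip (bigD1 k) //= /inj eqxx big1 ?addr0 //.
by move=> j /negPf ->; rewrite (hip0l (hY j)) //; exact: hy.
Qed.

Let inj_bounded k : bounded_op (Y k) (state U) (inj k).
Proof.
split; [exact: inj_hset| |exists 1 => x hx; rewrite mul1r].
  move=> a x y _ _; apply/funext => j; rewrite !fctE /inj; case: eqP => //.
  by rewrite scaler0 addr0.
by rewrite /hnorm inj_hip ?/inj ?eqxx //; exact: inj_hset.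
Qed.

Let Gam k n x := Gamma E U k n (inj k x).

Let Gamma_inj k n x : Gamma E U k n x = Gam k n (x k).
Proof. by rewrite /Gam -injE /Gamma projK. Qed.

Let bGam k n : bounded_op (Y k) G (Gam k n).
Proof. exact: (bounded_comp (hY k) hS hG (inj_bounded k) (bG k n)). Qed.

Let GamE k n m g : hset G g -> K k n m g = Gam k n (adj (Y k) G (Gam k m) g).
Proof.
move=> hg; rewrite hcomp // Gamma_inj; congr (Gam k n _); apply/esym.
have [ha ah] := adjP hS hG (bG k m) hg.
apply: (adj_unique (hY k)); first by move: ha => /stateP.
by move=> x hx; rewrite /Gam ah ?inj_hip //; exact: inj_hset.
Qed.

Let rk := HK_rkhs hE hEs hK.

Let Gamma_series k x : hset (state U) x -> hset (H k) (fun n => Gamma E U k n x).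
Proof.
move=> /stateP hx; under eq_fun do rewrite Gamma_inj.
exact: (rkhs_factor_hset (hY k) hG (bGam k) (GamE k) (rk k) (hx k)).
Qed.

Let Gamma0 k n : Gamma E U k n 0 = 0.
Proof. exact: (lin0 hS (bounded_lin (bG k n))). Qed.

Let identity_kerC x m : hset (state U) x -> blockC U x = 0 ->
  \sum_k Gamma E U k (m - evec k) (blockA U x) = \sum_k Gamma E U k m x.
Proof.
move=> hx Cx; have := colligation_identity hE hEs hU m hx (hset0 hE) => /=.
rewrite -/(blockC U x) -/(blockA U x) Cx.
have t0 n : transfer U n 0 = 0 by rewrite htr ?(lin0 hE (bounded_lin (bSn n))) //; hs.
have t0' n : transfer U' n 0 = 0.
  apply: (hip_inj hE) => [||e he]; [|by hs|].
    by apply: (transfer_hset hEs hE hU'); hs.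
  have h0 := hset0 hEs; have hT := transfer_hset hEs hE hU' n h0.
  rewrite (hip_conj hE (x := e)) // -(transfer_dual hE hEs hU) //.
  by rewrite (hip0r hEs) ?(hip0l hE) ?conjc0 //; apply: (transfer_hset hE hEs hU).
by rewrite t0 t0' /delta0 !if_same !addr0.
Qed.

(* The states invisible to all Gamma_k. In [colligation_identity] from such a
   state to its image under A the terms of the old state vanish, and from its
   image under A^* back to it those of the new state; the sum maps on the z_k
   H(K_k) and on the H(K_k) then show that the two images are invisible. *)
Let N : set ('I_d.+1 -> W) :=
  [set x | hset (state U) x /\ forall k n, Gamma E U k n x = 0].

Let N_C x : N x -> blockC U x = 0.
Proof.
move=> [hx Nx]; have := sum_Gamma1 hE hEs hU 0 hx; rewrite resolvent0 => <-.
by apply: big1 => k _; rewrite Nx.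
Qed.

Let N_C' x : N x -> blockC U' x = 0.
Proof.
move=> [hx Nx]; have := sum_Gamma2S hE hEs hU 0 hx; rewrite oppr0 resolvent0 => <-.
by apply: big1 => k _; rewrite Nx.
Qed.

Let N_A x : N x -> N (blockA U x).
Proof.
move=> Nx; have Cx := N_C Nx; case: Nx => hx Nx.
have hA := blockA_hset hE hEs hU hx; split=> //.
pose f k := zmul (evec k) (fun n => Gamma E U k n (blockA U x)).
suff f0 : f = 0.
  move=> k n; have := congr1 (fun f => f k (n + evec k)) f0.
  by rewrite /f /zmul /= addrK.
case: hscc => _ inj2; apply: inj2.
- by apply/stateP => k; eexists; first exact: (Gamma_series k hA).
- apply/stateP => k; exists 0; first exact: hset0 (HK_hilbert hE hEs hK k).
  by apply/funext.
apply/funext => m; rewrite /sum_map !fct_sumE [RHS]big1 //.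
by rewrite [LHS](identity_kerC m hx Cx) big1.
Qed.

Let N_A' x : N x -> N (blockA U' x).
Proof.
move=> Nx; have Cx := N_C' Nx; case: Nx => hx Nx.
have hA := blockA_hset hEs hE hU' hx; split=> //.
have [e1 e2] := blocks_on_kerC hEs hU hx Cx.
pose f k := (fun n => Gamma E U k n (blockA U' x)).
suff f0 : f = 0 by move=> k n; exact: (congr1 (fun f => f k n) f0).
case: hscc => inj1 _; apply: inj1.
- by apply/stateP => k; exact: (Gamma_series k hA).
- by apply/stateP => k; exact: hset0 (HK_hilbert hE hEs hK k).
apply/funext => m; rewrite /sum_map !fct_sumE [RHS]big1 //.
rewrite -[LHS]/(\sum_k Gamma E U k m (blockA U' x)) -identity_kerC // e1.
by rewrite big1.
Qed.

(** These states form the reducing subspace N, which close connectedness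
    excludes. *)
Lemma compatible_inj x : hset (state U) x -> (forall k n, Gamma E U k n x = 0) -> x = 0.
Proof.
move=> hx Nx.
apply: (closely_connected_trivial hE hEs hU hcc _ N_C N_C' N_A N_A' _ (conj hx Nx)).
- by move=> y [].
- move=> k y [hy Ny]; split; first exact: (cproj_hset hU).
  move=> j n; have [->|jk] := eqVneq j k; first by rewrite /Gamma projK -/(Gamma E U k n y).
  by rewrite Gamma_inj /Defs.proj (negPf jk) -[RHS](Gamma0 j n) Gamma_inj.
Qed.

(** The unitary identification of the k-th state space with H(K_k). *)
Definition model_map k x : Zd d -> VEs * VE := fun n => Gam k n x.

Lemma model_map_unitary k : unitary (Y k) (H k) (model_map k).
Proof.
apply: (rkhs_factor_unitary (hY k) hG (bGam k) (GamE k) (rk k)) => x hx h.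
have /(congr1 (@^~ k)) : inj k x = 0; last by rewrite /inj eqxx.
apply: compatible_inj => [|j n]; first exact: inj_hset.
have [->|jk] := eqVneq j k; first exact: h.
by rewrite Gamma_inj /inj (negPf jk) -[RHS](Gamma0 j n) Gamma_inj.
Qed.

Variable V : ('I_d.+1 -> Zd d -> VEs * VE)%type * VE -> ('I_d.+1 -> Zd d -> VEs * VE)%type * VEs.
Hypothesis hV : is_V E Es Sn K V.

(** By [colligation_identity] the operator that U induces on the direct sum of
    the H(K_k) has the observation property that determines V. *)
Lemma model_equiv : colligation_equiv E (Colligation H V) U.
Proof.
have uM := model_map_unitary.
exists (fun k => uinv (Y k) (model_map k)); split=> [k|x e /stateP hx he].
  exact: unitary_uinv.
set x2 := fun k => _; have hx2 : hset (state U) x2.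
  by apply/stateP => k; have [] := uinvP (uM k) (hx k).
have [hy2 he2] := cmap_hset hU hx2 he.
set y2 := (cmap U (x2, e)).1 in hy2; set e2 := (cmap U (x2, e)).2 in he2.
pose y : 'I_d.+1 -> Zd d -> (VEs * VE)%type := fun k => model_map k (y2 k).
have hy : hset X y.
  by apply/stateP => k; apply: (unitary_hset (uM k)); move: hy2 => /stateP.
suff eV : V (x, e) = (y, e2).
  rewrite [LHS]surjective_pairing -/e2 -![cmap _ (x, e)]/(V (x, e)) !eV; congr (_, _); apply/funext => k /=.
  by rewrite /y (uinvK (uM k)) //; move: hy2 => /stateP.
have hxX : hset X x by apply/stateP.
apply: (V_unique hE hEs bSn hK hscc hV) => //.
move=> m; have := colligation_identity hE hEs hU m hx2 he => /=.
rewrite -/y2 -/e2 htr //.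
have -> : transfer U' (- m) e2 = adj E Es (Sn (- m)) e2.
  apply/esym; apply: (adj_unique hE); first exact: (transfer_hset hEs hE hU').
  by move=> e' he'; rewrite -htr // (transfer_dual hE hEs hU).
move=> id; rewrite /obsR /obsD /=.
have -> : \sum_k y k (m - evec k) = \sum_k Gamma E U k (m - evec k) y2.
  by apply: eq_bigr => k _; rewrite Gamma_inj.
rewrite id; congr (_ + _); apply: eq_bigr => k _; rewrite Gamma_inj.
by have [_] := uinvP (uM k) (hx k) => <-.
Qed.

End Uniqueness.

(** * Trajectories and conservation of energy *)

Section EllTwo.
Variables (R : realType) (I : choiceType).
Local Open Scope complex_scope.
Implicit Types V : lmodType R[i].

Lemma restrict_in V (A : set I) (f : I -> V) n : A n -> restrict_to A f n = f n.
Proof. by move=> An; rewrite /restrict_to; case: asboolP. Qed.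

Lemma restrict_out V (A : set I) (f : I -> V) n : ~ A n -> restrict_to A f n = 0.
Proof. by move=> An; rewrite /restrict_to; case: asboolP. Qed.

Lemma restrict_linear V (A : set I) a (f g : I -> V) :
  restrict_to A (a *: f + g) = a *: restrict_to A f + restrict_to A g.
Proof.
apply/funext => n; rewrite /restrict_to !fctE; case: ifP => // _.
by rewrite scaler0 addr0.
Qed.

(** The possibly infinite squared norm of a family; additivity and reindexing
    are unconditional for it. *)
Definition sqsum V (A : set I) (H : hspace V) (f : I -> V) : \bar R :=
  (\esum_(i in A) (hnorm H (f i) ^+ 2)%:E)%E.

Lemma sqsum_ge0 V (A : set I) (H : hspace V) f : (0 <= sqsum A H f)%E.
Proof. by apply: esum_ge0 => i _; rewrite lee_fin sqr_ge0. Qed.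

Lemma ell2_restrict V (A : set I) (H : hspace V) f : (forall n, hset H (f n)) ->
  hset (ell2 A H) (restrict_to A f) <-> (sqsum A H f < +oo)%E.
Proof.
move=> hf; have e : sqsum A H (restrict_to A f) = sqsum A H f.
  by apply: eq_esum => n An; rewrite restrict_in.
split=> [[_ _]|h]; first by rewrite -e.
split; [by move=> n An; rewrite restrict_in|by move=> n nA; exact: restrict_out|].
by rewrite -e in h.
Qed.

Lemma usum_sqsum V (A : set I) (H : hspace V) f : is_hilbert H ->
  (forall n, hset H (f n)) -> (sqsum A H f < +oo)%E ->
  usum A (fun n => hip H (f n) (f n)) = (fine (sqsum A H f))%:C.
Proof.
move=> hH hf lt; apply: usumE.
apply: has_usum_eq (has_usum_ge0 _ lt); last by move=> i _; exact: sqr_ge0.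
by move=> n _; rewrite (hipxx hH).
Qed.

Lemma sqsum_sub V (A : set I) (H : hspace V) f n : A n ->
  ((hnorm H (f n) ^+ 2)%:E <= sqsum A H f)%E.
Proof.
move=> An; apply: ereal_sup_ubound; exists [set n]; first by split=> // m ->.
by rewrite fsbig_set1.
Qed.

End EllTwo.

Section IsometryCriterion.
Variables (R : realType) (V W : lmodType R[i]) (H1 : hspace V) (H2 : hspace W).
Variable T : V -> W.
Hypothesis (hH1 : is_hilbert H1) (hH2 : is_hilbert H2).

(** By polarization. *)
Lemma unitary_of_norm : (forall x, hset H1 x -> hset H2 (T x)) -> linear_on H1 T ->
  (forall y, hset H2 y -> exists2 x, hset H1 x & T x = y) ->
  (forall x, hset H1 x -> hip H2 (T x) (T x) = hip H1 x x) -> unitary H1 H2 T.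
Proof.
move=> hT lT sT nT; split=> // x y hx hy.
have hTx := hT _ hx; have hTy := hT _ hy.
rewrite (polarization hH1 hx hy) (polarization hH2 hTx hTy).
rewrite -!(linZ hH1 lT) // -!(linD lT) //; try hs.
rewrite -!(linB hH1 lT) //; try hs.
by rewrite !nT //; hs.
Qed.

End IsometryCriterion.

Section Trajectories.
Variables (R : realType) (d : nat) (VE VEs V : lmodType R[i]).
Variables (E : hspace VE) (Es : hspace VEs) (U : colligation d V VE VEs).
Hypothesis (hE : is_hilbert E) (hEs : is_hilbert Es) (hU : GR_unitary E Es U).
Local Notation X := (state U).
Local Notation Y := (cspace U).
Local Notation U' := (dual E U).
Local Notation VX := ('I_d.+1 -> V).
Local Notation VT := (Zd d -> (VE * VX * VEs)%type).
Local Notation VOm := ((Zd d -> VEs) * ('I_d.+1 -> Zd d -> V) * (Zd d -> VE))%type.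
Local Notation OmB := (@OmegaB d).
Local Notation Xi := (@Xi d).
Local Notation T := (spaceT E Es U).
Local Notation TOm := (spaceTOm E Es U).
Local Notation traj := (trajectory E Es U).
Local Open Scope complex_scope.

Let hY : forall k, is_hilbert (Y k). Proof. by case: hU. Qed.
Let hXX : is_hilbert X := state_hilbert hU.
Let hU' : GR_unitary Es E U' := dual_unitary hE hU.
Let uU : unitary (hprod X E) (hprod X Es) (cmap U). Proof. by case: hU. Qed.

Lemma OmegaB_lev n : OmB n <-> 0 <= lev n. Proof. by []. Qed.
Lemma Xi_lev n : Xi n <-> lev n = 0. Proof. by []. Qed.

Lemma levE (n : Zd d) k : lev (n + evec k) = lev n + 1.
Proof. by rewrite levD lev_evec. Qed.
Lemma levBE (n : Zd d) k : lev (n - evec k) = lev n - 1.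
Proof. by rewrite levD levN lev_evec. Qed.

Lemma traj_hset xi n : traj xi ->
  [/\ hset E (tu xi n), hset X (tx xi n) & hset Es (ty xi n)].
Proof. by case=> h _ _; have [[h1 h2] h3] := h n. Qed.

(** In this form the recursion can be inverted. *)
Lemma traj_step xi n : traj xi ->
  cmap U (tx xi n, tu xi n) = ((fun k => tx xi (n + evec k) k), ty xi n).
Proof.
move=> tr; have [h1 h2 h3] := traj_hset n tr; case: tr => _ e1 e2.
rewrite (cmapE hE hU) // -e2; congr (_, _).
by apply/funext => k; rewrite e1.
Qed.

Lemma traj_of_step xi :
  (forall n, [/\ hset E (tu xi n), hset X (tx xi n) & hset Es (ty xi n)]) ->
  (forall n, cmap U (tx xi n, tu xi n) = ((fun k => tx xi (n + evec k) k), ty xi n)) ->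
  traj xi.
Proof.
move=> h st; split=> [n|n k|n]; first by have [] := h n.
  have [h1 h2 _] := h n; have := congr1 (fun p => p.1 k) (st n).
  by rewrite /= (blockAE hE hU).
have [h1 h2 _] := h n; have := congr1 snd (st n).
by rewrite (blockCE hE hU).
Qed.

Lemma traj_linear : linear_set traj.
Proof.
split.
  apply: traj_of_step => n; first by split; [hs|exact: hset0 hXX|hs].
  rewrite -[(_, _)]/(0 : VX * VE) (lin0 _ (unitary_lin uU)) //.
  exact: hprod_hilbert.
move=> a x y tx_ ty_; apply: traj_of_step => n.
  have [h1 h2 h3] := traj_hset n tx_; have [g1 g2 g3] := traj_hset n ty_.
  by split; [exact: (hsetZD a hE h1 g1)|exact: (hsetZD a hXX h2 g2)|exact: (hsetZD a hEs h3 g3)].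
have [h1 h2 h3] := traj_hset n tx_; have [g1 g2 g3] := traj_hset n ty_.
have -> : (tx (a *: x + y) n, tu (a *: x + y) n) =
    a *: (tx x n, tu x n) + (tx y n, tu y n) by [].
by rewrite (unitary_lin uU) // !traj_step.
Qed.

Lemma traj_shift m xi : traj xi -> traj (fun n => xi (n + m)).
Proof.
move=> [h1 h2 h3]; split=> [n|n k|n]; [exact: h1| |exact: h3].
by rewrite -[RHS]h2 /tx /= addrAC.
Qed.

(** The states at one level are computed from the previous one, so zero data
    propagate. For the past the recursion of the dual colligation is used. *)
Lemma traj_fwd0 xi : traj xi -> (forall n, Xi n -> tx xi n = 0) ->
  (forall n, OmB n -> tu xi n = 0) -> forall n, OmB n -> tx xi n = 0 /\ ty xi n = 0.
Proof.
move=> tr x0 u0; have c0 : cmap U (0, 0) = 0.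
  by rewrite -[(0, 0)]/(0 : VX * VE) (lin0 _ (unitary_lin uU)) //; exact: hprod_hilbert.
have xz : forall n, OmB n -> tx xi n = 0.
  move=> n /OmegaB_lev; case en : (lev n) => [j|//] _.
  elim: j n en => [|j IH] n en; first by apply: x0.
  apply/funext => k; have enk : lev (n - evec k) = j by rewrite levBE en; lia.
  have := congr1 (fun p => p.1 k) (traj_step (n - evec k) tr).
  rewrite /= subrK IH // u0; last by apply/OmegaB_lev; rewrite enk.
  by rewrite c0 => <-.
move=> n On; split; first exact: xz.
by have /= := congr1 snd (traj_step n tr); rewrite xz // u0 // c0 => <-.
Qed.

Lemma traj_bwd0 xi : traj xi -> (forall n, Xi n -> tx xi n = 0) ->
  (forall n, ~ OmB n -> ty xi n = 0) -> forall n, ~ OmB n -> tx xi n = 0 /\ tu xi n = 0.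
Proof.
move=> tr x0 y0.
have z : cmap U' (0, 0) = 0.
  rewrite -[(0, 0)]/(0 : VX * VEs).
  apply: (lin0 (H1 := hprod X Es)); first exact: hprod_hilbert.
  by case: hU' => _ u'; exact: (unitary_lin u').
have back n : ~ OmB n -> (fun k => tx xi (n + evec k) k) = 0 :> VX ->
    tx xi n = 0 /\ tu xi n = 0.
  move=> nO nx; have [h1 h2 h3] := traj_hset n tr.
  have := cmap_dualK hE hU (hset_pair h2 h1).
  by rewrite traj_step // nx y0 // z => -[<- <-].
move=> n nO; move: (nO); rewrite OmegaB_lev; case en : (lev n) => [//|j] _.
elim: j n nO en => [|j IH] n nO en; apply: back => //; apply/funext => k.
  rewrite x0 //; apply/Xi_lev; rewrite levE en; lia.
have en' : lev (n + evec k) = Negz j by rewrite levE en; lia.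
have [|//|->//] := IH (n + evec k); by rewrite OmegaB_lev en'.
Qed.

Lemma PhiOm_linear a xi xi' :
  PhiOm (a *: xi + xi') = a *: PhiOm xi + PhiOm xi' :> VOm.
Proof.
rewrite /PhiOm; congr (_, _, _).
- by rewrite -[RHS]restrict_linear.
- by apply/funext => k; rewrite -[RHS]restrict_linear.
- by rewrite -[RHS]restrict_linear.
Qed.

(** The difference of two trajectories with the same data is zero in the
    future and in the past. *)
Lemma PhiOm_inj xi xi' : traj xi -> traj xi' -> PhiOm xi = PhiOm xi' :> VOm -> xi = xi'.
Proof.
move=> tr tr' e; have trd := traj_linear.2 (-1) _ _ tr' tr.
set z := -1 *: xi' + xi in trd.
have zE n : z n = xi n - xi' n by rewrite /z !fctE scaleN1r addrC.
have y0 n : ~ OmB n -> ty z n = 0.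
  move=> nO; rewrite /ty zE /=; have := congr1 (fun p => p.1.1 n) e.
  by rewrite /= !restrict_in // /ty => ->; rewrite subrr.
have x0 n : Xi n -> tx z n = 0.
  move=> xn; apply/funext => k; rewrite /tx zE /=; have := congr1 (fun p => p.1.2 k n) e.
  by rewrite /= !restrict_in // /tx !fctE => ->; rewrite subrr.
have u0 n : OmB n -> tu z n = 0.
  move=> On; rewrite /tu zE /=; have := congr1 (fun p => p.2 n) e.
  by rewrite /= !restrict_in // /tu => ->; rewrite subrr.
apply/funext => n; apply/eqP; rewrite -subr_eq0 -zE; apply/eqP.
rewrite [z n]surjective_pairing [(z n).1]surjective_pairing.
rewrite -/(tu z n) -/(tx z n) -/(ty z n).
have [On|nO] := pselect (OmB n).
  by have [-> ->] := traj_fwd0 trd x0 u0 On; rewrite u0.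
by have [-> ->] := traj_bwd0 trd x0 y0 nO; rewrite y0.
Qed.

Let hell2 (W : lmodType R[i]) (A : set (Zd d)) (H : hspace W) :
  is_hilbert H -> is_hilbert (ell2 A H).
Proof. by move=> hH; apply: hdsum_hilbert. Qed.

Let hX2 : is_hilbert (hdsum setT (fun k => ell2 Xi (Y k))).
Proof. by apply: hdsum_fin_hilbert => k; apply: hell2. Qed.

Lemma spaceTOm_hilbert : is_hilbert TOm.
Proof. apply: hprod_hilbert; last exact: hell2.
by apply: hprod_hilbert; [exact: hell2|exact: hX2]. Qed.

Lemma spaceTOm_hset t : hset TOm t <-> [/\ hset (ell2 (~` OmB) Es) t.1.1,
  forall k, hset (ell2 Xi (Y k)) (t.1.2 k) & hset (ell2 OmB E) t.2].
Proof.
split=> [[[h1 /stateP h2] h3]|[h1 h2 h3]]; first by [].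
by split=> //; split=> //; apply/stateP.
Qed.

Lemma sqsum_state (f : Zd d -> VX) A : (forall n, hset X (f n)) ->
  sqsum A X f = (\sum_k sqsum A (Y k) (fun n => f n k))%E.
Proof.
move=> hf; rewrite /sqsum -esum_sum; last by move=> *; rewrite lee_fin sqr_ge0.
apply: eq_esum => n _; rewrite sumEFin sqr_hnorm_hdsum_fin //.
by have := hf n; move/stateP.
Qed.

Lemma sqsum_state_lty (f : Zd d -> VX) A : (forall n, hset X (f n)) ->
  (sqsum A X f < +oo)%E <-> forall k, (sqsum A (Y k) (fun n => f n k) < +oo)%E.
Proof.
move=> hf; rewrite sqsum_state //; split=> [h k|h].
  apply: le_lt_trans h; rewrite (bigD1 k) //= leeDl //.
  by apply: sume_ge0 => i _; apply: sqsum_ge0.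
by apply: lte_sum_pinfty => k _; apply: h.
Qed.

(** Defined without admissibility, so that invariance under shifts can be
    proved first and admissibility of shifted trajectories deduced from it. *)
Definition tnorm2 (xi : VT) : \bar R :=
  (sqsum OmB E (tu xi) + sqsum Xi X (tx xi) + sqsum (~` OmB) Es (ty xi))%E.

Lemma admissible_tnorm2 xi : admissible E Es U xi <-> (tnorm2 xi < +oo)%E.
Proof.
have g1 := sqsum_ge0 OmB E (tu xi); have g2 := sqsum_ge0 Xi X (tx xi).
have g3 := sqsum_ge0 (~` OmB) Es (ty xi).
split=> [[h1 h2 h3]|h]; first by rewrite /tnorm2 !lte_add_pinfty.
split; apply: le_lt_trans h; rewrite /tnorm2 -/(sqsum _ _ _).
- by rewrite -addeA leeDl // adde_ge0.
- by rewrite addeAC leeDr // adde_ge0.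
- by rewrite leeDr // adde_ge0.
Qed.

Lemma PhiOm_hset xi : traj xi -> hset TOm (PhiOm xi) <-> hset T xi.
Proof.
move=> tr; have h n := traj_hset n tr.
have hu n : hset E (tu xi n) by case: (h n).
have hx n : hset X (tx xi n) by case: (h n).
have hy n : hset Es (ty xi n) by case: (h n).
have hxk n k : hset (Y k) (tx xi n k) by have := hx n; move/stateP.
rewrite spaceTOm_hset /=; split=> [[h1 h2 h3]|[_ [h1 h2 h3]]].
  split=> //; split.
  - by apply/(ell2_restrict OmB (H := E) hu).
  - by apply/(sqsum_state_lty Xi hx) => k; apply/(ell2_restrict Xi (H := Y k)).
  - by apply/(ell2_restrict (~` OmB) (H := Es) hy).
split.
- by apply/(ell2_restrict (~` OmB) (H := Es) hy).
- by move=> k; apply/(ell2_restrict Xi (H := Y k)) => //; apply: (sqsum_state_lty Xi hx).1.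
- by apply/(ell2_restrict OmB (H := E) hu).
Qed.

Lemma PhiOm_hip xi xi' : hset T xi -> hset T xi' ->
  hip TOm (PhiOm xi) (PhiOm xi') = hip T xi xi'.
Proof.
move=> hxi hxi'; have [tr _] := hxi; have [tr' _] := hxi'.
have /spaceTOm_hset[_ hk _] := (PhiOm_hset tr).2 hxi.
have /spaceTOm_hset[_ hk' _] := (PhiOm_hset tr').2 hxi'.
rewrite -[LHS]/(usum (~` OmB) (fun n => hip Es (restrict_to (~` OmB) (ty xi) n)
    (restrict_to (~` OmB) (ty xi') n)) +
  hip (hdsum setT (fun k => ell2 Xi (Y k))) (PhiOm xi).1.2 (PhiOm xi').1.2 +
  usum OmB (fun n => hip E (restrict_to OmB (tu xi) n) (restrict_to OmB (tu xi') n))).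
rewrite (usum_eq (g := fun n => hip Es (ty xi n) (ty xi' n))); last first.
  by move=> n An; rewrite !restrict_in.
rewrite (usum_eq (A := OmB) (g := fun n => hip E (tu xi n) (tu xi' n))); last first.
  by move=> n An; rewrite !restrict_in.
rewrite hdsum_fin_hip.
have -> : \sum_k hip (ell2 Xi (Y k)) ((PhiOm xi).1.2 k) ((PhiOm xi').1.2 k) =
    usum Xi (fun n => hip X (tx xi n) (tx xi' n)).
  apply/esym/usumE; apply: has_usum_eq; last first.
    apply: has_usum_sum => k.
    by apply: (hdsum_has_usum (H := fun=> Y k)) => //; [exact: hk|exact: hk'].
  move=> n xn; rewrite hdsum_fin_hip; apply: eq_bigr => k _ /=.
  by rewrite !restrict_in.
by rewrite addrC [X in _ + X]addrC addrA.
Qed.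

(** States at level j computed forwards from the data, and states at level - j
    computed backwards with the inverse of U. *)
Fixpoint xfwd (t : VOm) (j : nat) (n : Zd d) : VX :=
  if j is i.+1 then
    fun k => (cmap U (xfwd t i (n - evec k), t.2 (n - evec k))).1 k
  else fun k => t.1.2 k n.

Fixpoint xbwd (t : VOm) (j : nat) (n : Zd d) : VX :=
  if j is i.+1 then (cmap U' ((fun k => xbwd t i (n + evec k) k), t.1.1 n)).1
  else fun k => t.1.2 k n.

(** At level Negz j, that is - (j + 1), the state and the input are obtained
    together by inverting U on the next state and the given output. *)
Definition ext (t : VOm) : VT := fun n =>
  match lev n with
  | Posz j => (t.2 n, xfwd t j n, (cmap U (xfwd t j n, t.2 n)).2)
  | Negz j =>
      let p := cmap U' ((fun k => xbwd t j (n + evec k) k), t.1.1 n) in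
      (p.2, p.1, t.1.1 n)
  end.

Section Ext.
Variable t : VOm.
Hypothesis ht : hset TOm t.

Let ell2_hset (W : lmodType R[i]) (A : set (Zd d)) (H : hspace W) f n :
  is_hilbert H -> hset (ell2 A H) f -> hset H (f n).
Proof.
move=> hH [h f0 _]; have [An|nA] := pselect (A n); first exact: h.
by rewrite f0 //; hs.
Qed.

Let hes n : hset Es (t.1.1 n).
Proof. by have /spaceTOm_hset[h _ _] := ht; apply: ell2_hset h. Qed.
Let he n : hset E (t.2 n).
Proof. by have /spaceTOm_hset[_ _ h] := ht; apply: ell2_hset h. Qed.
Let hx n : hset X (fun k => t.1.2 k n).
Proof.
have /spaceTOm_hset[_ h _] := ht; apply/stateP => k.
by apply: (ell2_hset n (hY k) (h k)).
Qed.

Let xfwd_hset j n : hset X (xfwd t j n).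
Proof.
elim: j n => [|j IH] n; first exact: hx.
apply/stateP => k /=; have [+ _] := cmap_hset hU (IH (n - evec k)) (he (n - evec k)).
by move/stateP; apply.
Qed.

Let xbwd_hset j n : hset X (xbwd t j n).
Proof.
elim: j n => [|j IH] n; first exact: hx.
have hb : hset X (fun k => xbwd t j (n + evec k) k).
  by apply/stateP => k; have := IH (n + evec k); move/stateP.
by have [] := cmap_hset hU' hb (hes n).
Qed.

Let xbwd_next j n : hset X (fun k => xbwd t j (n + evec k) k).
Proof. by apply/stateP => k; have := xbwd_hset j (n + evec k); move/stateP. Qed.

Lemma ext_traj : traj (ext t).
Proof.
apply: traj_of_step => n.
  rewrite /tu /tx /ty /ext; case: (lev n) => j.
    have [_ h] := cmap_hset hU (xfwd_hset j n) (he n).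
    by split; [exact: he|exact: xfwd_hset|exact: h].
  have [h1 h2] := cmap_hset hU' (xbwd_next j n) (hes n).
  by split; [exact: h2|exact: h1|exact: hes].
case en : (lev n) => [j|j].
  have -> : (tx (ext t) n, tu (ext t) n) = (xfwd t j n, t.2 n).
    by rewrite /tx /tu /ext en.
  rewrite [LHS]surjective_pairing; congr (_, _); last by rewrite /ty /ext en.
  apply/funext => k; have enk : lev (n + evec k) = j.+1 by rewrite levE en; lia.
  by rewrite /tx /ext enk /= addrK.
have -> : (tx (ext t) n, tu (ext t) n) =
    cmap U' ((fun k => xbwd t j (n + evec k) k), t.1.1 n).
  by rewrite /tx /tu /ext en /= -surjective_pairing.
rewrite (dual_cmapK hU); last by split; [exact: xbwd_next|exact: hes].
congr (_, _); last by rewrite /ty /ext en.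
apply/funext => k; rewrite /tx /ext.
case: j en => [|j] en.
  by have -> : lev (n + evec k) = 0 by rewrite levE en; lia.
by have -> : lev (n + evec k) = Negz j by rewrite levE en; lia.
Qed.

Lemma PhiOm_ext : PhiOm (ext t) = t.
Proof.
have /spaceTOm_hset[[_ z1 _] h2 [_ z3 _]] := ht.
rewrite [RHS]surjective_pairing [t.1]surjective_pairing; congr (_, _, _).
- apply/funext => n; have [nO|On] := pselect (~ OmB n).
    rewrite restrict_in // /ty /ext; move: nO; rewrite OmegaB_lev.
    by case: (lev n) => j // h; case: h.
  by rewrite restrict_out // z1.
- apply/funext => k; apply/funext => n; have [_ z2 _] := h2 k.
  have [xn|nx] := pselect (Xi n); last by rewrite restrict_out // z2.
  by rewrite restrict_in // /tx /ext; move: xn => /Xi_lev ->.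
- apply/funext => n; have [On|nO] := pselect (OmB n).
    rewrite restrict_in // /tu /ext; move: On; rewrite OmegaB_lev.
    by case: (lev n) => j.
  by rewrite restrict_out // z3.
Qed.

Lemma ext_hset : hset T (ext t).
Proof. by apply/(PhiOm_hset ext_traj); rewrite PhiOm_ext. Qed.

End Ext.

Lemma ext_unitary : unitary TOm T ext.
Proof.
have hTOm := spaceTOm_hilbert; split.
- exact: ext_hset.
- move=> a s t hs' ht; apply: PhiOm_inj.
  + by apply: ext_traj; apply: hsetZD.
  + by apply: traj_linear.2; apply: ext_traj.
  + by rewrite PhiOm_linear !PhiOm_ext //; apply: hsetZD.
- move=> xi hxi; have [tr _] := hxi; have hp := (PhiOm_hset tr).2 hxi.
  exists (PhiOm xi) => //; apply: PhiOm_inj => //; first exact: ext_traj.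
  exact: PhiOm_ext.
- by move=> s t hs' ht; rewrite -PhiOm_hip ?PhiOm_ext //; apply: ext_hset.
Qed.

Lemma spaceT_hilbert : is_hilbert T.
Proof. exact: (unitary_hilbert ext_unitary spaceTOm_hilbert). Qed.

Lemma PhiOm_unitary : unitary T TOm (@PhiOm R d VE VEs V).
Proof.
split.
- by move=> xi hxi; have [tr _] := hxi; apply/(PhiOm_hset tr).
- by move=> a x y _ _; exact: PhiOm_linear.
- by move=> t ht; exists (ext t); [exact: ext_hset|exact: PhiOm_ext].
- exact: PhiOm_hip.
Qed.

Lemma spaceT_hip xi : hset T xi -> hip T xi xi = (fine (tnorm2 xi))%:C.
Proof.
move=> [tr adm]; have h n := traj_hset n tr; case: (adm) => h1 h2 h3.
rewrite -[LHS]/(usum OmB (fun n => hip E (tu xi n) (tu xi n))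
  + usum Xi (fun n => hip X (tx xi n) (tx xi n))
  + usum (~` OmB) (fun n => hip Es (ty xi n) (ty xi n))).
rewrite !usum_sqsum //; try by move=> n; case: (h n).
have f1 : sqsum OmB E (tu xi) \is a fin_num by rewrite ge0_fin_numE ?sqsum_ge0.
have f2 : sqsum Xi X (tx xi) \is a fin_num by rewrite ge0_fin_numE ?sqsum_ge0.
have f3 : sqsum (~` OmB) Es (ty xi) \is a fin_num by rewrite ge0_fin_numE ?sqsum_ge0.
by rewrite -!rmorphD /tnorm2 !fineD ?fin_numD ?f1 ?f2.
Qed.

(* Conservation of energy at one point: U preserves the norm of (x(n), u(n)). *)
Let sq_step xi n : traj xi -> hnorm E (tu xi n) ^+ 2 + hnorm X (tx xi n) ^+ 2 =
  hnorm Es (ty xi n) ^+ 2 + \sum_k hnorm (Y k) (tx xi (n + evec k) k) ^+ 2.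
Proof.
move=> tr; have [h1 h2 h3] := traj_hset n tr.
have := unitary_hnorm uU (hset_pair h2 h1); rewrite traj_step // => e.
have hn : hset X (fun k => tx xi (n + evec k) k).
  by apply/stateP => k; have [_ + _] := traj_hset (n + evec k) tr; move/stateP.
have := congr1 (fun r => r ^+ 2) e; rewrite /= !hnorm_hprod // => e2.
rewrite addrC -e2 addrC sqr_hnorm_hdsum_fin //.
by move/stateP: hn.
Qed.

Let esum_shift (A B : set (Zd d)) m (a : Zd d -> \bar R) : (forall n, A n <-> B (n + m)) ->
  (\esum_(n in B) a n = \esum_(n in A) a (n + m)%R)%E.
Proof.
move=> AB; apply: reindex_esum; split.
- by move=> n /AB.
- by move=> n n' _ _; exact: addIr.
- by move=> n Bn; exists (n - m); rewrite ?subrK //; apply/AB; rewrite subrK.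
Qed.

Let level j : set (Zd d) := [set n | lev n = j].

(** The shift exchanges the boundary at level 0 for the one at level -1. The
    data on the two boundaries have the same energy since U preserves norms at
    every point of level -1. *)
Lemma tnorm2_shift k xi : traj xi -> tnorm2 (Tshift k xi) = tnorm2 xi.
Proof.
move=> tr; pose below : set (Zd d) := [set n | lev n < -1].
pose a n := (hnorm E (tu xi n) ^+ 2)%:E.
pose b n := (hnorm X (tx xi n) ^+ 2)%:E; pose c n := (hnorm Es (ty xi n) ^+ 2)%:E.
have a0 n : (0 <= a n)%E by rewrite lee_fin sqr_ge0.
have b0 n : (0 <= b n)%E by rewrite lee_fin sqr_ge0.
have c0 n : (0 <= c n)%E by rewrite lee_fin sqr_ge0.
have eu : sqsum OmB E (tu (Tshift k xi)) =
    (\esum_(n in OmB) a n + \esum_(n in level (-1)%R) a n)%E.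
  rewrite [LHS](@esum_shift [set n | -1 <= lev n] _ (evec k)); last first.
    by move=> n; rewrite OmegaB_lev levE /=; split; lia.
  rewrite (esumID OmB); last by move=> *; rewrite lee_fin sqr_ge0.
  congr (_ + _)%E.
    have -> : [set n | -1 <= lev n] `&` OmB = OmB.
      by apply/seteqP; split=> [n []//|n On]; split=> //; move/OmegaB_lev: On => /=; lia.
    by apply: eq_esum => n _; rewrite /tu /Tshift addrK.
  have -> : [set n | -1 <= lev n] `&` ~` OmB = level (-1)%R.
    apply/seteqP; split=> [n [/= l1 nO]|n /= ln].
      by rewrite /level /=; have : ~ (0 <= lev n) by []; lia.
    by split; rewrite /= ?ln // OmegaB_lev ln.
  by apply: eq_esum => n _; rewrite /tu /Tshift addrK.
have ex : sqsum Xi X (tx (Tshift k xi)) = (\esum_(n in level (-1)%R) b n)%E.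
  rewrite [LHS](@esum_shift (level (-1)%R) _ (evec k)); last first.
    by move=> n; rewrite Xi_lev levE /level /=; split; lia.
  by apply: eq_esum => n _; rewrite /tx /Tshift addrK.
have ey : sqsum (~` OmB) Es (ty (Tshift k xi)) = (\esum_(n in below) c n)%E.
  rewrite [LHS](@esum_shift below _ (evec k)); last first.
    by move=> n; rewrite /below /= OmegaB_lev levE; split; lia.
  by apply: eq_esum => n _; rewrite /ty /Tshift addrK.
have ec : sqsum (~` OmB) Es (ty xi) =
    (\esum_(n in below) c n + \esum_(n in level (-1)%R) c n)%E.
  rewrite [LHS](esumID below); last by move=> *; rewrite lee_fin sqr_ge0.
  congr (_ + _)%E.
    congr (esum _ _); apply/seteqP; split=> [n []//|n ln].
    by split=> //; move: ln; rewrite /below /= OmegaB_lev; lia.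
  congr (esum _ _); apply/seteqP; split=> n; rewrite /below /level /setI /setC /=.
    by rewrite OmegaB_lev => -[]; lia.
  by rewrite OmegaB_lev => ->.
have cross : (\esum_(n in level (-1)%R) a n + \esum_(n in level (-1)%R) b n =
    \esum_(n in level (-1)%R) c n + sqsum Xi X (tx xi))%E.
  rewrite -esumD // sqsum_state; last by move=> n; case: (traj_hset n tr).
  have -> : (\sum_j sqsum Xi (Y j) (fun n => tx xi n j) =
      \esum_(n in level (-1)%R) \sum_j (hnorm (Y j) (tx xi (n + evec j) j) ^+ 2)%:E)%E.
    rewrite esum_sum; last by move=> *; rewrite lee_fin sqr_ge0.
    apply: eq_bigr => j _; apply: esum_shift => n.
    by rewrite Xi_lev levE /level /=; split; lia.
  rewrite -esumD //; last by move=> n _; apply: sume_ge0 => j _; rewrite lee_fin sqr_ge0.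
  apply: eq_esum => n _; rewrite /a /b /c sumEFin -!EFinD.
  by rewrite (sq_step n tr).
rewrite /tnorm2 eu ex ey ec -/(sqsum OmB E (tu xi)).
rewrite -!addeA; congr (_ + _)%E; rewrite addeA cross.
by rewrite addeAC addeC [X in (_ + X)%E]addeC.
Qed.

Definition Tback k (xi : VT) : VT := fun n => xi (n + evec k).

Lemma Tback_shift k xi : Tshift k (Tback k xi) = xi.
Proof. by apply/funext => n; rewrite /Tshift /Tback subrK. Qed.

Lemma Tshift_hset k xi : hset T xi -> hset T (Tshift k xi).
Proof.
move=> [tr adm]; split; first exact: (traj_shift (- evec k)).
by apply/admissible_tnorm2; rewrite tnorm2_shift //; apply/admissible_tnorm2.
Qed.

Lemma Tback_hset k xi : hset T xi -> hset T (Tback k xi).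
Proof.
move=> [tr adm]; have tr' := traj_shift (evec k) tr; split=> //.
by apply/admissible_tnorm2; rewrite -(tnorm2_shift k tr') Tback_shift; apply/admissible_tnorm2.
Qed.

Lemma Tshift_unitary k : unitary T T (Tshift k).
Proof.
apply: (unitary_of_norm spaceT_hilbert spaceT_hilbert) => //.
- exact: Tshift_hset.
- by move=> xi hxi; exists (Tback k xi); [exact: Tback_hset|exact: Tback_shift].
- move=> xi hxi; have [tr _] := hxi; rewrite !spaceT_hip ?tnorm2_shift //.
  exact: Tshift_hset.
Qed.

Lemma Tshift_adj k xi : hset T xi -> adj T T (Tshift k) xi = Tback k xi.
Proof.
move=> hxi; rewrite (unitary_adj (Tshift_unitary k) spaceT_hilbert hxi).
have hb := Tback_hset k hxi.
by rewrite -{1}(Tback_shift k xi) (uinvK (Tshift_unitary k) spaceT_hilbert hb).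
Qed.

End Trajectories.

(** * Scattering systems *)

Section ClosedIntersections.
Variables (R : realType) (V : lmodType R[i]) (H : hspace V).
Hypothesis hH : is_hilbert H.

Lemma closed_setI M N : closed_subspace H M -> closed_subspace H N ->
  closed_subspace H (M `&` N).
Proof.
move=> [sM [M0 lM] cM] [sN [N0 lN] cN]; split.
- by move=> x [/sM].
- by split=> // a x y [Mx Nx] [My Ny]; split; [exact: lM|exact: lN].
- move=> u l hu hl cu; split.
    by apply: cM hl cu => n; case: (hu n).
  by apply: cN hl cu => n; case: (hu n).
Qed.

(** A kernel is the orthogonal complement of the range of the adjoint. *)
Lemma kernels_closed (W : lmodType R[i]) (H2 : hspace W) (J : Type)
    (P : J -> Prop) (T : J -> V -> W) : is_hilbert H2 ->
  (forall j, P j -> bounded_op H H2 (T j)) ->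
  closed_subspace H [set x | hset H x /\ forall j, P j -> T j x = 0].
Proof.
move=> hH2 bT.
pose G := [set x | exists j y, [/\ P j, hset H2 y & x = adj H H2 (T j) y]].
have -> : [set x | hset H x /\ forall j, P j -> T j x = 0] = perp H G.
  apply/seteqP; split=> x /= [hx hT]; split=> //.
    move=> _ [j [y [Pj hy ->]]]; rewrite (adj_hip hH hH2 (bT j Pj)) //.
    by rewrite hT // (hip0l hH2).
  move=> j Pj; have bj := bT j Pj; have hTx := bounded_hset bj hx.
  apply: (hip_eq0 hH2) => //; rewrite -(adj_hip hH hH2 bj) //.
  by apply: hT; exists j, (T j x).
apply: (perp_closed hH) => _ [j [y [Pj hy ->]]].
exact: (adj_hset hH hH2 (bT j Pj)).
Qed.

End ClosedIntersections.

Section SingleTerm.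
Variables (R : realType) (I : choiceType).

Lemma usum1 (A : set I) (f : I -> R[i]) i : A i ->
  (forall j, A j -> j <> i -> f j = 0) -> usum A f = f i.
Proof.
move=> Ai f0; apply: usumE => e e0; exists [set i].
  by split=> [|j ->]; first exact: finite_set1.
move=> F [fF FA] iF; rewrite -(fsbig_widen [set i] F) //.
  by rewrite fsbig_set1 subrr Normc.normc0.
by move=> j [Fj ji]; apply: f0; [exact: FA|].
Qed.

End SingleTerm.

Section Transfer.
Variables (R : realType) (W W' : lmodType R[i]) (H : hspace W) (H' : hspace W').
Variables (T : W -> W) (T' : W' -> W') (tau : W -> W').
Hypothesis (hH : is_hilbert H) (uT : unitary H H T) (ut : unitary H H' tau).
Hypothesis inter : forall x, hset H x -> T' (tau x) = tau (T x).

Lemma conj_unitary : unitary H' H' T'.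
Proof.
have [ht lt st it] := ut; have [hT lT sT iT] := uT; split.
- by move=> y /st[x hx <-]; rewrite inter //; apply: ht; apply: hT.
- move=> a y z /st[x hx <-] /st[x' hx' <-].
  by rewrite -lt // !inter // ?lT ?lt //; [exact: hT|exact: hT|hs].
- move=> y /st[x hx <-]; have [z hz <-] := sT _ hx.
  by exists (tau z); [exact: ht|exact: inter].
- move=> y z /st[x hx <-] /st[x' hx' <-]; rewrite !inter // !it ?iT //; exact: hT.
Qed.

Lemma conj_adj x : hset H x -> adj H' H' T' (tau x) = tau (adj H H T x).
Proof.
move=> hx; have hH' := unitary_hilbert ut hH.
rewrite (unitary_adj uT hH hx).
rewrite (unitary_adj conj_unitary hH' (unitary_hset ut hx)).
have [hz {1}<-] := uinvP uT hx; rewrite -inter //.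
by rewrite (uinvK conj_unitary hH' (unitary_hset ut hz)).
Qed.

End Transfer.

Section SystemTransfer.
Variables (R : realType) (d : nat) (W W' : lmodType R[i]).
Variables (s : scattering_data d W) (s' : scattering_data d W') (tau : W -> W').
Local Notation H := (sK s).
Local Notation H' := (sK s').
Hypothesis hs_ : scattering_system s.
Hypothesis ut : unitary H H' tau.
Hypothesis inter : forall k x, hset H x -> sU s' k (tau x) = tau (sU s k x).
Hypothesis hF : sF s' = [set tau x | x in sF s].
Hypothesis hFs : sFs s' = [set tau x | x in sFs s].

Let hH : is_hilbert H. Proof. by case: hs_. Qed.
Let uU k : unitary H H (sU s k). Proof. by case: hs_. Qed.

Let zpower_transfer k p x : hset H x -> hset H (zpower s (sU s k) p x) /\
  zpower s' (sU s' k) p (tau x) = tau (zpower s (sU s k) p x).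
Proof.
have iterP (T : W -> W) (T' : W' -> W') : (forall x, hset H x -> hset H (T x)) ->
    (forall x, hset H x -> T' (tau x) = tau (T x)) ->
    forall j, hset H x -> hset H (iter j T x) /\ iter j T' (tau x) = tau (iter j T x).
  move=> hT hi j hx; elim: j => [|j [IH1 IH2]] //=.
  by rewrite IH2 hi //; split=> //; apply: hT.
case: p => j; apply: iterP.
- exact: unitary_hset (uU k).
- exact: inter.
- by move=> y hy; rewrite (unitary_adj (uU k) hH hy); case: (uinvP (uU k) hy).
- by move=> y hy; apply: (conj_adj hH (uU k) ut) => //; apply: inter.
Qed.

Lemma Upow_transfer n x : hset H x ->
  hset H (Upow s n x) /\ Upow s' n (tau x) = tau (Upow s n x).
Proof.
move: x; rewrite /Upow.
pose P (f' : W' -> W') (f : W -> W) := forall x, hset H x ->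
  hset H (f x) /\ f' (tau x) = tau (f x).
apply: (big_rec2 P) => [//|k f' f _ IH x hx] /=.
have [h1 h2] := IH x hx; have [h3 h4] := zpower_transfer k (n 0 k) h1.
by rewrite h2.
Qed.

Lemma scattering_system_transfer : scattering_system s'.
Proof.
have [_ _ com [cF wF] [cFs wFs]] := hs_; have hH' := unitary_hilbert ut hH.
have st := let: And4 _ _ st _ := ut in st.
have wan F : closed_subspace H F -> wandering s F -> wandering s' [set tau x | x in F].
  move=> [sF _ _] wF' n _ _ n0 [f Ff <-] [g Fg <-].
  have hf := sF _ Ff; have hg := sF _ Fg; have [hn ->] := Upow_transfer n hf.
  by rewrite (unitary_hip ut hn hg) wF'.
split=> //.
- by move=> k; apply: (conj_unitary hH (uU k) ut) => // x; apply: inter.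
- move=> j k y /st[x hx <-]; have hU l z : hset H z -> hset H (sU s l z).
    exact: (unitary_hset (uU l)).
  rewrite (inter k hx) (inter j hx) (inter j (hU k _ hx)) (inter k (hU j _ hx)).
  by rewrite com.
- by rewrite hF; split; [exact: (unitary_image_closed hH hH' ut)|exact: wan].
- by rewrite hFs; split; [exact: (unitary_image_closed hH hH' ut)|exact: wan].
Qed.

End SystemTransfer.

Section Systems.
Variables (R : realType) (d : nat) (VE VEs V : lmodType R[i]).
Variables (E : hspace VE) (Es : hspace VEs) (U : colligation d V VE VEs).
Hypothesis (hE : is_hilbert E) (hEs : is_hilbert Es) (hU : GR_unitary E Es U).
Local Notation X := (state U).
Local Notation Y := (cspace U).
Local Notation VX := ('I_d.+1 -> V).
Local Notation VT := (Zd d -> (VE * VX * VEs)%type).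
Local Notation VOm := ((Zd d -> VEs) * ('I_d.+1 -> Zd d -> V) * (Zd d -> VE))%type.
Local Notation OmB := (@OmegaB d).
Local Notation Xi := (@Xi d).
Local Notation T := (spaceT E Es U).
Local Notation TOm := (spaceTOm E Es U).
Local Notation ST := (system_T E Es U).
Local Notation SOm := (system_Om E Es U).
Local Notation Phi := (@PhiOm R d VE VEs V).
Local Open Scope complex_scope.

Let hT : is_hilbert T := spaceT_hilbert hE hEs hU.
Let hTOm : is_hilbert TOm := spaceTOm_hilbert hE hEs hU.
Let uPhi : unitary T TOm Phi := PhiOm_unitary hE hEs hU.
Let hXX : is_hilbert X := state_hilbert hU.
Let uS k : unitary T T (Tshift k) := Tshift_unitary hE hEs hU k.

Lemma tnorm_ge (W : lmodType R[i]) (A : set (Zd d)) (H : hspace W) f n xi :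
  hset T xi -> (sqsum A H f <= tnorm2 E Es U xi)%E -> A n ->
  hnorm H (f n) <= hnorm T xi.
Proof.
move=> hxi le An; rewrite -(@ler_pXn2r _ 2) ?nnegrE ?hnorm_ge0 //.
rewrite (sqr_hnorm hT hxi) (spaceT_hip hE hEs hU hxi) Re_ReC.
rewrite -lee_fin fineK; first exact: le_trans (sqsum_sub _ _ An) le.
have [_ /admissible_tnorm2 lt] := hxi; rewrite ge0_fin_numE //.
by rewrite /tnorm2 !adde_ge0 ?sqsum_ge0.
Qed.

Lemma bounded_tu n : OmB n -> bounded_op T E (fun xi => tu xi n).
Proof.
move=> On; split=> //.
  by move=> xi [tr _]; case: (traj_hset n tr).
exists 1 => xi hxi; rewrite mul1r; apply: (tnorm_ge hxi _ On).
by rewrite /tnorm2 -addeA leeDl // adde_ge0 ?sqsum_ge0.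
Qed.

Lemma bounded_tx n : Xi n -> bounded_op T X (fun xi => tx xi n).
Proof.
move=> xn; split=> //.
  by move=> xi [tr _]; case: (traj_hset n tr).
exists 1 => xi hxi; rewrite mul1r; apply: (tnorm_ge hxi _ xn).
by rewrite /tnorm2 addeAC leeDr // adde_ge0 ?sqsum_ge0.
Qed.

Lemma bounded_ty n : ~ OmB n -> bounded_op T Es (fun xi => ty xi n).
Proof.
move=> nO; split=> //.
  by move=> xi [tr _]; case: (traj_hset n tr).
exists 1 => xi hxi; rewrite mul1r; apply: (tnorm_ge (A := ~` OmB) hxi _ nO).
by rewrite /tnorm2 leeDr // adde_ge0 ?sqsum_ge0.
Qed.

Lemma closed_prescribed (P Q O : set (Zd d)) :
  P `<=` OmB -> Q `<=` Xi -> O `<=` ~` OmB ->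
  closed_subspace T [set xi | [/\ hset T xi, forall n, P n -> tu xi n = 0,
    forall n, Q n -> tx xi n = 0 & forall n, O n -> ty xi n = 0]].
Proof.
move=> sP sQ sO.
have cu := kernels_closed hT hE (fun n Pn => bounded_tu (sP n Pn)).
have cx := kernels_closed hT hXX (fun n Qn => bounded_tx (sQ n Qn)).
have cy := kernels_closed hT hEs (fun n On => bounded_ty (sO n On)).
have := closed_setI cu (closed_setI cx cy); congr closed_subspace.
by apply/seteqP; split=> xi /=; [case=> -[h1 h2] [[_ h3] [_ h4]]|case=> h1 h2 h3 h4].
Qed.

Lemma TF_closed : closed_subspace T (TF E Es U).
Proof.
have := @closed_prescribed [set n | OmB n /\ n <> 0] Xi (~` OmB).
have -> : [set xi | [/\ hset T xi, forall n, OmB n /\ n <> 0 -> tu xi n = 0,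
    forall n, Xi n -> tx xi n = 0 & forall n, (~` OmB) n -> ty xi n = 0]] = TF E Es U.
  apply/seteqP; split=> xi /= [h1 h2 h3 h4]; split=> // n; last by case; apply: h2.
  by move=> On n0; apply: h2.
by apply=> // n [].
Qed.

Lemma TFs0_closed : closed_subspace T (TFs0 E Es U).
Proof.
have := @closed_prescribed OmB Xi [set n | ~ OmB n /\ n <> - evec ord0].
have -> : [set xi | [/\ hset T xi, forall n, OmB n -> tu xi n = 0,
    forall n, Xi n -> tx xi n = 0 & forall n, ~ OmB n /\ n <> - evec ord0 -> ty xi n = 0]]
    = TFs0 E Es U.
  apply/seteqP; split=> xi /= [h1 h2 h3 h4]; split=> // n; last by case; apply: h4.
  by move=> On n0; apply: h4.
by apply=> // n [].
Qed.

(** Backward uniqueness: the data that vanish are those which determine the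
    past. *)
Lemma TF_supp xi n : TF E Es U xi -> [/\ n <> 0 -> tu xi n = 0,
  lev n <= 0 -> tx xi n = 0 & ~ OmB n -> ty xi n = 0].
Proof.
move=> [[tr _] u0 x0 y0]; split=> //.
  have [On|nO] := pselect (OmB n); first exact: u0.
  by have [] := traj_bwd0 hE hEs hU tr x0 y0 nO.
move=> le; have [/Xi_lev|nx] := pselect (Xi n); first exact: x0.
have nO : ~ OmB n by move: nx; rewrite OmegaB_lev Xi_lev; lia.
  by have [] := traj_bwd0 hE hEs hU tr x0 y0 nO.
exact: y0.
Qed.

(** Forward uniqueness: the data that vanish are those which determine the
    future. *)
Lemma TFs0_supp xi n : TFs0 E Es U xi -> [/\ n <> - evec ord0 -> ty xi n = 0,
  OmB n -> tx xi n = 0 & OmB n -> tu xi n = 0].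
Proof.
move=> [[tr _] u0 x0 y0]; split=> //.
  have [On|nO] := pselect (OmB n); last exact: y0.
  by have [] := traj_fwd0 hE hU tr x0 u0 On.
  by move=> On; have [] := traj_fwd0 hE hU tr x0 u0 On.
exact: u0.
Qed.

Definition Tmove (v : Zd d) (xi : VT) : VT := fun m => xi (m - v).

Let zpowerE k p xi : hset T xi -> hset T (zpower ST (Tshift k) p xi) /\
  zpower ST (Tshift k) p xi = Tmove (p *: evec k) xi.
Proof.
have sc (j : nat) : j.+1%:Z *: evec k = j%:Z *: evec k + evec k :> Zd d.
  by rewrite intS scalerDl scale1r addrC.
move=> hxi; case: p => j /=.
  elim: j => [|j [IH1 IH2]] /=; last split.
  - by split=> //; apply/funext => m; rewrite /Tmove scale0r subr0.
  - exact: (Tshift_hset hE hEs hU).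
  - by rewrite IH2; apply/funext => m; rewrite /Tshift /Tmove sc opprD addrA addrAC.
have e i : iter i (adj T T (Tshift k)) xi = Tmove (- (i%:Z *: evec k)) xi /\
    hset T (iter i (adj T T (Tshift k)) xi).
  elim: i => [|i [IH1 IH2]] /=.
    by split=> //; apply/funext => m; rewrite /Tmove scale0r oppr0 subr0.
  rewrite (Tshift_adj hE hEs hU k IH2); split; last exact: (Tback_hset hE hEs hU).
  rewrite IH1; apply/funext => m; rewrite /Tback /Tmove sc !opprK.
  by rewrite addrA addrAC.
by have [e1 e2] := e j.+1; split; [exact: e2|rewrite NegzE scaleNr -e1].
Qed.

Lemma Upow_T n xi : hset T xi -> hset T (Upow ST n xi) /\ Upow ST n xi = Tmove n xi.
Proof.
move=> hxi.
have : hset T (Upow ST n xi) /\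
    Upow ST n xi = Tmove (\sum_k n 0 k *: evec k) xi.
  move: xi hxi; rewrite /Upow.
  pose P (f : VT -> VT) (v : Zd d) := forall xi, hset T xi ->
    hset T (f xi) /\ f xi = Tmove v xi.
  apply: (big_rec2 P) => [xi hxi|k v f _ IH xi hxi] /=.
    by split=> //; apply/funext => m; rewrite /Tmove subr0.
  have [h1 h2] := IH xi hxi; have [h3 h4] := zpowerE k (n 0 k) h1.
  split=> //; rewrite h4 h2; apply/funext => m; rewrite /Tmove.
  by rewrite opprD addrA.
by rewrite -row_sum_delta.
Qed.

(** Of the data of g only the input at 0 can be nonzero, and the input of U^n
    f at 0 is that of f at - n. *)
Lemma TF_wandering : wandering ST (TF E Es U).
Proof.
move=> n f g n0 Ff Fg; have [hf _ _ _] := Ff; have [_ ->] := Upow_T n hf.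
have [_ gu gx gy] := Fg.
rewrite -[LHS]/(_ + _ + _) !usum0 ?addr0 // => m Am.
- by rewrite gy // (hip0r hEs) //; have [[tr _] _ _ _] := Ff; case: (traj_hset (m - n) tr).
- by rewrite gx // (hip0r hXX) //; have [[tr _] _ _ _] := Ff; case: (traj_hset (m - n) tr).
have [m0|mn0] := pselect (m = 0).
  have [fu _ _] := TF_supp (m - n) Ff; rewrite /tu in fu *; rewrite fu.
    by rewrite (hip0l hE) //; have [[tr _] _ _ _] := Fg; case: (traj_hset m tr).
  by rewrite m0 sub0r => /eqP; rewrite oppr_eq0 (negbTE n0).
by rewrite gu // (hip0r hE) //; have [[tr _] _ _ _] := Ff; case: (traj_hset (m - n) tr).
Qed.

(** The common shift by e_1 may be dropped. Of the data of g only the output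
    at - e_1 can be nonzero, and the output of U^n f there is that of f at -
    e_1 - n. *)
Lemma TFs_wandering : wandering ST (sFs ST).
Proof.
move=> n _ _ n0 [f Ff <-] [g Fg <-]; have [hf _ _ _] := Ff; have [hg gu gx gy] := Fg.
have [_ ->] := Upow_T n (Tshift_hset hE hEs hU ord0 hf).
have [hn en] := Upow_T n hf; rewrite en in hn.
have -> : Tmove n (Tshift ord0 f) = Tshift ord0 (Tmove n f).
  by apply/funext => m; rewrite /Tmove /Tshift addrAC.
rewrite (unitary_hip (uS ord0) hn hg).
have [trf _] := hf; have [trg _] := hg.
rewrite -[LHS]/(_ + _ + _) !usum0 ?addr0 // => m Am.
- have [m0|mn0] := pselect (m = - evec ord0).
    have [fy _ _] := TFs0_supp (m - n) Ff; rewrite /ty in fy *; rewrite fy.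
      by rewrite (hip0l hEs) //; case: (traj_hset m trg).
    rewrite m0 => /eqP; rewrite -subr_eq0 addrAC subrr sub0r oppr_eq0.
    by rewrite (negbTE n0).
  by rewrite gy // (hip0r hEs) //; case: (traj_hset (m - n) trf).
- by rewrite gx // (hip0r hXX) //; case: (traj_hset (m - n) trf).
by rewrite gu // (hip0r hE) //; case: (traj_hset (m - n) trf).
Qed.

Lemma system_T_scattering : scattering_system ST.
Proof.
split=> //.
- by move=> j k x _; apply/funext => n; rewrite /= /Tshift addrAC.
- by split; [exact: TF_closed|exact: TF_wandering].
- split; last exact: TFs_wandering.
  exact: (unitary_image_closed hT hT (uS ord0) TFs0_closed).
Qed.

Let PhiK xi : hset T xi -> uinv T Phi (Phi xi) = xi.
Proof. by move=> h; apply: (uinvK uPhi hT). Qed.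

Lemma sU_Om k xi : hset T xi -> sU SOm k (Phi xi) = Phi (Tshift k xi).
Proof. by move=> h; rewrite -[LHS]/(Phi (Tshift k (uinv T Phi (Phi xi)))) PhiK. Qed.

Lemma system_Om_scattering : scattering_system SOm.
Proof.
apply: (scattering_system_transfer (s' := SOm) system_T_scattering uPhi) => //.
by move=> k xi hxi; apply: sU_Om.
Qed.

Lemma system_Om_equiv : scattering_equiv SOm ST.
Proof.
exists (uinv T Phi); split.
- exact: (unitary_uinv uPhi hT).
- move=> k t ht; have [hx <-] := uinvP uPhi ht.
  rewrite (sU_Om k hx) !PhiK //; exact: (Tshift_hset hE hEs hU).
- apply/seteqP; split=> [_ [_ [f Ff <-] <-]|f Ff].
    by have [hf _ _ _] := Ff; rewrite PhiK.
  by have [hf _ _ _] := Ff; exists (Phi f); [exists f|rewrite PhiK].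
- have hs' f : sFs ST f -> hset T f.
    by move=> [g [hg _ _ _] <-]; exact: (Tshift_hset hE hEs hU).
  apply/seteqP; split=> [_ [_ [f Ff <-] <-]|f Ff].
    by rewrite PhiK //; apply: hs'.
  by exists (Phi f); [exists f|rewrite PhiK //; apply: hs'].
Qed.

(** For n at the boundary the shifted data involve one step of the recursion,
    and elsewhere they are the old data. *)
Lemma PhiOm_back k xi : hset T xi -> Phi (Tback k xi) = model_shift_adj U k (Phi xi).
Proof.
move=> [tr _]; have [_ ex ey] := tr.
rewrite /PhiOm /model_shift_adj; congr (_, _, _).
- apply/funext => n; have [nO|On] := pselect ((~` OmB) n); last first.
    by rewrite !restrict_out.
  rewrite restrict_in // [RHS]restrict_in //; case: asboolP => On.
    have xn : Xi (n + evec k).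
      by move: nO On; rewrite Xi_lev /setC /= !OmegaB_lev levE; lia.
    rewrite /ty /Tback -/(ty xi (n + evec k)) ey restrict_in //; congr (blockC U _ + _).
    by apply/funext => j; rewrite restrict_in.
  by rewrite restrict_in.
- apply/funext => j; apply/funext => n.
  have [xn|nx] := pselect (Xi n); last by rewrite !restrict_out.
  have xn' : Xi (n + evec k - evec j).
    by move: xn; rewrite !Xi_lev levBE levE; lia.
  have On : OmB (n + evec k - evec j) by rewrite OmegaB_lev (Xi_lev _).1.
  rewrite !restrict_in // /tx /Tback -{1}(subrK (evec j) (n + evec k)).
  rewrite -/(tx xi _) ex; congr (blockA U _ j + _).
  by apply/funext => i; rewrite restrict_in.
- apply/funext => n; have [On|nO] := pselect (OmB n); last by rewrite !restrict_out.
  rewrite !restrict_in // OmegaB_lev levE; move: On; rewrite OmegaB_lev; lia.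
Qed.

Lemma system_Om_adj k t : hset TOm t ->
  adj TOm TOm (sU SOm k) t = model_shift_adj U k t.
Proof.
move=> ht; have [hx <-] := uinvP uPhi ht.
rewrite (conj_adj hT (uS k) uPhi (sU_Om k)) //.
by rewrite (Tshift_adj hE hEs hU k hx) PhiOm_back.
Qed.

Let Upow_Om n xi : hset T xi -> Upow SOm n (Phi xi) = Phi (Tmove n xi).
Proof.
move=> hxi; have [_ ->] := Upow_transfer (s' := SOm) system_T_scattering uPhi sU_Om n hxi.
by have [_ ->] := Upow_T n hxi.
Qed.

Definition single (W : lmodType R[i]) (n : Zd d) (w : W) : Zd d -> W :=
  fun m => delta0 (m - n) w.

Lemma single_at (W : lmodType R[i]) n (w : W) : single n w n = w.
Proof. by rewrite /single subrr /delta0 eqxx. Qed.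

Lemma single_off (W : lmodType R[i]) n m (w : W) : m <> n -> single n w m = 0.
Proof. by move=> mn; rewrite /single /delta0 subr_eq0; case: eqP. Qed.

Lemma single_hset (W : lmodType R[i]) (H : hspace W) (A : set (Zd d)) n w :
  is_hilbert H -> A n -> hset H w -> hset (ell2 A H) (single n w).
Proof.
move=> hH An hw; split.
- by move=> m _; apply: hset_delta0.
- by move=> m nA; apply: single_off => mn; rewrite mn in nA.
apply/square_summableP; exists (hnorm H w ^+ 2) => F [fF FA].
rewrite (fsbigID [set n]) //= [X in _ + X]fsbig1 ?addr0; last first.
  by move=> m [_ mn]; rewrite single_off // (hnorm0 hH) expr0n.
have [Fn|nF] := pselect (F n).
  by rewrite (_ : F `&` [set n] = [set n]) ?fsbig_set1 ?single_at //;
    apply/seteqP; split=> [m []//|m ->].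
rewrite (_ : F `&` [set n] = set0) ?fsbig_set0 ?sqr_ge0 //.
by apply/seteqP; split=> m // [Fm mn]; rewrite -mn in nF.
Qed.

(** For n in Omega^B the support of U^n f in the data is the single point n. *)
Lemma Phi_TF n f : OmB n -> TF E Es U f ->
  Upow SOm n (Phi f) = (0, 0, single n (tu f 0)).
Proof.
move=> On Ff; have [hf _ _ _] := Ff; rewrite Upow_Om //; congr (_, _, _).
- apply/funext => m; have [nO|mO] := pselect ((~` OmB) m); last by rewrite restrict_out.
  rewrite restrict_in //; have [_ _ fy] := TF_supp (m - n) Ff.
  rewrite /ty in fy *; rewrite fy //.
  by move: nO On; rewrite /setC /= !OmegaB_lev levD levN; lia.
- apply/funext => k; apply/funext => m.
  have [xm|mx] := pselect (Xi m); last by rewrite restrict_out.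
  rewrite restrict_in //; have [_ fx _] := TF_supp (m - n) Ff.
  rewrite /tx in fx *; rewrite fx //.
  by move: xm On; rewrite Xi_lev OmegaB_lev levD levN; lia.
- apply/funext => m; have [Om|nO] := pselect (OmB m); last first.
    by rewrite restrict_out // single_off // => mn; rewrite mn in nO.
  rewrite restrict_in //; have [-> |mn] := pselect (m = n).
    by rewrite single_at /tu /Tmove subrr.
  rewrite single_off //; have [fu _ _] := TF_supp (m - n) Ff.
  by rewrite /tu in fu *; rewrite fu // => /eqP; rewrite subr_eq0 => /eqP.
Qed.

Lemma Phi_TFs n f : ~ OmB n -> TFs0 E Es U f ->
  Upow SOm n (Phi (Tshift ord0 f)) = (single n (ty f (- evec ord0)), 0, 0).
Proof.
move=> nO Ff; have [hf _ _ _] := Ff.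
rewrite Upow_Om; last exact: (Tshift_hset hE hEs hU).
have lv m : lev (m - n - evec ord0) = lev m - lev n - 1 by rewrite levBE levD levN.
congr (_, _, _).
- apply/funext => m; have [mO|Om] := pselect ((~` OmB) m); last first.
    by rewrite restrict_out // single_off // => mn; rewrite mn in Om.
  rewrite restrict_in //; have [-> |mn] := pselect (m = n).
    by rewrite single_at /ty /Tmove /Tshift subrr sub0r.
  rewrite single_off //; have [fy _ _] := TFs0_supp (m - n - evec ord0) Ff.
  rewrite /ty in fy *; rewrite /Tmove /Tshift fy // => /eqP.
  by rewrite -subr_eq0 opprK subrK subr_eq0 => /eqP.
- apply/funext => k; apply/funext => m.
  have [xm|mx] := pselect (Xi m); last by rewrite restrict_out.
  rewrite restrict_in //; have [_ fx _] := TFs0_supp (m - n - evec ord0) Ff.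
  rewrite /tx in fx *; rewrite /Tmove /Tshift fx //.
  by move: xm nO; rewrite Xi_lev !OmegaB_lev lv; lia.
- apply/funext => m; have [Om|mO] := pselect (OmB m); last by rewrite restrict_out.
  rewrite restrict_in //; have [_ _ fu] := TFs0_supp (m - n - evec ord0) Ff.
  rewrite /tu in fu *; rewrite /Tmove /Tshift fu //.
  by move: Om nO; rewrite !OmegaB_lev lv; lia.
Qed.

Lemma hip_Om0 t s : hset TOm t -> hset TOm s -> s.1.2 = 0 -> hip TOm t s =
  usum (~` OmB) (fun n => hip Es (t.1.1 n) (s.1.1 n)) +
  usum OmB (fun n => hip E (t.2 n) (s.2 n)).
Proof.
move=> [[_ ht] _] _ s0.
rewrite -[LHS]/(usum (~` OmB) (fun n => hip Es (t.1.1 n) (s.1.1 n)) +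
  hip (hdsum setT (fun k => ell2 Xi (Y k))) t.1.2 s.1.2 +
  usum OmB (fun n => hip E (t.2 n) (s.2 n))).
rewrite s0 hip0r ?addr0 //.
by apply: hdsum_fin_hilbert => k; apply: hdsum_hilbert => i _; case: hU.
Qed.

(** The vectors (0, 0, delta_n e) and (delta_n e_*, 0, 0) exhaust the U^n F
    and U^n F_* in question, so orthogonality to them says that the outer
    components vanish pointwise. *)
Lemma scattering_spaceE : scattering_space SOm OmB =
  [set t | [/\ hset TOm t, t.1.1 = 0 & t.2 = 0]].
Proof.
have z3 (W : lmodType R[i]) (H : hspace W) (A : set (Zd d)) : is_hilbert H ->
    hset (ell2 A H) 0 by move=> hH; apply: hset0; apply: hdsum_hilbert.
have hY k : is_hilbert (Y k) by case: hU.
apply/seteqP; split=> t /=.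
  move=> [ht hF hFs]; have /spaceTOm_hset[h1 h2 h3] := ht; split=> //.
  - apply/funext => n; have [nO|On] := pselect ((~` OmB) n); last exact: hdsum_out h1 On.
    have hn := hdsum_hset h1 nO; apply: (hip_eq0 hEs hn).
    pose s : VOm := (single (- evec ord0) (t.1.1 n), 0, 0).
    have mO : (~` OmB) (- evec ord0).
      by rewrite /setC /= OmegaB_lev -[- _]add0r levBE lev0; lia.
    have hs' : hset TOm s.
      by apply/spaceTOm_hset; split=> [|k|]; [exact: single_hset|exact: z3|exact: z3].
    have [hx ex] := uinvP uPhi hs'; set xi := uinv _ _ _ in hx ex.
    have val m : (~` OmB) m -> ty xi m = single (- evec ord0) (t.1.1 n) m.
      by move=> mo; have := congr1 (fun p => p.1.1 m) ex; rewrite /= restrict_in.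
    have Fxi : TFs0 E Es U xi.
      split=> // m Am.
      - by have := congr1 (fun p => p.2 m) ex; rewrite /= restrict_in.
      - apply/funext => k; have := congr1 (fun p => p.1.2 k m) ex.
        by rewrite /= restrict_in.
      - by move=> mn; rewrite val // single_off.
    have := hFs n _ nO; move/(_ (Phi (Tshift ord0 xi))); rewrite Phi_TFs //.
    rewrite val // single_at => /(_ _); rewrite hip_Om0 //; last first.
      by apply/spaceTOm_hset; split=> [|k|]; [exact: single_hset|exact: z3|exact: z3].
    rewrite /= (usum1 nO); last first.
      by move=> m Am mn; rewrite single_off // (hip0r hEs) //; apply: hdsum_hset h1 Am.
    rewrite usum0 ?addr0; last first.
      by move=> m Am; rewrite (hip0r hE) //; apply: hdsum_hset h3 Am.
    by rewrite single_at; apply; exists (Tshift ord0 xi) => //; exists xi.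
  - apply/funext => n; have [On|nO] := pselect (OmB n); last exact: hdsum_out h3 nO.
    have hn := hdsum_hset h3 On; apply: (hip_eq0 hE hn).
    pose s : VOm := (0, 0, single 0 (t.2 n)).
    have O0 : OmB 0 by rewrite OmegaB_lev lev0.
    have hs' : hset TOm s.
      by apply/spaceTOm_hset; split=> [|k|]; [exact: z3|exact: z3|exact: single_hset].
    have [hx ex] := uinvP uPhi hs'; set xi := uinv _ _ _ in hx ex.
    have val m : OmB m -> tu xi m = single 0 (t.2 n) m.
      by move=> mo; have := congr1 (fun p => p.2 m) ex; rewrite /= restrict_in.
    have Fxi : TF E Es U xi.
      split=> // m Am.
      - by move=> mn; rewrite val // single_off.
      - apply/funext => k; have := congr1 (fun p => p.1.2 k m) ex.
        by rewrite /= restrict_in.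
      - by have := congr1 (fun p => p.1.1 m) ex; rewrite /= restrict_in.
    have := hF n (Phi xi) On; rewrite Phi_TF // val // single_at hip_Om0 //; last first.
      by apply/spaceTOm_hset; split=> [|k|]; [exact: z3|exact: z3|exact: single_hset].
    rewrite /= (usum1 On); last first.
      by move=> m Am mn; rewrite single_off // (hip0r hE) //; apply: hdsum_hset h3 Am.
    rewrite usum0 ?add0r; last first.
      by move=> m Am; rewrite (hip0r hEs) //; apply: hdsum_hset h1 Am.
    by rewrite single_at; apply; exists xi.
move=> [ht t1 t2]; split=> // n f An.
  move=> [g Fg <-]; have [hg _ _ _] := Fg; rewrite Phi_TF //.
  have hu : hset E (tu g 0) by have [tr _] := hg; case: (traj_hset 0 tr).
  rewrite hip_Om0 //; last first.
    by apply/spaceTOm_hset; split=> [|k|]; [exact: z3|exact: z3|exact: single_hset].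
  rewrite t1 t2 /= !usum0 ?addr0 // => m _; first by rewrite (hip0l hE) //; apply: hset_delta0.
  by rewrite (hip0l hEs) //; exact: hset0.
move=> [_ [g Fg <-] <-]; have [hg _ _ _] := Fg; rewrite Phi_TFs //.
have hy : hset Es (ty g (- evec ord0)) by have [tr _] := hg; case: (traj_hset (- evec ord0) tr).
rewrite hip_Om0 //; last first.
  by apply/spaceTOm_hset; split=> [|k|]; [exact: single_hset|exact: z3|exact: z3].
rewrite t1 t2 /= !usum0 ?addr0 // => m _; first by rewrite (hip0l hE) //; exact: hset0.
by rewrite (hip0l hEs) //; apply: hset_delta0.
Qed.

End Systems.

(** * The scattering space in functional form *)

Section Embedding.
Variables (R : realType) (d : nat) (VG VE VEs : lmodType R[i]).
Variables (E : hspace VE) (Es : hspace VEs).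
Variable U : colligation d (Zd d -> VG) VE VEs.
Hypothesis (hE : is_hilbert E) (hEs : is_hilbert Es) (hU : GR_unitary E Es U).
Local Notation Y := (cspace U).
Local Notation Xi := (@Xi d).
Local Notation TOm := (spaceTOm E Es U).

Lemma zmulK n (f : Zd d -> VG) : zmul (- n) (zmul n f) = f.
Proof. by apply/funext => m; rewrite /zmul opprK addrK. Qed.

Lemma zmulNK n (f : Zd d -> VG) : zmul n (zmul (- n) f) = f.
Proof. by apply/funext => m; rewrite /zmul opprK subrK. Qed.

Lemma zmulH_hset n (H : hspace (Zd d -> VG)) f :
  hset (zmulH n H) f <-> hset H (zmul (- n) f).
Proof.
split=> [[g hg <-]|h]; first by rewrite zmulK.
by exists (zmul (- n) f) => //; rewrite zmulNK.
Qed.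

Let Xin k : hspace (Zd d -> Zd d -> VG) := hdsum Xi (fun n => zmulH n (Y k)).

Let Xin_hset k (f : Zd d -> Zd d -> VG) :
  hset (Xin k) f <-> hset (ell2 Xi (Y k)) (fun n => zmul (- n) (f n)).
Proof.
split=> [[h1 h2 h3]|[h1 h2 h3]]; split=> //.
- by move=> n xn; apply/zmulH_hset; apply: h1.
- by move=> n nx; rewrite h2 //; apply/funext.
- by move=> n xn; apply/zmulH_hset; apply: h1.
- by move=> n nx; rewrite -[f n](zmulNK n) h2 //; apply/funext.
Qed.

(** Multiplication by z^(-n) identifies z^n H(K_k) with H(K_k), and so the
    direct sum over Xi with l^2(Xi, H(K_k)), the middle component of the space
    of data. *)
Lemma embedding_unitary : unitary (hdsum setT Xin)
  (hsub TOm (scattering_space (system_Om E Es U) (@OmegaB d)))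
  (@scattering_embedding R d VG VE VEs).
Proof.
rewrite (scattering_spaceE hE hEs hU).
have hY k : is_hilbert (Y k) by case: hU.
have z3 (W : lmodType R[i]) (H : hspace W) (A : set (Zd d)) : is_hilbert H ->
    hset (ell2 A H) 0 by move=> hH; apply: hset0; apply: hdsum_hilbert.
split.
- move=> f [hf _ _]; split=> //; apply/spaceTOm_hset; split=> /=.
  + exact: z3.
  + by move=> k; apply/Xin_hset; apply: hf.
  + exact: z3.
- move=> a f g _ _; rewrite -[RHS]/(a *: 0 + 0, _, a *: 0 + 0) scaler0 addr0.
  by rewrite scaler0 addr0.
- move=> t /= [/spaceTOm_hset[_ h2 _] t1 t2].
  exists (fun k n => zmul n (t.1.2 k n)); last first.
    rewrite /scattering_embedding [RHS]surjective_pairing [t.1]surjective_pairing t1 t2.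
    by congr (_, _, _); apply/funext => k; apply/funext => n; rewrite zmulK.
  have hX k : hset (Xin k) (fun n => zmul n (t.1.2 k n)).
    apply/Xin_hset; have := h2 k; congr (hset (ell2 _ _)).
    by apply/funext => n; rewrite zmulK.
  split=> [k _|k|]; [exact: hX|by []|].
  have [_ _] := hdsum_fin_hset (H := fun k => ell2 Xi (Y k)) h2.
  congr (_ < _)%E; apply: eq_esum => k _; congr (_ ^+ 2)%:E.
  rewrite /hnorm; congr (Num.sqrt (complex.Re _)).
  by apply: usum_eq => n _; rewrite /= zmulK.
- move=> f g _ _.
  rewrite -[LHS]/(usum (~` @OmegaB d) (fun=> hip Es 0 0) + hip (hdsum setT Xin) f g +
    usum (@OmegaB d) (fun=> hip E 0 0)).
  rewrite (hip0l hE (hset0 hE)) (hip0l hEs (hset0 hEs)).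
  by rewrite [X in X + _ + _]usum0 // [X in _ + X]usum0 // add0r addr0.
Qed.

End Embedding.

(** * Equivalent colligations have equivalent scattering systems *)

Section Equivalence.
Variables (R : realType) (d : nat) (VE VEs V V' : lmodType R[i]).
Variables (E : hspace VE) (Es : hspace VEs).
Variables (U : colligation d V VE VEs) (U' : colligation d V' VE VEs).
Variable tau : 'I_d.+1 -> V -> V'.
Hypothesis (hE : is_hilbert E).
Hypothesis (hU : GR_unitary E Es U) (hU' : GR_unitary E Es U').
Hypothesis ut : forall k, unitary (cspace U k) (cspace U' k) (tau k).
Local Notation Tau := (fun (x : 'I_d.+1 -> V) k => tau k (x k)).
Hypothesis hcmap : forall x e, hset (state U) x -> hset E e ->
  cmap U' (Tau x, e) = (Tau (cmap U (x, e)).1, (cmap U (x, e)).2).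

Let hY k : is_hilbert (cspace U k). Proof. by case: hU. Qed.
Let hTau x : hset (state U) x -> hset (state U') (Tau x).
Proof. by move/stateP => h; apply: hdsum_fin_hset => k; apply: (unitary_hset (ut k)). Qed.

Let Tau_hip x y : hset (state U) x -> hset (state U) y ->
  hip (state U') (Tau x) (Tau y) = hip (state U) x y.
Proof.
move=> /stateP hx /stateP hy; rewrite !hdsum_fin_hip; apply: eq_bigr => k _.
exact: (unitary_hip (ut k)).
Qed.

Definition traj_map (xi : Zd d -> VE * ('I_d.+1 -> V) * VEs) n : VE * ('I_d.+1 -> V') * VEs :=
  (tu xi n, Tau (tx xi n), ty xi n).

Lemma traj_map_hset xi : hset (spaceT E Es U) xi -> hset (spaceT E Es U') (traj_map xi).
Proof.
move=> [tr [a1 a2 a3]]; split; last first.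
  split=> //; move: a2; congr (_ < _)%E; apply: eq_esum => n _.
  rewrite /hnorm Tau_hip //; by case: (traj_hset n tr).
apply: (traj_of_step hE hU') => n; have [h1 h2 h3] := traj_hset n tr.
  by split=> //; apply: hTau.
by rewrite hcmap // (traj_step hE hU n tr).
Qed.

Lemma traj_map_hip xi xi' : hset (spaceT E Es U) xi -> hset (spaceT E Es U) xi' ->
  hip (spaceT E Es U') (traj_map xi) (traj_map xi') = hip (spaceT E Es U) xi xi'.
Proof.
move=> [tr _] [tr' _]; congr (_ + _ + _); apply: usum_eq => n _.
by apply: Tau_hip; [case: (traj_hset n tr)|case: (traj_hset n tr')].
Qed.

Lemma traj_map_linear : linear_on (spaceT E Es U) traj_map.
Proof.
move=> a xi xi' [tr _] [tr' _]; apply/funext => n; congr (_, _, _).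
have [_ /stateP hx _] := traj_hset n tr; have [_ /stateP hx' _] := traj_hset n tr'.
by apply/funext => k; apply: (unitary_lin (ut k)); [exact: hx|exact: hx'].
Qed.

Let Tau0 : Tau 0 = 0.
Proof. by apply/funext => k; apply: (lin0 (hY k) (unitary_lin (ut k))). Qed.

Lemma traj_map_TF xi : TF E Es U xi -> TF E Es U' (traj_map xi).
Proof.
move=> [h u0 x0 y0]; split=> //; first exact: traj_map_hset.
by move=> n xn; rewrite -Tau0 -(x0 n xn).
Qed.

Lemma traj_map_TFs0 xi : TFs0 E Es U xi -> TFs0 E Es U' (traj_map xi).
Proof.
move=> [h u0 x0 y0]; split=> //; first exact: traj_map_hset.
by move=> n xn; rewrite -Tau0 -(x0 n xn).
Qed.

End Equivalence.

Section ScatteringEquivalence.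
Variables (R : realType) (d : nat) (VE VEs V V' : lmodType R[i]).
Variables (E : hspace VE) (Es : hspace VEs).
Variables (U : colligation d V VE VEs) (U' : colligation d V' VE VEs).
Hypothesis (hE : is_hilbert E).
Hypothesis (hU : GR_unitary E Es U) (hU' : GR_unitary E Es U').

(** The equivalence acts on the states of a trajectory and leaves inputs and
    outputs alone; its inverse is given by the inverse equivalence. *)
Lemma scattering_equiv_of_colligation : colligation_equiv E U U' ->
  scattering_equiv (system_T E Es U) (system_T E Es U').
Proof.
move=> [tau /= [ut hc]]; have hY k : is_hilbert (cspace U k) by case: hU.
have hY' k : is_hilbert (cspace U' k) by case: hU'.
pose sig k := uinv (cspace U k) (tau k).
have us k : unitary (cspace U' k) (cspace U k) (sig k) := unitary_uinv (ut k) (hY k).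
have sigK x : hset (state U') x -> (fun k => tau k (sig k (x k))) = x.
  by move/stateP => hx; apply/funext => k; case: (uinvP (ut k) (hx k)).
have tauK x : hset (state U) x -> (fun k => sig k (tau k (x k))) = x.
  by move/stateP => hx; apply/funext => k; apply: (uinvK (ut k)).
have hsig x : hset (state U') x -> hset (state U) (fun k => sig k (x k)).
  by move/stateP => h; apply: hdsum_fin_hset => k; apply: (unitary_hset (us k)).
have hcs x e : hset (state U') x -> hset E e ->
    cmap U ((fun k => sig k (x k)), e) =
    ((fun k => sig k ((cmap U' (x, e)).1 k)), (cmap U' (x, e)).2).
  move=> hx he; have := hc _ e (hsig x hx) he; rewrite sigK // => -> /=.
  have [h1 _] := cmap_hset hU (hsig x hx) he.
  by rewrite tauK // -surjective_pairing.
have mapK xi : hset (spaceT E Es U') xi -> traj_map tau (traj_map sig xi) = xi.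
  move=> [tr _]; apply/funext => n; rewrite /traj_map /tx /= sigK.
    by rewrite [RHS]surjective_pairing [(xi n).1]surjective_pairing.
  by case: (traj_hset n tr).
have hm := traj_map_hset hE hU hU' ut hc; have hm' := traj_map_hset hE hU' hU us hcs.
exists (traj_map tau); split=> //.
- split; [exact: hm|exact: traj_map_linear|move=> xi hxi|exact: traj_map_hip].
  by exists (traj_map sig xi); [exact: hm'|exact: mapK].
- apply/seteqP; split=> [_ [xi Fxi <-]|xi Fxi]; first exact: (traj_map_TF hE hU hU').
  exists (traj_map sig xi); first exact: (traj_map_TF hE hU' hU).
  by apply: mapK; case: Fxi.
- apply/seteqP; split=> [_ [_ [xi Fxi <-] <-]|_ [xi Fxi <-]].
    by exists (traj_map tau xi) => //; exact: (traj_map_TFs0 hE hU hU').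
  exists (Tshift ord0 (traj_map sig xi)).
    by exists (traj_map sig xi) => //; exact: (traj_map_TFs0 hE hU' hU).
  by rewrite -[LHS]/(Tshift ord0 (traj_map tau (traj_map sig xi))) mapK //; case: Fxi.
Qed.

End ScatteringEquivalence.

Theorem theorem8p1 (R : realType) (d : nat) (VE VEs : lmodType R[i])
    (E : hspace VE) (Es : hspace VEs)
    (S : 'rV[R[i]]_d.+1 -> VE -> VEs) (Sn : Zd d -> VE -> VEs)
    (K : 'I_d.+1 -> kernel d (VEs * VE)%type)
    (hE : is_hilbert E) (hEs : is_hilbert Es)
    (hS : schur_class E Es S) (hSn : taylor_series E Es S Sn)
    (hK : augmented_agler_decomposition E Es Sn K)
    (hKscc : strictly_closely_connected E Es K) :
  [/\ spaceD E Es Sn K = hset (hprod (hdsum setT (HK E Es K)) E),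
      spaceR E Es Sn K = hset (hprod (hdsum setT (HK E Es K)) Es)
    & exists V, is_V E Es Sn K V] /\
  forall V, is_V E Es Sn K V ->
    let U := Colligation (HK E Es K) V in
    [/\ GR_unitary E Es U,
        realizes E U S,
        compatible E Es U K,
        closely_connected E Es U
      & forall (W : lmodType R[i]) (U' : colligation d W VE VEs),
          GR_unitary E Es U' -> realizes E U' S -> compatible E Es U' K ->
          closely_connected E Es U' ->
          colligation_equiv E U U' /\
          scattering_equiv (system_T E Es U) (system_T E Es U')] /\
    [/\ scattering_system (system_Om E Es U),
        unitary (spaceT E Es U) (spaceTOm E Es U) (@PhiOm _ _ _ _ _),
        scattering_equiv (system_Om E Es U) (system_T E Es U),
        forall k t, hset (spaceTOm E Es U) t ->
          adj (spaceTOm E Es U) (spaceTOm E Es U) (sU (system_Om E Es U) k) t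
            = model_shift_adj U k t
      & unitary
          (hdsum setT (fun k => hdsum (@Xi d) (fun n => zmulH n (HK E Es K k))))
          (hsub (spaceTOm E Es U) (scattering_space (system_Om E Es U) (@OmegaB d)))
          (@scattering_embedding R d _ VE VEs)].
Proof.
have bSn n : bounded_op E Es (Sn n) by case: hSn.
have hD := spaceD_full hE hEs bSn hK hKscc.
split; first by split; [exact: hD|exact: spaceR_full|exact: V_exists].
move=> V0 hV U; have hU := model_GR hE hEs bSn hK hKscc hV.
split; split.
- exact: hU.
- apply: (realizes_of_transfer hE hEs hS hSn hU) => n e he.
  exact: (model_transfer hE hEs bSn hK hKscc hV).
- exact: (model_compatible hE hEs bSn hK hKscc hV).
- exact: (model_closely_connected hE hEs bSn hK hKscc hV).
- move=> W U' hU' hr hc hcc.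
  have htr := transfer_of_realizes hE hEs hS hSn hU' hr.
  have eqv : colligation_equiv E U U' by exact: model_equiv hV.
  by split=> //; exact: scattering_equiv_of_colligation.
- exact: system_Om_scattering.
- exact: PhiOm_unitary.
- exact: system_Om_equiv.
- by move=> k t; exact: system_Om_adj.
- exact: (embedding_unitary hE hEs hU).
Qed.
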